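(* Let $\Omega\subset\mathbb{R}^d$ be a bounded Lipschitz domain and let $u,v\in H^1_0(\Lambda)$ for some bounded set $\Lambda$ containing $\Omega$. Then $$\lim_{s\to\frac12^-}e_s(u,v)=e(u,v).$$
   Context: Functions in $H_0^1(\Lambda)$ are extended by zero to $\mathbb{R}^d$. $\Omega^c=\mathbb{R}^d\setminus\Omega$, $Q_\Omega=(\mathbb{R}^d\times\mathbb{R}^d)\setminus(\Omega^c\times\Omega^c)$. For $s\in(0,1/2)$: $G_s(\rho)=\int_0^\rho(1+r^2)^{-(d+1+2s)/2}dr$, $C_{d,s}=\frac{1-2s}{\alpha_d}$ with $\alpha_d$ the volume of the $d$-dimensional unit ball, $d_w(x,y)=\frac{w(x)-w(y)}{|x-y|}$ for any function $w$, and $$e_s(u,v)=\left(C_{d,s}\iint_{Q_\Omega}\big(G_s(d_u(x,y))-G_s(d_v(x,y))\big)\frac{d_{u-v}(x,y)}{|x-y|^{d-1+2s}}\,dx\,dy\right)^{1/2}.$$ For $\mathbf{a}\in\mathbb{R}^d$, $Q(\mathbf{a})=\sqrt{1+|\mathbf{a}|^2}$ and $\widehat\nu(\mathbf{a})=\frac{(\mathbf{a},-1)}{Q(\mathbf{a})}\in\mathbb{R}^{d+1}$, and $$e(u,v)=\left(\int_\Omega\big|\widehat\nu(\nabla u)-\widehat\nu(\nabla v)\big|^2\,\frac{Q(\nabla u)+Q(\nabla v)}{2}\,dx\right)^{1/2}.$$ *)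

(* Defs.v *)
From HB Require Import structures.
From mathcomp Require Import all_boot all_order all_algebra.
From mathcomp Require Import all_classical all_reals all_analysis.

Set Implicit Arguments.
Unset Strict Implicit.
Unset Printing Implicit Defensive.

Import Order.TTheory GRing.Theory Num.Theory.
Import numFieldNormedType.Exports.

Local Open Scope classical_set_scope.
Local Open Scope ring_scope.

(* 'rV[R]_n carries the sigma-algebra generated by the coordinates, which is
   the Borel one, and Lebesgue measure is the iterated product of the
   one-dimensional measure, see lebesgue_rV_box for its value on boxes. *)

Definition rV_display : measure_display.
Proof. exact: default_measure_display. Qed.

Definition coor (R : realType) n (i : 'I_n) (v : 'rV[R]_n) : R := v ord0 i.

Section measurable_rV.
Context (R : realType) (n : nat).

Let rV_set0 : g_sigma_preimage (@coor R n) set0.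
Proof. exact: sigma_algebra0. Qed.

Let rV_setC A : g_sigma_preimage (@coor R n) A ->
  g_sigma_preimage (@coor R n) (~` A).
Proof. exact: sigma_algebraC. Qed.

Let rV_bigcup (F : (set 'rV[R]_n)^nat) :
  (forall i, g_sigma_preimage (@coor R n) (F i)) ->
  g_sigma_preimage (@coor R n) (\bigcup_i (F i)).
Proof. exact: sigma_algebra_bigcup. Qed.

HB.instance Definition _ := @isMeasurable.Build rV_display
  'rV[R]_n (g_sigma_preimage (@coor R n)) rV_set0 rV_setC rV_bigcup.

End measurable_rV.

Lemma measurable_coor (R : realType) n (i : 'I_n) :
  measurable_fun [set: 'rV[R]_n] (@coor R n i).
Proof.
move=> _ Y mY; rewrite setTI; apply: sub_sigma_algebra => /=.
rewrite -bigcup_seq/=; exists i => /=; first by rewrite mem_index_enum.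
by exists Y => //; rewrite setTI.
Qed.

Lemma measurable_fun_rV d (T : measurableType d) (R : realType) n
    (f : T -> 'rV[R]_n) :
  (forall i, measurable_fun [set: T] (@coor R n i \o f)) ->
  measurable_fun [set: T] f.
Proof.
move=> mf _ Y mY.
suff : g_sigma_preimage (@coor R n) `<=` [set A | measurable (setT `&` f @^-1` A)].
  exact.
apply: smallest_sub.
  split => /=.
  - by rewrite preimage_set0 setI0; exact: measurable0.
  - move=> A; rewrite !setTI => mA.
    by rewrite setTD preimage_setC; exact: measurableC.
  - move=> F mF; rewrite setTI preimage_bigcup; apply: bigcup_measurable => k _.
    by rewrite -[X in measurable X]setTI; exact: mF.
move=> A; rewrite -bigcup_seq/= => -[i _ [B mB <-]] /=.
by rewrite !setTI -comp_preimage -[X in measurable X]setTI; exact: mf.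
Qed.

Definition rV_cons (R : realType) n (p : measurableTypeR R * 'rV[R]_n) : 'rV[R]_n.+1 :=
  row_mx p.1%:M p.2.

Definition rV_uncons (R : realType) n (v : 'rV[R]_n.+1) : measurableTypeR R * 'rV[R]_n :=
  (v ord0 ord0, \row_i v ord0 (lift ord0 i)).

Lemma coor_rV_cons0 (R : realType) n (p : measurableTypeR R * 'rV[R]_n) :
  coor ord0 (rV_cons p) = p.1.
Proof.
have e : lshift n (ord0 : 'I_1) = ord0 :> 'I_n.+1 by exact/val_inj.
rewrite /coor /rV_cons -e (row_mxEl p.1%:M p.2 ord0 (ord0 : 'I_1)).
by rewrite mxE eqxx mulr1n.
Qed.

Lemma coor_rV_consS (R : realType) n (p : measurableTypeR R * 'rV[R]_n) (i : 'I_n) :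
  coor (lift ord0 i) (rV_cons p) = coor i p.2.
Proof.
have e : rshift 1 i = lift ord0 i :> 'I_n.+1 by exact/val_inj.
by rewrite /coor /rV_cons -e (row_mxEr p.1%:M p.2 ord0 i).
Qed.

Lemma rV_consK (R : realType) n : cancel (@rV_cons R n) (@rV_uncons R n).
Proof.
move=> p; rewrite [RHS]surjective_pairing; congr (_, _).
  exact: coor_rV_cons0.
by apply/rowP => i; rewrite mxE; exact: coor_rV_consS.
Qed.

Lemma measurable_rV_cons (R : realType) n :
  measurable_fun [set: measurableTypeR R * 'rV[R]_n] (@rV_cons R n).
Proof.
apply: measurable_fun_rV => i; case: (unliftP ord0 i) => [j|] ->.
- rewrite (_ : _ \o _ = coor j \o snd).
    by apply: measurableT_comp => //; exact: measurable_coor.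
  by apply/funext => p /=; exact: coor_rV_consS.
- rewrite (_ : _ \o _ = fst)//.
  by apply/funext => p /=; exact: coor_rV_cons0.
Qed.

Lemma measurable_rV_uncons (R : realType) n :
  measurable_fun [set: 'rV[R]_n.+1] (@rV_uncons R n).
Proof.
apply: measurable_fun_pair; first exact: (measurable_coor ord0).
apply: measurable_fun_rV => i.
rewrite (_ : _ \o _ = coor (lift ord0 i)); first exact: measurable_coor.
by apply/funext => v /=; rewrite /coor mxE.
Qed.

Lemma sigma_finite_product_measure d1 d2 (T1 : measurableType d1)
    (T2 : measurableType d2) (R : realType)
    (m1 : {sigma_finite_measure set T1 -> \bar R})
    (m2 : {sigma_finite_measure set T2 -> \bar R}) :
  sigma_finite setT (m1 \x m2)%E.
Proof.
have /sigma_finiteP[F [TF ndF Foo]] := sigma_finiteT m1.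
have /sigma_finiteP[G [TG ndG Goo]] := sigma_finiteT m2.
exists (fun n => F n `*` G n).
  rewrite -setXTT TF TG; apply/seteqP; split => [[x y]|[x y]]; last first.
    by move=> [n _ [/= Fx Gy]]; split; exists n.
  move=> [/= [n _ Fnx] [k _ Gky]]; exists (maxn n k) => //; split.
  - by move: x Fnx; exact/subsetPset/ndF/leq_maxl.
  - by move: y Gky; exact/subsetPset/ndG/leq_maxr.
move=> k; have [? ?] := Foo k; have [? ?] := Goo k.
split; first exact: measurableX.
by rewrite product_measure1E// lte_mul_pinfty// ge0_fin_numE.
Qed.

Definition lebesgue_rVS (R : realType) n
    (m : {sigma_finite_measure set 'rV[R]_n -> \bar R}) :
    set 'rV[R]_n.+1 -> \bar R :=
  pushforward (lebesgue_measure \x m)%E (@rV_cons R n).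

Section lebesgue_rVS_measure.
Context (R : realType) (n : nat).
Variable m : {sigma_finite_measure set 'rV[R]_n -> \bar R}.

HB.instance Definition _ := Measure.copy (lebesgue_rVS m)
  (measure_function_pushforward__canonical__measure_function_Measure
     (lebesgue_measure \x m)%E (@measurable_rV_cons R n)).

Let sigma_finite_lebesgue_rVS : sigma_finite setT (lebesgue_rVS m).
Proof.
have [F TF mF] := sigma_finite_product_measure
  (lebesgue_measure : {sigma_finite_measure set (measurableTypeR R) -> \bar R}) m.
exists (fun k => @rV_uncons R n @^-1` F k).
  by rewrite -preimage_bigcup -TF preimage_setT.
move=> k; have [mFk Fkoo] := mF k; split.
  by rewrite -[X in measurable X]setTI; exact: measurable_rV_uncons.
rewrite /lebesgue_rVS /pushforward -comp_preimage.
by rewrite (_ : _ \o _ = id) ?preimage_id//; apply/funext; exact: rV_consK.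
Qed.

HB.instance Definition _ := Measure_isSigmaFinite.Build _ _ _ (lebesgue_rVS m)
  sigma_finite_lebesgue_rVS.

End lebesgue_rVS_measure.

Fixpoint lebesgue_rV (R : realType) (n : nat) :
    {sigma_finite_measure set 'rV[R]_n -> \bar R} :=
  if n is k.+1 then lebesgue_rVS (lebesgue_rV R k) else \d_ (0 : 'rV[R]_0).

Lemma lebesgue_rV_box (R : realType) n (a b : 'rV[R]_n) :
  (forall i, a ord0 i <= b ord0 i) ->
  lebesgue_rV R n [set v | forall i, v ord0 i \in `]a ord0 i, b ord0 i]] =
  (\prod_i (b ord0 i - a ord0 i))%:E.
Proof.
elim: n a b => [|n IHn] a b ab.
  rewrite big_ord0 /= diracE mem_set//=; last by case.
pose a' : 'rV[R]_n := \row_i a ord0 (lift ord0 i).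
pose b' : 'rV[R]_n := \row_i b ord0 (lift ord0 i).
rewrite /= /lebesgue_rVS /pushforward.
have -> : @rV_cons R n @^-1`
    [set v | forall i, v ord0 i \in `]a ord0 i, b ord0 i]] =
    `]a ord0 ord0, b ord0 ord0] `*`
    [set v : 'rV[R]_n | forall i, v ord0 i \in `]a' ord0 i, b' ord0 i]].
  apply/seteqP; split => -[x v] /=.
    move=> abp; split; first by have := abp ord0; rewrite [_ _ ord0]coor_rV_cons0.
    by move=> i; have := abp (lift ord0 i); rewrite [_ _ (lift _ _)]coor_rV_consS !mxE.
  move=> [abx abv] i; case: (unliftP ord0 i) => [j|] ->.
    by have := abv j; rewrite [X in _ -> X \in _]coor_rV_consS !mxE.
  by rewrite [X in X \in _]coor_rV_cons0.
rewrite product_measure1E//=.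
- rewrite IHn; last by move=> i; rewrite !mxE.
  rewrite lebesgue_measure_itv/= lte_fin big_ord_recl EFinM.
  under eq_bigr do rewrite !mxE.
  by case: ltgtP (ab ord0) => // -> _; rewrite subrr mul0e.
- rewrite (_ : [set _ | _] = \bigcap_(i in [set: 'I_n])
      (@coor R n i @^-1` `]a' ord0 i, b' ord0 i])); last first.
    by apply/seteqP; split => v /= h i; [move=> _|]; exact: h.
  apply: fin_bigcap_measurable => // i _.
  by rewrite -[X in measurable X]setTI; exact: measurable_coor.
Qed.

(* `|x| on 'rV[R]_d is the sup norm, hence this separate Euclidean norm. *)

Definition dotv (R : realType) d (x y : 'rV[R]_d) : R :=
  \sum_(i < d) x ord0 i * y ord0 i.

Definition enorm (R : realType) d (x : 'rV[R]_d) : R := Num.sqrt (dotv x x).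

Definition partial (R : realType) d (i : 'I_d) (f : 'rV[R]_d -> R) :
    'rV[R]_d -> R :=
  fun x => 'D_(delta_mx ord0 i) f x.

Definition gradient (R : realType) d (f : 'rV[R]_d -> R) (x : 'rV[R]_d) :
    'rV[R]_d :=
  \row_i partial i f x.

Fixpoint class_C (R : realType) d (k : nat) (f : 'rV[R]_d -> R) : Prop :=
  continuous f /\
  if k is k'.+1 then
    forall i : 'I_d,
      (forall x, derivable f x (delta_mx ord0 i)) /\ class_C k' (partial i f)
  else True.

Definition supp (R : realType) d (f : 'rV[R]_d -> R) : set 'rV[R]_d :=
  closure [set x | f x != 0].

Definition Cc_infty (R : realType) d (A : set 'rV[R]_d) (f : 'rV[R]_d -> R) :=
  [/\ forall k, class_C k f, compact (supp f) & supp f `<=` A].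

Definition L2 (R : realType) d (f : 'rV[R]_d -> R) : Prop :=
  f \in Lfun (lebesgue_rV R d) 2%:E.

Definition is_weak_gradient (R : realType) d (u : 'rV[R]_d -> R)
    (g : 'rV[R]_d -> 'rV[R]_d) : Prop :=
  forall i : 'I_d,
    L2 (fun x => g x ord0 i) /\
    forall phi, Cc_infty setT phi ->
      \int[lebesgue_rV R d]_x (u x * partial i phi x) =
      - \int[lebesgue_rV R d]_x (g x ord0 i * phi x).

Definition H1 (R : realType) d (u : 'rV[R]_d -> R) : Prop :=
  L2 u /\ exists g, is_weak_gradient u g.

(* The weak gradient is unique up to a null set; we choose a representative. *)
Definition weak_gradient (R : realType) d (u : 'rV[R]_d -> R) :
    'rV[R]_d -> 'rV[R]_d :=
  xget (fun=> 0) [set g | is_weak_gradient u g].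

(* Closure of C_c^oo(A) in H^1(R^d): its elements are functions on the whole
   space, already extended by zero outside A. *)
Definition H10 (R : realType) d (A : set 'rV[R]_d) (u : 'rV[R]_d -> R) : Prop :=
  [/\ H1 u,
      {ae lebesgue_rV R d, forall x, ~ A x -> u x = 0} &
      forall eps : R, 0 < eps -> exists2 phi, Cc_infty A phi &
        (\int[lebesgue_rV R d]_x
           ((u x - phi x) ^+ 2 +
            enorm (weak_gradient u x - gradient phi x) ^+ 2)%:E < eps%:E)%E].

(* Near each boundary point, Omega is the strict epigraph, in the direction of
   a unit vector e, of a Lipschitz function of the orthogonal projection on the
   hyperplane e^\perp (which plays the role of R^(d-1)). *)
Definition lipschitz_boundary (R : realType) d (Omega : set 'rV[R]_d) : Prop :=
  forall x0, (closure Omega `\` Omega°) x0 ->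
    exists (r : R) (e : 'rV[R]_d) (gamma : 'rV[R]_d -> R),
      [/\ 0 < r, enorm e = 1, lipschitz gamma &
          forall y, enorm (y - x0) < r ->
            (Omega y <-> gamma (y - dotv y e *: e) < dotv y e)].

Definition lipschitz_domain (R : realType) d (Omega : set 'rV[R]_d) : Prop :=
  [/\ Omega !=set0, open Omega, connected Omega & lipschitz_boundary Omega].

Definition Gs (R : realType) (d : nat) (s rho : R) : R :=
  let f r := (1 + r ^+ 2) `^ (- (d%:R + 1 + 2 * s) / 2) in
  if 0 <= rho then \int[lebesgue_measure]_(r in `[0, rho]) f r
  else - \int[lebesgue_measure]_(r in `[rho, 0]) f r.

Definition ball_volume (R : realType) (d : nat) : R :=
  fine (lebesgue_rV R d [set x | enorm x < 1]).

Definition Cds (R : realType) (d : nat) (s : R) : R :=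
  (1 - 2 * s) / ball_volume R d.

Definition diffq (R : realType) d (w : 'rV[R]_d -> R) (x y : 'rV[R]_d) : R :=
  (w x - w y) / enorm (x - y).

Definition Qset (R : realType) d (Omega : set 'rV[R]_d) :
    set ('rV[R]_d * 'rV[R]_d) :=
  ~` (~` Omega `*` ~` Omega).

(* e_s and e are extended-real valued, so that no convention is needed about
   divergent integrals of these nonnegative integrands. *)
Definition e_nonlocal (R : realType) d (Omega : set 'rV[R]_d) (s : R)
    (u v : 'rV[R]_d -> R) : \bar R :=
  (((Cds d s)%:E *
    \int[lebesgue_rV R d \x lebesgue_rV R d]_(p in Qset Omega)
      ((Gs d s (diffq u p.1 p.2) - Gs d s (diffq v p.1 p.2)) *
       (diffq (u \- v) p.1 p.2 /
        enorm (p.1 - p.2) `^ (d%:R - 1 + 2 * s)))%R%:E) `^ (1 / 2)%R)%E.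

Definition Qarea (R : realType) d (a : 'rV[R]_d) : R :=
  Num.sqrt (1 + enorm a ^+ 2).

Definition nu_hat (R : realType) d (a : 'rV[R]_d) : 'rV[R]_(d + 1) :=
  (Qarea a)^-1 *: row_mx a (-1)%:M.

Definition e_local (R : realType) d (Omega : set 'rV[R]_d)
    (u v : 'rV[R]_d -> R) : \bar R :=
  ((\int[lebesgue_rV R d]_(x in Omega)
      (enorm (nu_hat (weak_gradient u x) - nu_hat (weak_gradient v x)) ^+ 2 *
       ((Qarea (weak_gradient u x) + Qarea (weak_gradient v x)) / 2))%R%:E)
    `^ (1 / 2)%R)%E.

(* Main.v *)
(* Substituting y = x + h, the squared energy becomes
     (1 - 2s) / alpha_d * int |h|^-(d-1+2s) Theta_s(h) dh,
   where Theta_s(h) is the integral over x of the monotone flux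
   (G_s(p) - G_s(q)) (p - q) evaluated at the difference quotients p, q of u, v.
   The kernel (1 - 2s) |h|^-(d-1+2s) concentrates at h = 0, where Theta_s(h)
   approaches its analogue Theta_0(h) with directional derivatives in place of
   difference quotients: G_s - G_{1/2} has Lipschitz constant (1 - 2s) / 2, the
   difference quotients of an H^1_0 function converge in L^2 by approximation
   with test functions, and the pairs (x, x + h) leaving the open set Omega
   contribute o(1). The limit is thus a spherical mean of Theta_0. The identity
     int_{S^{d-1}} (1 + (a.w)^2)^(-d/2) dw = d alpha_d / Q(a)
   is the volume of the ellipsoid |h|^2 + (a.h)^2 < 1 in polar coordinates;
   differentiating it in a and integrating along the ray t a yields
     int_{S^{d-1}} G_{1/2}(a.w) w dw = alpha_d a / Q(a). *)
Require Import Defs.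
From HB Require Import structures.
From mathcomp Require Import all_boot all_order all_algebra.
From mathcomp Require Import all_classical all_reals all_analysis.
From mathcomp Require Import measurable_realfun ring lra.

Set Implicit Arguments.
Unset Strict Implicit.
Unset Printing Implicit Defensive.

Import Order.TTheory GRing.Theory Num.Theory.
Import numFieldNormedType.Exports.
Local Open Scope classical_set_scope.
Local Open Scope ring_scope.

(** * Change of variables for [lebesgue_rV] *)

(** No surface measure on the sphere appears. A spherical mean is the integral over the punctured
    unit ball of a function constant on rays, which is 1/d times the integral over the sphere; each
    spherical identity thus carries its constant divided by d. Polar coordinates come from dilations
    and Tonelli alone.

    The h-integral is cut at |h| = delta. Beyond delta only the L^2 norm of u - v enters, and the
    factor 1 - 2s kills that part. Within delta, Theta_s is Theta_0 up to a constant rho. Both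
    Theta_0 and rho are constant on rays, so their integrals are explicit: (1 - 2s) int_0^delta
    r^(-2s) dr = delta^(1-2s). Hence delta is fixed first and s tends to 1/2 afterwards.

    The obstacle is the L^2 control of increments relative to |h|. A test function fixed in advance
    leaves an error in u that division by |h| amplifies. A second test function, whose accuracy
    depends on h, absorbs it, because increments of the difference of two test functions are bounded
    by gradients alone. *)

Section affine.
Context (R : realType).
Local Notation leb := (@lebesgue_measure R).

Lemma ge0_integral_affine (a b : R) (f : R -> \bar R) : 0 < a ->
  measurable_fun [set: R] f -> (forall x, (0 <= f x)%E) ->
  (a%:E * \int[leb]_x f (a * x + b)%R = \int[leb]_x f x)%E.
Proof.
move=> a0 mf f0.
pose phi : measurableTypeR R -> measurableTypeR R := fun x => a * x + b.
have mphi : measurable_fun setT phi.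
  by apply: measurable_funD => //; exact: measurable_funM.
pose pf : {measure set measurableTypeR R -> \bar R} :=
  measure_function_pushforward__canonical__measure_function_Measure leb mphi.
pose aN : {nonneg R} := NngNum (ltW a0).
(* By uniqueness of Lebesgue measure it suffices to compare the two measures on half-open
   intervals. *)
have E : forall A, measurable A -> leb A = mscale aN pf A.
  apply: lebesgue_measure_unique => _ [[x y]] _ <-.
  change (leb [set` `]x, y]] = a%:E * leb (phi @^-1` [set` `]x, y]]))%E.
  rewrite (_ : phi @^-1` _ = `](x - b) / a, (y - b) / a]%classic); last first.
    apply/seteqP; split => z /=; rewrite !in_itv/= /phi => /andP[xz zy]; apply/andP; split.
    - by rewrite ltr_pdivrMr// ltrBlDr mulrC.
    - by rewrite ler_pdivlMr// lerBrDr mulrC.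
    - by move: xz; rewrite ltr_pdivrMr// ltrBlDr mulrC.
    - by move: zy; rewrite ler_pdivlMr// lerBrDr mulrC.
  rewrite !lebesgue_measure_itv/= !lte_fin ltr_pM2r ?invr_gt0// ltrD2r.
  case: ifPn => _; last by rewrite mule0.
  rewrite -EFinM; congr (_%:E).
  by field; rewrite gt_eqF.
rewrite [RHS](eq_measure_integral (mscale aN pf)); last by move=> A mA _; exact: E.
rewrite ge0_integral_mscale//; congr (_ * _)%E.
by rewrite ge0_integral_pushforward.
Qed.

End affine.

Section change_of_variables.
Context (R : realType).
Local Notation leb := (@lebesgue_measure R).

Lemma rV_consE0 n (p : measurableTypeR R * 'rV[R]_n) : rV_cons p 0 ord0 = p.1.
Proof. exact: coor_rV_cons0. Qed.

Lemma rV_consES n (p : measurableTypeR R * 'rV[R]_n) (i : 'I_n) :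
  rV_cons p 0 (lift ord0 i) = p.2 0 i.
Proof. exact: coor_rV_consS. Qed.

Lemma ge0_integral_rVS n (f : 'rV[R]_n.+1 -> \bar R) :
  measurable_fun setT f -> (forall x, (0 <= f x)%E) ->
  (\int[lebesgue_rV R n.+1]_x f x =
   \int[lebesgue_rV R n]_v \int[leb]_t f (rV_cons (t, v)))%E.
Proof.
move=> mf f0.
have mg : measurable_fun setT (f \o @rV_cons R n).
  by apply: measurableT_comp => //; exact: measurable_rV_cons.
transitivity (\int[leb \x lebesgue_rV R n]_x (f \o @rV_cons R n) x)%E.
  have := @ge0_integral_pushforward _ _ _ _ R _ (@measurable_rV_cons R n)
    (leb \x lebesgue_rV R n)%E _ _ measurableT mf (fun x _ => f0 x).
  by rewrite preimage_setT.
by rewrite fubini_tonelli2//= => x; exact: f0.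
Qed.

(** [c] plays the role of |det T|. As an integral identity, the Jacobian passes from dimension n to
    n+1 by Tonelli, without determinants or invertibility of [T]. *)
Definition volume_scaling n (c : R) (T : 'rV[R]_n -> 'rV[R]_n) :=
  measurable_fun setT T /\
  forall f : 'rV[R]_n -> \bar R, measurable_fun setT f ->
    (forall x, (0 <= f x)%E) ->
    (c%:E * \int[lebesgue_rV R n]_x f (T x) = \int[lebesgue_rV R n]_x f x)%E.

Lemma volume_scaling_ext n (c : R) (T T' : 'rV[R]_n -> 'rV[R]_n) :
  T =1 T' -> volume_scaling c T -> volume_scaling c T'.
Proof. by move=> /funext ->. Qed.

Lemma volume_scaling0 (T : 'rV[R]_0 -> 'rV[R]_0) : volume_scaling 1 T.
Proof.
have -> : T = id by apply/funext => x; apply/rowP; case.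
by split => // f mf f0; rewrite mul1e.
Qed.

(** A triangular map: with the other coordinates fixed, the first one undergoes an affine map of
    slope [a], which contributes [a] by the one-dimensional formula; [T] then contributes [c].
    Translations, dilations and the completion of the square are all built from this. *)
Lemma volume_scaling_cons n (c : R) (T : 'rV[R]_n -> 'rV[R]_n) (a : R)
    (g : 'rV[R]_n -> R) : 0 < a -> 0 < c -> measurable_fun setT g ->
  volume_scaling c T ->
  volume_scaling (a * c) (fun x => let p := rV_uncons x in
    rV_cons (a * p.1 + g p.2, T p.2)).
Proof.
move=> a0 c0 mg [mT ET].
have mS : measurable_fun setT (fun x : 'rV[R]_n.+1 => let p := rV_uncons x in
    rV_cons (a * p.1 + g p.2, T p.2)).
  apply: (measurableT_comp (@measurable_rV_cons R n)).
  have m1 : measurable_fun setT (fst \o @rV_uncons R n).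
    by apply: measurableT_comp => //; exact: measurable_rV_uncons.
  have m2 : measurable_fun setT (snd \o @rV_uncons R n).
    by apply: measurableT_comp => //; exact: measurable_rV_uncons.
  apply: measurable_fun_pair => /=.
    apply: measurable_funD; first exact: measurable_funM.
    exact: (measurableT_comp mg m2).
  exact: (measurableT_comp mT m2).
split=> // f mf f0.
rewrite ge0_integral_rVS//; last exact: measurableT_comp mf mS.
rewrite ge0_integral_rVS//.
have mfc : measurable_fun setT (f \o @rV_cons R n).
  by apply: measurableT_comp => //; exact: measurable_rV_cons.
have mfc2 v : measurable_fun setT (fun t : measurableTypeR R => f (rV_cons (t, v))).
  exact: (measurableT_comp mfc (pair2_measurable v)).
pose F v := (\int[leb]_t f (rV_cons (t, v)))%E.
have F0 v : (0 <= F v)%E by apply: integral_ge0 => t _; exact: f0.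
have mF : measurable_fun setT F.
  by apply: (measurable_fun_fubini_tonelli_G (f \o @rV_cons R n)) => //= x; exact: f0.
rewrite -[RHS](ET F mF F0).
under eq_integral => v _ do under eq_integral => t _ do rewrite rV_consK/=.
have aE v : (\int[leb]_t f (rV_cons ((a * t + g v)%R, T v)) = a^-1%:E * F (T v))%E.
  rewrite /F -[in RHS](ge0_integral_affine (g v) a0)//; last exact: mfc2.
  by rewrite muleA -EFinM mulVf ?gt_eqF// mul1e.
under eq_integral do rewrite aE.
rewrite ge0_integralZl//.
- rewrite muleA -EFinM mulrAC mulfV ?gt_eqF// mul1r//.
- exact: measurableT_comp mF mT.
- by rewrite lee_fin invr_ge0 ltW.
Qed.

Lemma volume_scaling_translation n (b : 'rV[R]_n) : volume_scaling 1 (+%R^~ b).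
Proof.
elim: n b => [|n IHn] b; first exact: volume_scaling0.
have := volume_scaling_cons ltr01 ltr01 (measurable_cst (b ord0 ord0))
  (IHn (\row_i b ord0 (lift ord0 i))).
rewrite mulr1; apply: volume_scaling_ext => x /=.
apply/rowP => i; case: (unliftP ord0 i) => [j|] ->.
  by rewrite rV_consES/= !mxE.
by rewrite rV_consE0/= mul1r mxE.
Qed.

Lemma volume_scaling_dilation n (t : R) : 0 < t ->
  volume_scaling (t ^+ n) (fun x : 'rV[R]_n => t *: x).
Proof.
move=> t0; elim: n => [|n IHn]; first exact: volume_scaling0.
have := volume_scaling_cons t0 (exprn_gt0 n t0) (measurable_cst (0 : R)) IHn.
rewrite exprS; apply: volume_scaling_ext => x /=.
apply/rowP => i; case: (unliftP ord0 i) => [j|] ->.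
  by rewrite rV_consES/= !mxE.
by rewrite rV_consE0/= addr0 mxE.
Qed.

Lemma measurable_dotv n (a : 'rV[R]_n) : measurable_fun setT (dotv a).
Proof.
apply: measurable_sum => i; apply: measurable_funM => //.
exact: measurable_coor.
Qed.

Lemma dotvS n (x y : 'rV[R]_n.+1) :
  dotv x y = (rV_uncons x).1 * (rV_uncons y).1 + dotv (rV_uncons x).2 (rV_uncons y).2.
Proof.
by rewrite /dotv big_ord_recl/=; congr (_ + _); apply: eq_bigr => i _; rewrite !mxE.
Qed.

Lemma dotvZl n (c : R) (x y : 'rV[R]_n) : dotv (c *: x) y = c * dotv x y.
Proof. by rewrite /dotv mulr_sumr; apply: eq_bigr => i _; rewrite mxE mulrA. Qed.

Lemma dotvC n (x y : 'rV[R]_n) : dotv x y = dotv y x.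
Proof. by apply: eq_bigr => i _; rewrite mulrC. Qed.

Lemma dotvv_ge0 n (x : 'rV[R]_n) : 0 <= dotv x x.
Proof. by apply: sumr_ge0 => i _; rewrite -expr2 sqr_ge0. Qed.

(* Completing the square in the first coordinate turns |h|^2 + (a.h)^2 into
   a square plus |h'|^2 + (a'.h')^2 / (1 + a_0^2), a form of the same type. *)
Lemma volume_scaling_quadratic n (a : 'rV[R]_n) :
  exists2 T, volume_scaling (Qarea a) T &
    forall h, dotv (T h) (T h) = dotv h h + dotv a h ^+ 2.
Proof.
have QE m (b : 'rV[R]_m) : Qarea b = Num.sqrt (1 + dotv b b).
  by rewrite /Qarea /enorm sqr_sqrtr// dotvv_ge0.
elim: n a => [|n IHn] a.
  exists id.
    rewrite (_ : Qarea a = 1); first exact: volume_scaling0.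
    by rewrite QE /dotv big_ord0 addr0 sqrtr1.
  by move=> h; rewrite /dotv !big_ord0 expr0n addr0.
pose a0 := (rV_uncons a).1; pose a' := (rV_uncons a).2.
pose k := Num.sqrt (1 + a0 ^+ 2).
have k2 : k ^+ 2 = 1 + a0 ^+ 2 by rewrite sqr_sqrtr// addr_ge0// sqr_ge0.
have k0 : 0 < k by rewrite sqrtr_gt0 ltr_pwDl// sqr_ge0.
have [T sT ET] := IHn (k^-1 *: a').
have Q0 : 0 < Qarea (k^-1 *: a') by rewrite QE sqrtr_gt0 ltr_pwDl// dotvv_ge0.
exists (fun x => let p := rV_uncons x in
    rV_cons (k * p.1 + a0 / k * dotv a' p.2, T p.2)).
  have -> : Qarea a = k * Qarea (k^-1 *: a').
    rewrite !QE -sqrtrM ?addr_ge0 ?sqr_ge0//; congr Num.sqrt.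
    rewrite dotvS dotvZl [dotv a' (_ *: _)]dotvC dotvZl -/a0 -/a'.
    rewrite -k2.
    have -> : a0 * a0 = k ^+ 2 - 1 by rewrite k2; ring.
    by field; rewrite gt_eqF.
  apply: (volume_scaling_cons (g := fun v => a0 / k * dotv a' v)) => //.
  by apply: measurable_funM => //; exact: measurable_dotv.
move=> h /=; rewrite dotvS rV_consK/= ET dotvZl.
rewrite (dotvS h h) (dotvS a h) -/a0 -/a'.
set h0 := (rV_uncons h).1; set h' := (rV_uncons h).2.
set A := dotv a' h'; set B := dotv h' h'.
apply/eqP; rewrite -subr_eq0.
have -> : (k * h0 + a0 / k * A) * (k * h0 + a0 / k * A) + (B + (k^-1 * A) ^+ 2) -
  (h0 * h0 + B + (a0 * h0 + A) ^+ 2) =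
  (k ^+ 2 - 1 - a0 ^+ 2) * (h0 ^+ 2 ) + A ^+ 2 * (a0 ^+ 2 + 1 - k ^+ 2) / k ^+ 2.
  by field; rewrite gt_eqF.
by rewrite k2; apply/eqP; ring.
Qed.

End change_of_variables.

(** * Integrals of powers near 0 and near infinity *)

Section power_integrals.
Context (R : realType).
Local Notation leb := (@lebesgue_measure R).

Lemma is_derive_powR_div (e x : R) : e != 0 -> 0 < x ->
  is_derive x 1 (fun r => r `^ e / e) (x `^ (e - 1)).
Proof.
move=> e0 x0.
have := is_deriveM (is_derive1_powR e x0) (is_derive_cst e^-1 x (1 : R)).
rewrite scaler0 add0r => h; apply: (is_derive_eq h).
by rewrite [_ *: _]mulrA mulVf// mul1r.
Qed.

Lemma integral_powR_itvcc (e a b : R) : e != 0 -> 0 < a -> a < b ->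
  (\int[leb]_(r in `[a, b]) (r `^ (e - 1))%:E = (b `^ e / e - a `^ e / e)%:E)%E.
Proof.
move=> e0 a0 ab.
have D x : a <= x -> derivable (fun r : R => r `^ e / e) x 1.
  by move=> ax; apply: ex_derive; apply: is_derive_powR_div => //; exact: lt_le_trans ax.
rewrite (@continuous_FTC2 _ _ (fun r => r `^ e / e))//.
- apply: derivable_within_continuous => x; rewrite in_itv/= => /andP[ax _].
  apply: derivable_powR; rewrite in_itv/= andbT; exact: lt_le_trans ax.
- split.
  + by move=> x; rewrite in_itv/= => /andP[/ltW ax _]; exact: D.
  + apply: cvg_at_right_filter; apply: (@differentiable_continuous _ _ _ a).
    by apply/derivable1_diffP; exact: D.
  + apply: cvg_at_left_filter; apply: (@differentiable_continuous _ _ _ b).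
    by apply/derivable1_diffP; apply: D; exact: ltW.
- move=> x; rewrite in_itv/= => /andP[ax _]; rewrite derive1E.
  have h := is_derive_powR_div e0 (lt_trans a0 ax).
  exact: derive_val.
Qed.

Lemma measurable_powR_EFin (p : R) (D : set R) : measurable_fun D (fun r : R => (r `^ p)%:E).
Proof. by apply/measurable_EFinP; exact: (measurable_funS measurableT). Qed.

Lemma integral_powR_itv0 (e b : R) : 0 < e -> 0 < b ->
  (\int[leb]_(r in `]0%R, b]) (r `^ (e - 1))%:E = (b `^ e / e)%:E)%E.
Proof.
move=> e0 b0.
(* The left endpoints decrease to 0; n+2 instead of n+1 keeps them strictly below [b] already at n =
   0. *)
pose F n := `[b * n.+2%:R^-1, b]%classic.
have -> : `]0, b]%classic = \bigcup_n F n.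
  apply/seteqP; split => x /=; rewrite in_itv/=; last first.
    move=> [n _]; rewrite /F/= in_itv/= => /andP[nx ->]; rewrite andbT.
    by apply: lt_le_trans nx; rewrite mulr_gt0// invr_gt0.
  move=> /andP[x0 xb].
  pose n := Num.trunc (b / x).
  exists n => //; rewrite /F/= in_itv/= xb andbT ler_pdivrMr// -ler_pdivrMl//.
  rewrite mulrC; apply: ltW; apply: (lt_trans (truncnS_gt _)).
  by rewrite ltr_nat.
have Fn n : (\int[leb]_(r in F n) (r `^ (e - 1))%:E = (b `^ e / e - b `^ e / e * (n.+2%:R^-1) `^ e)%:E)%E.
  rewrite integral_powR_itvcc ?gt_eqF//.
  - by rewrite powRM ?invr_ge0 ?ltW// mulrAC.
  - by rewrite mulr_gt0// invr_gt0.
  - by rewrite gtr_pMr// invf_lt1// ltr1n.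
have c1 : (\int[leb]_(r in F n) (r `^ (e - 1))%:E @[n --> \oo] -->
    \int[leb]_(r in \bigcup_n F n) (r `^ (e - 1))%:E)%E.
  apply: ge0_nondecreasing_set_cvg_integral => //.
  - move=> m n mn; apply/subsetPset; apply: subset_itvr; rewrite bnd_simp.
    rewrite ler_pM2l// lef_pV2 ?posrE//.
    by rewrite ler_nat !ltnS.
  - by move=> i; exact: measurable_itv.
  - by move=> i; exact: (@measurable_powR_EFin (e - 1) (F i)).
  - by move=> i x _; rewrite lee_fin powR_ge0.
apply: (cvg_unique _ c1) => //.
rewrite (_ : (fun i => _) = EFin \o (fun n => b `^ e / e - b `^ e / e * (n.+2%:R^-1) `^ e)); last first.
  by apply/funext => n; rewrite Fn.
apply: cvg_EFin; first by near=> n.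
rewrite -[X in _ --> X]subr0; apply: cvgB; first exact: cvg_cst.
rewrite -[X in _ --> X](mulr0 (b `^ e / e)); apply: cvgM; first exact: cvg_cst.
have /cvg_at_rightP := powR_cvg0 e0; apply; split.
  by move=> n; rewrite invr_gt0.
by have := @cvg_harmonic R; rewrite -(cvg_shiftS _).
Unshelve. all: by end_near. Qed.

Lemma powRN_cvgy (e : R) : 0 < e -> x `^ (- e) @[x --> +oo] --> 0.
Proof.
move=> e0; apply/cvgrPdist_le => eps eps0.
near=> x.
rewrite sub0r normrN ger0_norm ?powR_ge0//.
have x0 : 0 < x by [].
have -> : eps = (eps `^ (- e^-1)) `^ (- e).
  by rewrite -powRrM mulrNN mulVf ?gt_eqF// powRr1 ?ltW.
rewrite !(powRN _ e) lef_pV2 ?posrE ?powR_gt0//.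
by apply: ge0_ler_powR => //; rewrite ?nnegrE ?powR_ge0// ltW.
Unshelve. all: by end_near. Qed.

Lemma integral_powRN_itvy (e a : R) : 0 < e -> 0 < a ->
  (\int[leb]_(r in `[a, +oo[) (r `^ (- e - 1))%:E = (a `^ (- e) / e)%:E)%E.
Proof.
move=> e0 a0.
have eN0 : - e != 0 by rewrite oppr_eq0 gt_eqF.
have D x : a <= x -> derivable (fun r : R => r `^ (- e) / - e) x 1.
  by move=> ax; apply: ex_derive; apply: is_derive_powR_div => //; exact: lt_le_trans ax.
have c x : a <= x -> {for x, continuous (fun r : R => r `^ (- e - 1))}.
  move=> ax; apply: differentiable_continuous; apply/derivable1_diffP.
  by apply: derivable_powR; rewrite in_itv/= andbT; exact: lt_le_trans ax.
rewrite (@ge0_continuous_FTC2y _ _ (fun r => r `^ (- e) / - e) a 0)//.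
- by rewrite sub0e -EFinN invrN mulrN opprK.
- by move=> x _; exact: powR_ge0.
- apply/continuous_within_itvcyP; split.
    by move=> x; rewrite in_itv/= andbT => /ltW; exact: c.
  by apply: cvg_at_right_filter; exact: c.
- by rewrite -(mul0r (- e)^-1); apply: cvgMl; exact: powRN_cvgy.
- by move=> x /ltW; exact: D.
- apply: cvg_at_right_filter; apply: (@differentiable_continuous _ _ _ a).
  by apply/derivable1_diffP; exact: D.
- move=> x; rewrite in_itv/= andbT => ax; rewrite derive1E.
  have h := is_derive_powR_div eN0 (lt_trans a0 ax).
  exact: derive_val.
Qed.

End power_integrals.

(** * Open sets, the Euclidean norm and the unit ball *)

Section borel_rV.
Context (R : realType) (n : nat).

Lemma measurable_coor_itv (a b : 'rV[R]_n) (c d : bool) :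
  measurable [set v : 'rV[R]_n | forall i,
    v ord0 i \in Interval (BSide c (a ord0 i)) (BSide d (b ord0 i))].
Proof.
rewrite (_ : [set _ | _] = \bigcap_(i in [set: 'I_n]) (@coor R n i @^-1`
    [set` Interval (BSide c (a ord0 i)) (BSide d (b ord0 i))])); last first.
  by apply/seteqP; split => v /= h i; [move=> _|]; exact: h.
apply: fin_bigcap_measurable => // i _.
by rewrite -[X in measurable X]setTI; exact: measurable_coor.
Qed.

(** The sigma-algebra is generated by coordinates, so an open set is exhibited as a countable union
    of boxes: those with rational corners that lie inside it. [F] replaces the other boxes by the
    empty set. *)
Lemma open_measurable_rV (A : set 'rV[R]_n) : open A -> measurable A.
Proof.
move=> oA.
pose box (q : 'rV[rat]_n * 'rV[rat]_n) : set 'rV[R]_n := [set v | forall i,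
  v ord0 i \in `](map_mx ratr q.1 : 'rV[R]_n) ord0 i, (map_mx ratr q.2 : 'rV[R]_n) ord0 i[].
pose F q := if pselect (box q `<=` A) then box q else set0.
have -> : A = \bigcup_q F q.
  apply/seteqP; split => [x Ax|x [q _]]; last first.
    by rewrite /F; case: pselect => // sub; exact: sub.
  have /nbhs_ballP[e /= e0 xeA] : nbhs x A by apply: open_nbhs_nbhs; split.
  have qlt i : exists q : rat, ratr q \in `]x ord0 i - e / 2, x ord0 i[.
    by apply: rat_in_itvoo; rewrite ltrBlDr ltrDl divr_gt0.
  have qgt i : exists q : rat, ratr q \in `]x ord0 i, x ord0 i + e / 2[.
    by apply: rat_in_itvoo; rewrite ltrDl divr_gt0.
  have [p /= ltp] := choice qlt; have [q /= gtq] := choice qgt.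
  exists (\row_i p i, \row_i q i) => //; rewrite /F; case: pselect => [_|] /=.
    move=> i; rewrite !mxE in_itv/=.
    by have := ltp i; have := gtq i; rewrite !in_itv/= => /andP[-> _] /andP[_ ->].
  move=> nsub; exfalso; apply: nsub => y yb; apply: xeA; split=> // j i.
  rewrite (ord1 j); have := yb i; rewrite !mxE in_itv/= => /andP[py yq].
  have := ltp i; have := gtq i; rewrite !in_itv/= => /andP[xq qx] /andP[xp px].
  by rewrite /ball/= ltr_distl; apply/andP; split; lra.
apply: (countable_bigcupT_measurable (countableP _)).
move=> q; rewrite /F; case: (pselect (box q `<=` A)) => ?; last exact: measurable0.
exact: measurable_coor_itv.
Qed.

Lemma continuous_measurable_rV (f : 'rV[R]_n -> R) :
  continuous f -> measurable_fun setT f.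
Proof.
move=> /continuousP cf; apply: (measurability _ (RGenOpens.measurableE R)).
move=> _ [_ [a [b ->] <-]]; rewrite setTI; apply: open_measurable_rV.
exact/cf/interval_open.
Qed.

End borel_rV.

Definition uball (R : realType) n : set 'rV[R]_n := [set x | enorm x < 1].
Arguments uball : clear implicits.

Section euclidean.
Context (R : realType).

Lemma enorm_ge0 n (x : 'rV[R]_n) : 0 <= enorm x.
Proof. exact: sqrtr_ge0. Qed.

Lemma sqr_enorm n (x : 'rV[R]_n) : enorm x ^+ 2 = dotv x x.
Proof. by rewrite sqr_sqrtr// dotvv_ge0. Qed.

Lemma sqr_coor_le n (x : 'rV[R]_n) i : x ord0 i ^+ 2 <= dotv x x.
Proof.
rewrite /dotv (bigD1 i)//= -expr2 lerDl.
by apply: sumr_ge0 => j _; rewrite -expr2 sqr_ge0.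
Qed.

Lemma dotvv_eq0 n (x : 'rV[R]_n) : (dotv x x == 0) = (x == 0).
Proof.
apply/idP/eqP => [/eqP x0|->]; last first.
  by rewrite /dotv big1// => i _; rewrite mxE mul0r.
apply/rowP => i; rewrite mxE; apply/eqP; rewrite -sqrf_eq0.
by rewrite eq_le sqr_ge0 andbT -x0 sqr_coor_le.
Qed.

Lemma enorm_eq0 n (x : 'rV[R]_n) : (enorm x == 0) = (x == 0).
Proof. by rewrite -dotvv_eq0 -sqr_enorm sqrf_eq0. Qed.

Lemma enorm_gt0 n (x : 'rV[R]_n) : (0 < enorm x) = (x != 0).
Proof. by rewrite lt0r enorm_eq0 enorm_ge0 andbT. Qed.

Lemma enormZ n (c : R) (x : 'rV[R]_n) : enorm (c *: x) = `|c| * enorm x.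
Proof.
rewrite /enorm dotvZl dotvC dotvZl mulrA -expr2 sqrtrM ?sqr_ge0//.
by rewrite sqrtr_sqr.
Qed.

Lemma enormN n (x : 'rV[R]_n) : enorm (- x) = enorm x.
Proof. by rewrite -scaleN1r enormZ normrN1 mul1r. Qed.

Lemma dotvDl n (x y z : 'rV[R]_n) : dotv (x + y) z = dotv x z + dotv y z.
Proof.
by rewrite /dotv -big_split/=; apply: eq_bigr => i _; rewrite mxE mulrDl.
Qed.

Lemma dotvNl n (x y : 'rV[R]_n) : dotv (- x) y = - dotv x y.
Proof. by rewrite -scaleN1r dotvZl mulN1r. Qed.

Lemma dotv_sqr_le n (x y : 'rV[R]_n) : dotv x y ^+ 2 <= dotv x x * dotv y y.
Proof.
have [->|y0] := eqVneq y 0.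
  have z u : dotv u (0 : 'rV[R]_n) = 0.
    by rewrite /dotv big1// => i _; rewrite mxE mulr0.
  by rewrite !z expr0n mulr0.
have C0 : 0 < dotv y y by rewrite lt0r dotvv_eq0 y0 dotvv_ge0.
have := dotvv_ge0 (dotv y y *: x - dotv x y *: y).
rewrite !(dotvDl, dotvNl, dotvZl) ![dotv _ (_ - _)]dotvC.
rewrite !(dotvDl, dotvNl, dotvZl) (dotvC y x).
rewrite [X in 0 <= X](_ : _ =
  dotv y y * (dotv x x * dotv y y - dotv x y ^+ 2)); last by ring.
by rewrite pmulr_rge0// subr_ge0.
Qed.

Lemma measurable_enorm n : measurable_fun setT (@enorm R n).
Proof.
apply: (measurableT_comp (continuous_measurable_fun (@sqrt_continuous R))).
by apply: measurable_sum => i; apply: measurable_funM; exact: measurable_coor.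
Qed.

Lemma measurable_uball n : measurable (uball R n).
Proof.
rewrite (_ : uball R n = setT `&` @enorm R n @^-1` `]-oo, 1[).
  exact: measurable_enorm.
by apply/seteqP; split => x; rewrite /uball/= in_itv/=; [|case].
Qed.

Lemma uball_box n : uball R n `<=` [set v | forall i,
  v ord0 i \in `](const_mx (-1) : 'rV[R]_n) ord0 i, (const_mx 1 : 'rV[R]_n) ord0 i]].
Proof.
move=> x xB i; rewrite !mxE in_itv/=.
have : x ord0 i ^+ 2 < 1.
  apply: le_lt_trans (sqr_coor_le x i) _.
  by rewrite -sqr_enorm expr_lt1// enorm_ge0.
by rewrite -real_normK ?num_real// expr_lt1// ltr_norml => /andP[-> /ltW ->].
Qed.

Lemma uball_fin_num n : (lebesgue_rV R n (uball R n) < +oo)%E.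
Proof.
apply: (@le_lt_trans _ _ _); last first.
  apply: (@ltry _ (\prod_(i < n) ((const_mx 1 : 'rV[R]_n) ord0 i -
    (const_mx (-1) : 'rV[R]_n) ord0 i))).
rewrite -lebesgue_rV_box; last by move=> i; rewrite !mxE; lra.
apply: le_measure; rewrite ?inE.
- exact: measurable_uball.
- exact: measurable_coor_itv.
- exact: uball_box.
Qed.

Lemma ball_volumeE n : (ball_volume R n)%:E = lebesgue_rV R n (uball R n).
Proof. by rewrite fineK// ge0_fin_numE ?uball_fin_num. Qed.

Lemma ball_volume_gt0 n : 0 < ball_volume R n.
Proof.
rewrite -lte_fin ball_volumeE.
(* On the cube of side 1/(n+1) each squared coordinate is at most 1/(n+1), so their sum is at most
   n/(n+1) < 1 and the cube lies in the ball. *)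
pose b : 'rV[R]_n := const_mx (n.+1%:R^-1).
apply: (@lt_le_trans _ _ (lebesgue_rV R n [set v | forall i,
  v ord0 i \in `](0 : 'rV[R]_n) ord0 i, b ord0 i]])).
  rewrite lebesgue_rV_box; last by move=> i; rewrite !mxE invr_ge0.
  by rewrite lte_fin prodr_gt0// => i _; rewrite !mxE subr0 invr_gt0.
apply: le_measure; rewrite ?inE.
- exact: measurable_coor_itv.
- exact: measurable_uball.
move=> v vb; rewrite /uball/= -(expr_lt1 (n := 2))//; last exact: enorm_ge0.
rewrite sqr_enorm.
apply: (@le_lt_trans _ _ (\sum_(i < n) n.+1%:R^-1)).
  apply: ler_sum => i _; have := vb i; rewrite !mxE in_itv/= => /andP[v0 v1].
  have k1 : n.+1%:R^-1 <= 1 :> R by rewrite invf_le1// ler1n.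
  apply: (le_trans (ler_wpM2l (ltW v0) v1)).
  rewrite -[leRHS]mul1r; apply: ler_wpM2r; first by rewrite invr_ge0.
  exact: le_trans v1 k1.
by rewrite sumr_const card_ord -[ltLHS]mulr_natl ltr_pdivrMr// mul1r ltr_nat.
Qed.

(** In dimension 0 the measure is the Dirac mass at the origin, hence the restriction on n. *)
Lemma lebesgue_rV_set1 n : (0 < n)%N -> lebesgue_rV R n [set 0] = 0%E.
Proof.
move=> n0; apply/eqP; rewrite eq_le measure_ge0 andbT.
apply/lee_addgt0Pr => e e0; rewrite add0e.
(* Capping the side at 1 gives k^n <= k <= e for every n > 0. *)
pose k := Num.min e 1.
have k0 : 0 < k by rewrite lt_min e0 ltr01.
apply: (@le_trans _ _ (lebesgue_rV R n [set v | forall i,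
  v ord0 i \in `](const_mx (- k) : 'rV[R]_n) ord0 i, (0 : 'rV[R]_n) ord0 i]])).
  apply: le_measure; rewrite ?inE.
  - rewrite (_ : [set 0] = setT `&` @enorm R n @^-1` [set 0]).
      exact: (@measurable_enorm n).
    apply/seteqP; split => x /=; first by move=> ->; split => //; apply/eqP; rewrite enorm_eq0.
    by move=> [_ /eqP]; rewrite enorm_eq0 => /eqP.
  - exact: measurable_coor_itv.
  - by move=> _ -> i; rewrite !mxE in_itv/= lexx oppr_lt0 k0.
rewrite lebesgue_rV_box; last by move=> i; rewrite !mxE oppr_le0 ltW.
rewrite lee_fin; under eq_bigr do rewrite !mxE sub0r opprK.
rewrite prodr_const card_ord.
have k1 : k <= 1 by rewrite ge_min lexx orbT.
apply: (@le_trans _ _ k); last by rewrite ge_min lexx.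
by case: n n0 => // m _; rewrite exprS; apply: ler_piMr; [exact: ltW|apply: exprn_ile1 => //; exact: ltW].
Qed.

End euclidean.

(** * Polar coordinates *)

Section polar.
Context (R : realType).
Local Notation leb := (@lebesgue_measure R).

Lemma integral_bool d (T : measurableType d) (mu : {measure set T -> \bar R})
    (b : T -> bool) (f : T -> \bar R) :
  (\int[mu]_(x in [set x | b x]) f x = \int[mu]_x if b x then f x else 0)%E.
Proof.
rewrite integral_mkcond; apply: eq_integral => x _; rewrite patchE.
by case: ifPn => [/set_mem ->//|]; case: ifPn => // bx; rewrite mem_set.
Qed.

Lemma measurable_scale d (T : measurableType d) n (f : T -> R) (g : T -> 'rV[R]_n) :
  measurable_fun setT f -> measurable_fun setT g ->
  measurable_fun setT (fun x => f x *: g x).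
Proof.
move=> mf mg; apply: measurable_fun_rV => i.
rewrite (_ : _ \o _ = fun x => f x * (coor i \o g) x); last first.
  by apply/funext => x /=; rewrite /coor mxE.
by apply: measurable_funM => //; apply: measurableT_comp => //; exact: measurable_coor.
Qed.

(* For a variable n: at n.+1, unification would unfold [lebesgue_rV R n.+1]. *)
Lemma tonelli_rV_leb n (f : 'rV[R]_n * measurableTypeR R -> \bar R) :
  measurable_fun setT f -> (forall x, (0 <= f x)%E) ->
  (\int[lebesgue_rV R n]_x \int[leb]_t f (x, t) =
   \int[leb]_t \int[lebesgue_rV R n]_x f (x, t))%E.
Proof. by move=> mf f0; exact: (fubini_tonelli f). Qed.

Lemma tonelli_rV n (f : 'rV[R]_n * 'rV[R]_n -> \bar R) :
  measurable_fun setT f -> (forall x, (0 <= f x)%E) ->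
  (\int[lebesgue_rV R n]_x \int[lebesgue_rV R n]_y f (x, y) =
   \int[lebesgue_rV R n]_y \int[lebesgue_rV R n]_x f (x, y))%E.
Proof. by move=> mf f0; exact: (fubini_tonelli f). Qed.

(** Let d = n+1. Insert 1 = int_{|h|}^oo d |h|^d t^(-d-1) dt, exchange the integrals, put h = t k at
    fixed t so that |h| < t becomes |k| < 1, exchange back, and put r = t |k| at fixed k. [Psi] and
    [K] are the integrands before and after the dilation. *)
Lemma ge0_integral_polar n (F : 'rV[R]_n.+1 -> \bar R) :
  measurable_fun setT F -> (forall x, (0 <= F x)%E) ->
  (\int[lebesgue_rV R n.+1]_(h in [set h | (0 < enorm h)%R]) F h =
   \int[lebesgue_rV R n.+1]_(k in [set k | (0 < enorm k < 1)%R])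
     \int[leb]_(r in [set r | (0 < r)%R])
       (F ((r / enorm k)%R *: k) * (n.+1%:R * r ^+ n)%:E))%E.
Proof.
move=> mF F0.
pose K (p : 'rV[R]_n.+1 * measurableTypeR R) := (if ((0 < enorm p.1 < 1) && (0 < p.2))%R then
  F (p.2 *: p.1) * (n.+1%:R * enorm p.1 ^+ n.+1 * p.2 ^+ n)%:E else 0)%E.
pose Psi (p : 'rV[R]_n.+1 * measurableTypeR R) := (if (0 < enorm p.1 < p.2)%R then
  F p.1 * (n.+1%:R * enorm p.1 ^+ n.+1 * p.2 `^ (- n.+1%:R - 1))%:E else 0)%E.
have m1 : measurable_fun setT (fun p : 'rV[R]_n.+1 * measurableTypeR R => enorm p.1).
  exact: (measurableT_comp (@measurable_enorm R n.+1)).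
have K0 p : (0 <= K p)%E.
  rewrite /K; case: ifPn => // /andP[_ /ltW p0]; rewrite mule_ge0// lee_fin.
  by rewrite !mulr_ge0// exprn_ge0// enorm_ge0.
have Psi0 p : (0 <= Psi p)%E.
  rewrite /Psi; case: ifPn => // p0; rewrite mule_ge0// lee_fin.
  by rewrite !mulr_ge0 ?powR_ge0// exprn_ge0// enorm_ge0.
have mK : measurable_fun setT K.
  apply: measurable_fun_ifT => //.
    apply: measurable_and.
      by apply: measurable_and; exact: measurable_fun_ltr.
    exact: measurable_fun_ltr.
  apply: emeasurable_funM.
    apply: (measurableT_comp mF); exact: measurable_scale.
  apply/measurable_EFinP; apply: measurable_funM.
    by apply: measurable_funM => //; exact: measurable_funX.
  exact: measurable_funX.
have mPsi : measurable_fun setT Psi.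
  apply: measurable_fun_ifT => //.
    by apply: measurable_and; exact: measurable_fun_ltr.
  apply: emeasurable_funM; first exact: (measurableT_comp mF).
  apply/measurable_EFinP; apply: measurable_funM.
    by apply: measurable_funM => //; exact: measurable_funX.
  exact: (measurableT_comp (measurable_powR _)).
rewrite [LHS]integral_bool [RHS]integral_bool.
transitivity (\int[lebesgue_rV R n.+1]_h \int[leb]_t Psi (h, t))%E.
  apply: eq_integral => h _; case: ifPn => h0; last first.
    by rewrite integral0_eq// => t _; rewrite /Psi/= (negbTE h0).
  rewrite (_ : (fun t => _) = fun t => if (enorm h < t)%R then F h * (n.+1%:R * enorm h ^+ n.+1 * t `^ (- n.+1%:R - 1))%:E else 0)%E; last first.
    by apply/funext => t; rewrite /Psi/= h0.
  rewrite -integral_bool.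
  under eq_integral do rewrite EFinM muleA.
  have -> : [set t | (enorm h < t)%R] = `]enorm h, +oo[%classic.
    by apply/seteqP; split => t /=; rewrite in_itv/= andbT.
  have mp : measurable_fun `]enorm h, +oo[%classic
      (fun t : measurableTypeR R => (t `^ (- n.+1%:R - 1))%:E).
    exact: measurable_powR_EFin.
  rewrite ge0_integralZl//.
  - rewrite integral_itv_obnd_cbnd// integral_powRN_itvy//.
    rewrite -muleA -EFinM powRN powR_mulrn ?enorm_ge0//.
    rewrite (_ : _ * _ = 1) ?mule1//.
    by field; rewrite nat1r !pnatr_eq0/= expf_neq0// gt_eqF.
  - by move=> t _; rewrite lee_fin powR_ge0.
  - by rewrite mule_ge0// lee_fin mulr_ge0// exprn_ge0// enorm_ge0.
transitivity (\int[lebesgue_rV R n.+1]_h \int[leb]_t K (h, t))%E; last first.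
  apply: eq_integral => k _; case: ifPn => k0; last first.
    by rewrite integral0_eq// => t _; rewrite /K/= (negbTE k0).
  rewrite integral_bool.
  have /andP[e0 _] := k0.
  pose g (r : R) := (if (0 < r)%R then
    F ((r / enorm k)%R *: k) * (n.+1%:R * r ^+ n)%:E else 0)%E.
  have g0 r : (0 <= g r)%E.
    rewrite /g; case: ifPn => // /ltW r0.
    by rewrite mule_ge0// lee_fin mulr_ge0// exprn_ge0.
  have mg : measurable_fun [set: R] g.
    apply: measurable_fun_ifT => //; first exact: measurable_fun_ltr.
    apply: emeasurable_funM.
      apply: (measurableT_comp mF); apply: measurable_scale => //.
      exact: measurable_funM.
    apply/measurable_EFinP; apply: measurable_funM => //.
  (* The substitution r = t |k|; its Jacobian |k| is one of the d factors |k| in [K], and the other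
     d-1 complete t^n to r^n. *)
  rewrite -(ge0_integral_affine 0 e0 mg g0) -ge0_integralZl//.
  - apply: eq_integral => t _; rewrite /K/= k0/= /g addr0 pmulr_rgt0//.
    case: ifPn => t0; last by rewrite mule0.
    rewrite muleCA -EFinM [in RHS]mulrAC mulfV ?mul1r ?gt_eqF//.
    by congr (_ * _%:E)%E; rewrite exprMn exprS; ring.
  - apply: (measurableT_comp mg); apply: measurable_funD => //.
  - by rewrite lee_fin ltW.
rewrite (tonelli_rV_leb mPsi Psi0) (tonelli_rV_leb mK K0).
apply: eq_integral => t _.
have [t0|t0] := ltP 0 t; last first.
  rewrite !integral0_eq// => k _; rewrite /K /Psi/=.
  - by rewrite (le_gtF t0) andbF.
  - by case: ifPn => // /andP[a b]; move: (lt_le_trans (lt_trans a b) t0); rewrite ltxx.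
have [_ sc] := volume_scaling_dilation n.+1 t0.
rewrite -(sc (fun h => Psi (h, t)))//; last exact: measurableT_comp.
rewrite -ge0_integralZl//.
- apply: eq_integral => k _; rewrite /K /Psi/= t0 andbT enormZ gtr0_norm//.
  rewrite pmulr_rgt0// gtr_pMr//; case: ifPn => k0; last by rewrite mule0.
  rewrite muleCA -EFinM; congr (_ * _%:E)%E.
  rewrite powRB; last by rewrite (gt_eqF t0) implybT.
  rewrite powRN powRr1 ?ltW// powR_mulrn ?ltW// exprMn !exprS; field.
  by rewrite ?expf_neq0 ?gt_eqF.
- apply: (measurableT_comp (f := Psi)) => //.
  by apply: measurable_fun_pair => //; exact: measurable_scale.
- by rewrite lee_fin exprn_ge0// ltW.
Qed.
End polar.

(** * The function G_s *)

Section Gs.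
Context (R : realType).
Local Notation leb := (@lebesgue_measure R).

Definition Gs' (d : nat) (s r : R) : R := (1 + r ^+ 2) `^ (- (d%:R + 1 + 2 * s) / 2).

Lemma onesqr_gt0 (x : R) : 0 < 1 + x ^+ 2.
Proof. by rewrite ltr_pwDl// sqr_ge0. Qed.

Lemma onesqr_ge1 (x : R) : 1 <= 1 + x ^+ 2.
Proof. by rewrite lerDl sqr_ge0. Qed.

Lemma is_derive_onesqr_powR (q x : R) :
  is_derive x 1 (fun r : R => (1 + r ^+ 2) `^ q) (q * (1 + x ^+ 2) `^ (q - 1) * (2 * x)).
Proof.
have h1 : is_derive x (1 : R) (fun r : R => 1 + r ^+ 2) (2 * x).
  apply: is_derive_eq; rewrite add0r /GRing.scale/=; ring.
have h2 := is_derive1_powR q (onesqr_gt0 x).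
exact: (@is_derive1_comp R (fun y => y `^ q) (fun r => 1 + r ^+ 2) x _ _ h2 h1).
Qed.

Lemma continuous_onesqr_powR (q : R) : continuous (fun r : R => (1 + r ^+ 2) `^ q).
Proof.
move=> x; apply: differentiable_continuous; apply/derivable1_diffP.
by apply: ex_derive; exact: is_derive_onesqr_powR.
Qed.

Lemma Gs'_gt0 d (s r : R) : 0 < Gs' d s r.
Proof. by apply: powR_gt0; exact: onesqr_gt0. Qed.

Lemma Gs'_le1 d (s r : R) : 0 <= s -> Gs' d s r <= 1.
Proof.
move=> s0; rewrite -[leRHS](powRr0 (1 + r ^+ 2)); apply: ler_powR.
  exact: onesqr_ge1.
by rewrite mulNr oppr_le0 divr_ge0// !addr_ge0// mulr_ge0.
Qed.

(** With X = 1 + r^2 and e = (1 - 2s)/2 the difference is X^(-(d+1+2s)/2) (1 - X^(-e)). The first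
    factor is at most 1/X because d >= 1, and 1 - X^(-e) <= e ln X <= e X, so the bound is uniform
    in r. *)
Lemma Gs'_near d (s r : R) : (0 < d)%N -> 0 <= s -> s <= 1 / 2 ->
  `|Gs' d s r - Gs' d (1 / 2) r| <= (1 - 2 * s) / 2.
Proof.
move=> d0 s0 s1; rewrite /Gs'.
set X := 1 + r ^+ 2.
have X1 : 1 <= X := onesqr_ge1 r.
have X0 : 0 < X := onesqr_gt0 r.
set e := (1 - 2 * s) / 2.
have e0 : 0 <= e by rewrite /e; lra.
have -> : - (d%:R + 1 + 2 * (1 / 2)) / 2 = - (d%:R + 1 + 2 * s) / 2 - e :> R.
  by rewrite /e; field.
rewrite powRB ?(gt_eqF X0) ?implybT// -[X in `|X - _|]mulr1 -mulrBr normrM.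
rewrite ger0_norm ?powR_ge0//.
have d1 : 1 <= d%:R :> R by rewrite ler1n.
have pX : X `^ (- (d%:R + 1 + 2 * s) / 2) <= X^-1.
  by rewrite -[leRHS]powR_inv1 ?(ltW X0)//; apply: ler_powR => //; lra.
have eX : X `^ (- e) <= 1 by rewrite -[leRHS](powRr0 X); apply: ler_powR => //; lra.
rewrite -powRN ger0_norm ?subr_ge0//.
have h : 1 - X `^ (- e) <= e * X.
  rewrite /powR (gt_eqF X0).
  have h1 := expR_ge1Dx (- e * ln X).
  have h2 : e * ln X <= e * X.
    apply: ler_wpM2l => //; apply: (@le_trans _ _ (r ^+ 2)); last by rewrite lerDr.
    by apply: le_ln1Dx; rewrite (lt_le_trans _ (sqr_ge0 r))// ltrN10.
  lra.
apply: (@le_trans _ _ (X^-1 * (e * X))).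
  by apply: ler_pM => //; rewrite ?powR_ge0// subr_ge0.
by rewrite mulrCA mulVf ?mulr1// gt_eqF.
Qed.

Lemma integrable_Gs' d (s a b : R) : leb.-integrable `[a, b]%classic (EFin \o Gs' d s).
Proof.
apply: continuous_compact_integrable; first exact: segment_compact.
by apply: continuous_subspaceT; exact: continuous_onesqr_powR.
Qed.

(** Moving the base point from 0 to some N below both 0 and r removes the case distinction on the
    sign of r, so the fundamental theorem of calculus applies near every r, including r = 0. *)
Lemma Gs_itvE d s (N r : R) : N < 0 -> N <= r ->
  Gs d s r = \int[leb]_(t in `[N, r]) Gs' d s t - \int[leb]_(t in `[N, 0]) Gs' d s t.
Proof.
move=> N0 Nr; rewrite /Gs; case: ifPn => [r0|].
  rewrite Rintegral_itvB; [|exact: integrable_Gs'|by rewrite bnd_simp ltW|by rewrite bnd_simp].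
  rewrite Rintegral_itv_obnd_cbnd//.
  by apply: integrableS (integrable_Gs' d s 0 r) => //; exact: subset_itv_oc_cc.
rewrite -ltNge => r0; rewrite -[RHS]opprB; congr (- _).
rewrite Rintegral_itvB; [|exact: integrable_Gs'|by rewrite bnd_simp|by rewrite bnd_simp ltW].
rewrite Rintegral_itv_obnd_cbnd//.
by apply: integrableS (integrable_Gs' d s r 0) => //; exact: subset_itv_oc_cc.
Qed.

Lemma is_derive_Gs d s (r : R) : is_derive r 1 (Gs d s) (Gs' d s r).
Proof.
pose N := Num.min r 0 - 1.
have Nr : N < r by rewrite /N ltrBlDr (le_lt_trans (y := r)) ?ge_min ?lexx// ltrDl.
have N0 : N < 0 by rewrite /N ltrBlDr add0r (le_lt_trans (y := 0)) ?ge_min ?lexx ?orbT.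
pose c := \int[leb]_(t in `[N, 0]) Gs' d s t.
apply: (@near_eq_is_derive _ _ _ (fun r => \int[leb]_(t in `[N, r]) Gs' d s t - c)).
  near=> t; rewrite (@Gs_itvE d s N)//; apply/ltW.
  by near: t; exact: lt_nbhsr.
have [] := @continuous_FTC1_closed _ (Gs' d s) N r (r + 1) _ (integrable_Gs' _ _ _ _) Nr _.
- by rewrite ltrDl.
- exact: continuous_onesqr_powR.
move=> h1 h2.
have h : is_derive r (1 : R) (fun x => \int[leb]_(t in `[N, x]) Gs' d s t) (Gs' d s r).
  by apply: DeriveDef; [exact: h1|rewrite -derive1E; exact: h2].
by apply: is_derive_eq; rewrite subr0.
Unshelve. all: by end_near. Qed.

Lemma continuous_Gs d (s : R) : continuous (Gs d s : R -> R).
Proof.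
move=> x; apply: differentiable_continuous; apply/derivable1_diffP.
by apply: ex_derive; exact: is_derive_Gs.
Qed.

Lemma measurable_Gs d (s : R) : measurable_fun [set: R] (Gs d s).
Proof. by apply: continuous_measurable_fun; exact: continuous_Gs. Qed.

Lemma Gs0 d s : Gs d s (0 : R) = 0.
Proof. by rewrite /Gs lexx set_itv1 Rintegral_set1. Qed.

Lemma is_derive_MVT (f df : R -> R) (a b : R) :
  (forall x : R, is_derive x (1 : R) f (df x)) -> exists c, f a - f b = df c * (a - b).
Proof.
move=> fd.
have cf A : {within A, continuous f}.
  apply: continuous_subspaceT => x; apply: differentiable_continuous.
  by apply/derivable1_diffP; exact: ex_derive.
wlog ab : a b / b <= a.
  move=> H; have [/H //|/ltW/H[c E]] := leP b a.
  by exists c; rewrite -opprB E -mulrN opprB.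
by have [c _ E] := MVT_segment ab (fun x _ => fd x) (cf _); exists c.
Qed.

Lemma Gs_mono d (s a b : R) : 0 <= s ->
  0 <= (Gs d s a - Gs d s b) * (a - b) <= (a - b) ^+ 2.
Proof.
move=> s0; have [c ->] := is_derive_MVT a b (is_derive_Gs d s).
rewrite -mulrA -expr2; apply/andP; split.
  by rewrite mulr_ge0 ?sqr_ge0// ltW// Gs'_gt0.
by apply: ler_piMl; [exact: sqr_ge0|exact: Gs'_le1].
Qed.

Lemma Gs_lip d (s a b : R) : 0 <= s -> `|Gs d s a - Gs d s b| <= `|a - b|.
Proof.
move=> s0; have [c ->] := is_derive_MVT a b (is_derive_Gs d s).
rewrite normrM ler_piMl// ger0_norm; last exact/ltW/Gs'_gt0.
exact: Gs'_le1.
Qed.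

Lemma Gs_near d (s a b : R) : (0 < d)%N -> 0 <= s -> s <= 1 / 2 ->
  `|(Gs d s a - Gs d s b) * (a - b) - (Gs d (1 / 2) a - Gs d (1 / 2) b) * (a - b)| <=
  (1 - 2 * s) / 2 * (a - b) ^+ 2.
Proof.
move=> d0 s0 s1.
have fd x : is_derive x (1 : R) (fun x => Gs d s x - Gs d (1 / 2) x)
    (Gs' d s x - Gs' d (1 / 2) x).
  by apply: is_deriveB; exact: is_derive_Gs.
have [c E] := is_derive_MVT a b fd.
rewrite -mulrBl (_ : _ - _ - _ = (Gs' d s c - Gs' d (1 / 2) c) * (a - b)); last first.
  by rewrite -E /=; move: (Gs d s a) (Gs d s b) (Gs d _ a) (Gs d _ b) => ? ? ? ?; ring.
rewrite -[X in `|X|]mulrA -expr2 normrM [X in _ * X <= _]ger0_norm ?sqr_ge0//.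
by apply: ler_wpM2r; [exact: sqr_ge0|exact: Gs'_near].
Qed.

Lemma GsN d (s a : R) : Gs d s (- a) = - Gs d s a.
Proof.
have fd x : is_derive x (1 : R) (fun x => Gs d s x + Gs d s (- x)) ((cst 0 : R -> R) x).
  have h := is_derive_Gs d s (- x).
  have h1 : is_derive x (1 : R) (-%R : R -> R) (- 1).
    exact: is_deriveN.
  have := is_deriveD (is_derive_Gs d s x) (@is_derive1_comp R (Gs d s) -%R x _ _ h h1).
  rewrite /comp => h2; apply: (is_derive_eq h2).
  by rewrite /Gs' sqrrN /cst; ring.
have [c] := is_derive_MVT a 0 fd.
rewrite mul0r oppr0 !Gs0 addr0 subr0 => /eqP.
by rewrite addrC addr_eq0 => /eqP.
Qed.

End Gs.

(** Stand-in for the unit sphere: functions constant on rays are integrated over this set. The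
    origin is removed because it has no direction. *)
Definition pball (R : realType) n : set 'rV[R]_n := [set k | 0 < enorm k < 1].
Arguments pball : clear implicits.

(** * Integrals of a function constant on rays times a radial weight *)

Section radial.
Context (R : realType).
Local Notation leb := (@lebesgue_measure R).

Lemma measurable_pball n : measurable (pball R n).
Proof.
rewrite (_ : pball R n = setT `&` @enorm R n @^-1` `]0, 1[).
  exact: measurable_enorm.
by apply/seteqP; split => x; rewrite /pball/= in_itv/=; [|case].
Qed.

Lemma integral_origin n (D : set 'rV[R]_n) (f : 'rV[R]_n -> \bar R) : (0 < n)%N ->
  measurable D -> measurable_fun D f -> (forall x, D x -> (0 <= f x)%E) ->
  (\int[lebesgue_rV R n]_(x in D) f x =
   \int[lebesgue_rV R n]_(x in D `&` [set x | (0 < enorm x)%R]) f x)%E.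
Proof.
move=> n0 mD mf f0; rewrite (ge0_negligible_integral _ mD mf f0 (lebesgue_rV_set1 R n0)).
  congr (integral _ _ _); apply/seteqP; split => x [Dx] /= h; split => //.
    by rewrite enorm_gt0; apply/eqP.
  by move: h; rewrite enorm_gt0 => /eqP.
rewrite (_ : [set 0] = setT `&` @enorm R n @^-1` [set 0]).
  exact: (@measurable_enorm R n).
apply/seteqP; split => x /=; first by move=> ->; split => //; apply/eqP; rewrite enorm_eq0.
by move=> [_ /eqP]; rewrite enorm_eq0 => /eqP.
Qed.

Lemma integral_pball1 n : (0 < n)%N ->
  (\int[lebesgue_rV R n]_(k in pball R n) 1 = (ball_volume R n)%:E)%E.
Proof.
move=> n0; rewrite ball_volumeE -[RHS]mul1e.
rewrite -integral_cst; last exact: measurable_uball.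
rewrite [RHS]integral_origin//; last exact: measurable_uball.
by congr (integral _ _ _); apply/seteqP; split => x; rewrite /pball/uball/=; [move/andP => -[]|move=> [-> ->]].
Qed.

Lemma integral_radial n (g : 'rV[R]_n.+1 -> \bar R) (w : R -> R) :
  measurable_fun setT g -> (forall x, (0 <= g x)%E) ->
  (forall c x, 0 < c -> g (c *: x) = g x) ->
  measurable_fun setT w -> (forall r, 0 <= w r) ->
  (\int[lebesgue_rV R n.+1]_(h in [set h | (0 < enorm h)%R]) (g h * (w (enorm h))%:E) =
   (\int[lebesgue_rV R n.+1]_(k in pball R n.+1) g k) *
   \int[leb]_(r in [set r | (0 < r)%R]) (w r * (n.+1%:R * r ^+ n))%:E)%E.
Proof.
move=> mg g0 gh mw w0.
have mwe : measurable_fun setT (fun h : 'rV[R]_n.+1 => (w (enorm h))%:E).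
  apply/measurable_EFinP; apply: (measurableT_comp mw); exact: measurable_enorm.
rewrite ge0_integral_polar; [|exact: emeasurable_funM|]; last first.
  by move=> x; rewrite mule_ge0// lee_fin.
set I := (X in _ = (_ * X)%E).
have mpos : measurable [set r : measurableTypeR R | 0 < r].
  by rewrite (_ : [set _ | _] = `]0, +oo[%classic)//; apply/seteqP; split => r /=; rewrite in_itv/= andbT.
have mwr : measurable_fun [set r : measurableTypeR R | 0 < r]
    (fun r => (w r * (n.+1%:R * r ^+ n))%:E).
  apply/measurable_EFinP; apply: (measurable_funS measurableT) => //.
  by apply: measurable_funM => //; apply: measurable_funM => //; exact: measurable_funX.
have wr0 r : [set r : measurableTypeR R | 0 < r] r -> (0 <= (w r * (n.+1%:R * r ^+ n))%:E)%E.
  by move=> /= /ltW r0; rewrite lee_fin !mulr_ge0// exprn_ge0.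
have I0 : (0 <= I)%E by exact: integral_ge0.
rewrite -ge0_integralZr//; [|exact: measurable_pball|exact: (measurable_funS measurableT)].
apply: eq_integral => k /set_mem/= /andP[k0 _].
rewrite -ge0_integralZl//.
apply: eq_integral => r /set_mem/= r0.
rewrite gh ?divr_gt0// -muleA; congr (_ * _)%E; rewrite -EFinM; congr (_%:E).
rewrite enormZ gtr0_norm ?divr_gt0// -mulrA mulVf ?mulr1//.
by rewrite gt_eqF.
Qed.

Lemma integral_itvNyb (f : R -> \bar R) (a b : R) : 
  (\int[leb]_(r in [set r | (a < r)%R]) (if (r <= b)%R then f r else 0) =
   \int[leb]_(r in `]a, b]) f r)%E.
Proof.
rewrite integral_bool [RHS]integral_mkcond; apply: eq_integral => r _.
by rewrite patchE mem_setE in_itv/=; case: (a < r)%R => //; case: (r <= b)%R.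
Qed.

Lemma integral_radial_near n (g : 'rV[R]_n.+1 -> \bar R) (p delta : R) :
  measurable_fun setT g -> (forall x, (0 <= g x)%E) ->
  (forall c x, 0 < c -> g (c *: x) = g x) -> p < n.+1%:R -> 0 < delta ->
  (\int[lebesgue_rV R n.+1]_(h in [set h | (0 < enorm h <= delta)%R])
      (g h * (enorm h `^ (- p))%:E) =
   (\int[lebesgue_rV R n.+1]_(k in pball R n.+1) g k) *
   (n.+1%:R * (delta `^ (n.+1%:R - p) / (n.+1%:R - p)))%:E)%E.
Proof.
move=> mg g0 gh pn d0.
pose w (r : R) := if r <= delta then r `^ (- p) else 0.
transitivity (\int[lebesgue_rV R n.+1]_(h in [set h | (0 < enorm h)%R])
   (g h * (w (enorm h))%:E))%E.
  rewrite !integral_bool; apply: eq_integral => h _; rewrite /w.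
  by case: ltP => //= h0; case: ifPn => // _; rewrite mule0.
rewrite integral_radial//; last 2 first.
- by apply: measurable_fun_ifT => //; exact: measurable_fun_ler.
- by move=> r; rewrite /w; case: ifPn => // _; exact: powR_ge0.
congr (_ * _)%E.
rewrite (_ : (fun r => _) = fun r => if (r <= delta)%R then (n.+1%:R * (r `^ (- p) * r ^+ n))%:E else 0%E); last first.
  by apply/funext => r; rewrite /w; case: ifPn => _; rewrite ?mul0r// mulrCA.
rewrite integral_itvNyb.
under eq_integral => r.
  rewrite inE/= in_itv/= => /andP[r0 _].
  rewrite (_ : _ * _ = n.+1%:R * r `^ ((n.+1%:R - p) - 1)); last first.
    rewrite -powR_mulrn ?ltW// -powRD; last by rewrite (gt_eqF r0) implybT.
    by congr (_ * _ `^ _); rewrite -(natr1 n); ring.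
  rewrite EFinM.
over.
rewrite ge0_integralZl//.
- by rewrite integral_powR_itv0// subr_gt0.
- exact: measurable_powR_EFin.
- by move=> r _; rewrite lee_fin powR_ge0.
Qed.

Lemma integral_radial_far n (q delta : R) : n.+1%:R < q -> 0 < delta ->
  (\int[lebesgue_rV R n.+1]_(h in [set h | (delta < enorm h)%R]) (enorm h `^ (- q))%:E =
   (ball_volume R n.+1 *
    (n.+1%:R * (delta `^ (- (q - n.+1%:R)) / (q - n.+1%:R))))%:E)%E.
Proof.
move=> qn d0.
pose w (r : R) := if delta < r then r `^ (- q) else 0.
transitivity (\int[lebesgue_rV R n.+1]_(h in [set h | (0 < enorm h)%R])
   (1%E * (w (enorm h))%:E))%E.
  rewrite !integral_bool; apply: eq_integral => h _; rewrite /w mul1e.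
  case: ifPn => dh; first by rewrite (lt_trans d0 dh).
  by case: ifPn.
rewrite (integral_radial (g := fun=> 1%E))//; last 2 first.
- by apply: measurable_fun_ifT => //; exact: measurable_fun_ltr.
- by move=> r; rewrite /w; case: ifPn => // _; exact: powR_ge0.
rewrite integral_pball1// EFinM; congr (_ * _)%E.
transitivity (\int[leb]_(r in `]delta, +oo[) (n.+1%:R * r `^ (- (q - n.+1%:R) - 1))%:E)%E.
  rewrite integral_bool [RHS]integral_mkcond; apply: eq_integral => r _.
  rewrite patchE mem_setE in_itv/= andbT /w.
  case: ifPn => r0; last by rewrite ifF//; apply/negbTE; apply: contra r0; exact: lt_trans.
  case: ifPn => dr; last by rewrite mul0r.
  rewrite mulrCA -powR_mulrn ?ltW// -powRD; last by rewrite (gt_eqF r0) implybT.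
  by congr (_ * _ `^ _)%:E; rewrite -(natr1 n); ring.
under eq_integral do rewrite EFinM.
rewrite ge0_integralZl//; first last.
- by move=> r _; rewrite lee_fin powR_ge0.
- exact: measurable_powR_EFin.
rewrite integral_itv_obnd_cbnd; last exact: measurable_powR_EFin.
by rewrite integral_powRN_itvy// subr_gt0.
Qed.

End radial.

(** * The spherical mean of G_{1/2} *)

(** Since the inverse of 0 is 0, the direction of the origin is 0, and bounds such as
    [dotv_unitv_le] hold for every k. *)
Definition unitv (R : realType) n (k : 'rV[R]_n) : 'rV[R]_n := (enorm k)^-1 *: k.

Section spherical.
Context (R : realType).
Local Notation leb := (@lebesgue_measure R).

Lemma dotvZr n (c : R) (x y : 'rV[R]_n) : dotv x (c *: y) = c * dotv x y.
Proof. by rewrite dotvC dotvZl dotvC. Qed.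

Lemma sqr_Qarea n (a : 'rV[R]_n) : Qarea a ^+ 2 = 1 + dotv a a.
Proof. by rewrite /Qarea sqr_enorm sqr_sqrtr// addr_ge0// dotvv_ge0. Qed.

Lemma Qarea_gt0 n (a : 'rV[R]_n) : 0 < Qarea a.
Proof. by rewrite /Qarea sqrtr_gt0 onesqr_gt0. Qed.

Lemma QareaV n (a : 'rV[R]_n) : (Qarea a)^-1 = (1 + dotv a a) `^ (- 2^-1).
Proof. by rewrite -sqr_Qarea powRN powR12_sqrt ?sqr_ge0// sqrtr_sqr gtr0_norm// Qarea_gt0. Qed.

Lemma dotv_unitv n (k : 'rV[R]_n) : k != 0 -> dotv (unitv k) (unitv k) = 1.
Proof.
move=> k0; rewrite /unitv dotvZl dotvZr -sqr_enorm mulrA -expr2 -exprMn.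
by rewrite mulVf ?expr1n// enorm_eq0.
Qed.

Lemma dotv_unitv_le n (a k : 'rV[R]_n) : `|dotv a (unitv k)| <= enorm a.
Proof.
rewrite -(ler_pXn2r (n := 2))// ?nnegrE ?enorm_ge0// real_normK ?num_real//.
rewrite sqr_enorm; apply: (le_trans (dotv_sqr_le _ _)).
rewrite -[leRHS]mulr1; apply: ler_wpM2l; first exact: dotvv_ge0.
have [->|k0] := eqVneq k 0; last by rewrite dotv_unitv.
by rewrite /unitv scaler0 /dotv big1// => i _; rewrite mxE mulr0.
Qed.

Lemma measurable_enormV n : measurable_fun setT (fun k : 'rV[R]_n => (enorm k)^-1).
Proof.
rewrite (_ : (fun k => _) = fun k => enorm k `^ (-1)); last first.
  by apply/funext => k; rewrite powR_inv1// enorm_ge0.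
by apply: (measurableT_comp (measurable_powR _)); exact: measurable_enorm.
Qed.

Lemma measurable_dotv_unitv n (a : 'rV[R]_n) :
  measurable_fun setT (fun k => dotv a (unitv k)).
Proof.
rewrite (_ : (fun k => _) = fun k => (enorm k)^-1 * dotv a k); last first.
  by apply/funext => k; rewrite dotvZr.
apply: measurable_funM; last exact: measurable_dotv.
exact: measurable_enormV.
Qed.

Lemma unitvZ n c (k : 'rV[R]_n) : 0 < c -> unitv (c *: k) = unitv k.
Proof.
move=> c0; rewrite /unitv enormZ gtr0_norm// invfM scalerA mulrAC mulVf ?mul1r//.
by rewrite gt_eqF.
Qed.

Lemma integral_ellipsoid n (a : 'rV[R]_n.+1) :
  (\int[lebesgue_rV R n.+1]_(k in pball R n.+1)
     ((1 + dotv a (unitv k) ^+ 2) `^ (- (n.+1%:R / 2)))%:E =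
   (ball_volume R n.+1 / Qarea a)%:E)%E.
Proof.
have [T [mT sT] ET] := volume_scaling_quadratic a.
pose f (x : 'rV[R]_n.+1) : \bar R := (if (dotv x x < 1)%R then 1 else 0)%E.
pose F (h : 'rV[R]_n.+1) : \bar R := (if (dotv h h + dotv a h ^+ 2 < 1)%R then 1 else 0)%E.
have md : measurable_fun setT (fun x : 'rV[R]_n.+1 => dotv x x).
  by apply: measurable_sum => i; apply: measurable_funM; exact: measurable_coor.
have mf : measurable_fun setT f.
  by apply: measurable_fun_ifT => //; exact: measurable_fun_ltr.
have mF : measurable_fun setT F.
  apply: measurable_fun_ifT => //; apply: measurable_fun_ltr => //.
  by apply: measurable_funD => //; apply: measurable_funX; exact: measurable_dotv.
have f0 x : (0 <= f x)%E by rewrite /f; case: ifPn.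
have F0 x : (0 <= F x)%E by rewrite /F; case: ifPn.
have E1 : ((Qarea a)%:E * \int[lebesgue_rV R n.+1]_h F h = (ball_volume R n.+1)%:E)%E.
  rewrite (_ : F = f \o T); last by apply/funext => h; rewrite /f /F/= ET.
  rewrite (sT f mf f0) /f -(integral_bool _ (fun x => dotv x x < 1)) ball_volumeE.
  rewrite integral_cst ?mul1e.
    congr (lebesgue_rV _ _ _); apply/seteqP; split => x /=; rewrite /uball/=.
      by rewrite -sqr_enorm expr_lt1// enorm_ge0.
    by rewrite -sqr_enorm expr_lt1// enorm_ge0.
  rewrite (_ : [set _ | _] = uball R n.+1); first exact: measurable_uball.
  by apply/seteqP; split => x /=; rewrite /uball/= -sqr_enorm expr_lt1// enorm_ge0.
have -> : (ball_volume R n.+1 / Qarea a)%:E = (\int[lebesgue_rV R n.+1]_h F h)%E.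
  rewrite mulrC EFinM -E1 muleA -EFinM mulVf; [by rewrite mul1e|by rewrite (gt_eqF (Qarea_gt0 a))].
rewrite [RHS]integral_origin// setTI ge0_integral_polar//.
apply: eq_integral => k /set_mem/= /andP[k0 _].
have k1 : k != 0 by rewrite -enorm_gt0.
set m := 1 + dotv a (unitv k) ^+ 2.
have m0 : 0 < m := onesqr_gt0 _.
(* [rho] is the distance from the origin to the boundary of the ellipsoid in the direction of k, and
   d int_0^rho r^(d-1) dr = rho^d = m^(-d/2). *)
pose rho := m `^ (- 2^-1).
have rho0 : 0 < rho by exact: powR_gt0.
have rho2 : rho ^+ 2 = m^-1.
  by rewrite -powR_mulrn ?powR_ge0// -powRrM mulNr mulVf// powR_inv1// ltW.
transitivity (\int[leb]_(r in `]0%R, rho[) (n.+1%:R%:E * (r `^ (n.+1%:R - 1))%:E))%E.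
  rewrite ge0_integralZl//; last 2 first.
  - exact: measurable_powR_EFin.
  - by move=> r _; rewrite lee_fin powR_ge0.
  rewrite integral_itv_bndo_bndc; last exact: measurable_powR_EFin.
  rewrite integral_powR_itv0// -EFinM mulrCA mulfV ?mulr1 ?pnatr_eq0//.
  by rewrite /rho -powRrM; congr (_ `^ _)%:E; field.
rewrite [RHS]integral_bool [LHS]integral_mkcond; apply: eq_integral => r _.
rewrite patchE mem_setE in_itv/=; have [r0|//] := boolP (0 < r).
rewrite (_ : (r / enorm k)%R *: k = r *: unitv k); last by rewrite /unitv scalerA.
rewrite /F (dotvZl r) !(dotvZr r) dotv_unitv//.
have -> : r * (r * 1) + (r * dotv a (unitv k)) ^+ 2 = r ^+ 2 * m by rewrite /m; ring.
rewrite -ltr_pdivlMr// mul1r -rho2 ltr_pXn2r ?nnegrE ?ltW//=.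
case: ifPn => _; last by rewrite mul0e.
rewrite mul1e -EFinM; congr (_ * _)%:E.
rewrite -powR_mulrn ?ltW//; congr (_ `^ _).
by rewrite -(natr1 n); ring.
Qed.

End spherical.

(** * Differentiation under the integral sign on a set of finite measure *)

Section derivative_under_integral.
Context (R : realType) d (T : measurableType d) (mu : {measure set T -> \bar R}).
Variables (B : set T) (mB : measurable B) (Bfin : (mu B < +oo)%E).

Lemma bounded_integrable (f : T -> R) (M : R) :
  measurable_fun setT f -> (forall y, `|f y| <= M) -> mu.-integrable B (EFin \o f).
Proof.
move=> mf fM; apply: measurable_bounded_integrable => //.
  exact: measurable_funTS.
exists M; split; [exact: num_real|move=> x Mx y _ /=]; exact: le_trans (fM y) (ltW Mx).
Qed.

(** On a set of finite measure constants are integrable. The bound [C t], which may depend on t,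
    gives integrability of [f t]; only the bound [M] on the derivative has to be uniform in t. *)
Lemma is_derive_integral (f df : R -> T -> R) (M : R) (C : R -> R) (t0 : R) :
  (forall t, measurable_fun setT (f t)) -> (forall t y, `|f t y| <= C t) ->
  (forall t y, is_derive t (1 : R) (f ^~ y) (df t y)) ->
  (forall t y, `|df t y| <= M) ->
  is_derive t0 (1 : R) (fun t => \int[mu]_(y in B) f t y) (\int[mu]_(y in B) df t0 y).
Proof.
move=> mf fC fd dfM.
have I0 : `]t0 - 1, t0 + 1[%classic t0 by rewrite /= in_itv/=; apply/andP; split; lra.
have intf t : `]t0 - 1, t0 + 1[%classic t -> mu.-integrable B (EFin \o f t).
  by move=> _; exact: bounded_integrable.
have derf t y : `]t0 - 1, t0 + 1[%classic t -> B y -> derivable (f ^~ y) t 1.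
  by move=> _ _; exact: ex_derive.
have dE t y : partial1of2 f t y = df t y.
  by rewrite /partial1of2 derive1E; exact: derive_val.
have M0 (y : T) : 0 <= `|M| by [].
have iM : mu.-integrable B (EFin \o (fun y : T => `|M|)).
  by apply: (@bounded_integrable _ `|M|) => // y; rewrite normr_id.
have ubM t y : `]t0 - 1, t0 + 1[%classic t -> B y -> `|partial1of2 f t y| <= `|M|.
  by move=> _ _; rewrite dE (le_trans (dfM t y))// ler_norm.
apply: DeriveDef.
  exact: (derivable_under_integral mB I0 intf derf M0 iM ubM).
rewrite -derive1E (differentiation_under_integral mB I0 intf derf M0 iM ubM).
by apply: eq_Rintegral => y _; rewrite dE.
Qed.

End derivative_under_integral.

(** Equality of the derivatives is asked only for t > 0, because in [sph_Gs] it is obtained after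
    division by t. *)
Lemma eq_derive_itv01 (R : realType) (g h dg dh : R -> R) :
  (forall t : R, is_derive t (1 : R) g (dg t)) ->
  (forall t : R, is_derive t (1 : R) h (dh t)) ->
  (forall t, 0 < t -> dg t = dh t) -> g 0 = h 0 -> g 1 = h 1.
Proof.
move=> gd hd dE e0.
have ghd (t : R) : is_derive t (1 : R) (fun t => g t - h t) (dg t - dh t).
  by apply: is_deriveB.
have gc : {within `[0, 1], continuous (fun t => g t - h t)}.
  apply: continuous_subspaceT => x; apply: differentiable_continuous.
  by apply/derivable1_diffP; exact: ex_derive.
have [t] := MVT ltr01 (fun t _ => ghd t) gc.
rewrite in_itv/= => /andP[t0 _]; rewrite dE// subrr mul0r e0 subrr subr0.
by move=> /eqP; rewrite subr_eq0 => /eqP.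
Qed.

(** * Spherical moments of the integrand of G_{1/2} and of G_{1/2} itself *)

Section spherical_identity.
Context (R : realType) (n : nat).
Let d : R := n.+1%:R.
Let alpha : R := ball_volume R n.+1.
Local Notation "'sph' g" := (\int[lebesgue_rV R n.+1]_(k in pball R n.+1) g k) (at level 10).

Lemma pball_fin : (lebesgue_rV R n.+1 (pball R n.+1) < +oo)%E.
Proof.
apply: le_lt_trans (uball_fin_num R n.+1); apply: le_measure; rewrite ?inE.
- exact: measurable_pball.
- exact: measurable_uball.
- by move=> x /= /andP[].
Qed.

Lemma dotv_line (a c : 'rV[R]_n.+1) (t : R) k : dotv (a + t *: c) k = dotv a k + t * dotv c k.
Proof. by rewrite dotvDl dotvZl. Qed.

Lemma sph_ellipsoid (a : 'rV[R]_n.+1) :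
  sph (fun k => (1 + dotv a (unitv k) ^+ 2) `^ (- (d / 2))) =
  alpha * (1 + dotv a a) `^ (- 2^-1).
Proof. by rewrite /Rintegral integral_ellipsoid/= -QareaV. Qed.

(** The derivative at t = 0 of [sph_ellipsoid] along [a + t *: c]. Differentiation lowers the
    exponent -d/2 to -d/2 - 1, which is that of [Gs'] at s = 1/2; the factor -d it produces on the
    left explains alpha/d on the right. *)
Lemma sph_moment (a c : 'rV[R]_n.+1) :
  sph (fun k => Gs' n.+1 (1 / 2) (dotv a (unitv k)) *
                (dotv a (unitv k) * dotv c (unitv k))) =
  alpha / d * (dotv a c * (1 + dotv a a) `^ (- 2^-1 - 1)).
Proof.
have d0 : 0 < d by [].
pose f (t : R) k := (1 + (dotv a (unitv k) + t * dotv c (unitv k)) ^+ 2) `^ (- (d / 2)).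
pose df (t : R) k := - (d / 2) *
  (1 + (dotv a (unitv k) + t * dotv c (unitv k)) ^+ 2) `^ (- (d / 2) - 1) *
  (2 * (dotv a (unitv k) + t * dotv c (unitv k))) * dotv c (unitv k).
have mf t : measurable_fun setT (f t : 'rV[R]_n.+1 -> R).
  apply: (measurableT_comp (measurable_powR _)); apply: measurable_funD => //.
  apply: measurable_funX; apply: measurable_funD; first exact: measurable_dotv_unitv.
  by apply: measurable_funM => //; exact: measurable_dotv_unitv.
have fC t k : `|f t k| <= 1.
  rewrite ger0_norm ?powR_ge0// -[leRHS](powRr0 (1 + (dotv a (unitv k) + t * dotv c (unitv k)) ^+ 2)).
  by apply: ler_powR; [exact: onesqr_ge1|rewrite oppr_le0 divr_ge0// ltW].
have fd t k : is_derive t (1 : R) (f ^~ k) (df t k).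
  have h1 : is_derive t (1 : R) (fun t : R => dotv a (unitv k) + t * dotv c (unitv k))
      (dotv c (unitv k)).
    by apply: is_derive_eq; rewrite add0r /GRing.scale/=; ring.
  exact: (@is_derive1_comp R (fun r => (1 + r ^+ 2) `^ (- (d / 2)))
    (fun t => dotv a (unitv k) + t * dotv c (unitv k)) t _ _
    (is_derive_onesqr_powR _ _) h1).
have dfM t k : `|df t k| <= d * enorm c.
  rewrite /df; set x := dotv a _ + _; rewrite normrM ler_pM ?dotv_unitv_le//.
  rewrite (_ : _ * (2 * x) = - (d * ((1 + x ^+ 2) `^ (- (d / 2) - 1) * x))); last by field.
  rewrite normrN normrM (ger0_norm (ltW d0)).
  rewrite -[leRHS]mulr1 ler_pM2l// normrM ger0_norm ?powR_ge0//.
  (* The power is at most (1 + x^2)^-1, and |x| <= 1 + x^2. *)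
  apply: (@le_trans _ _ ((1 + x ^+ 2)^-1 * (1 + x ^+ 2))); last first.
    by rewrite mulVf// gt_eqF// onesqr_gt0.
  apply: ler_pM; rewrite ?powR_ge0//.
    rewrite -[leRHS]powR_inv1 ?(ltW (onesqr_gt0 x))//; apply: ler_powR; first exact: onesqr_ge1.
    by rewrite gerDr oppr_le0 divr_ge0// ltW.
  rewrite -[x ^+ 2]real_normK ?num_real//.
  by have := sqr_ge0 (`|x| - 1); have := normr_ge0 x; rewrite sqrrB; lra.
have D1 := is_derive_integral (@measurable_pball R n.+1) pball_fin 0 mf fC fd dfM.
pose P (t : R) := 1 + dotv a a + t * (2 * dotv a c) + t ^+ 2 * dotv c c.
have PE t : P t = 1 + dotv (a + t *: c) (a + t *: c).
  by rewrite dotv_line ![dotv _ (a + _)]dotvC !dotv_line (dotvC c a) /P; ring.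
have P0 t : 0 < P t by rewrite PE ltr_pwDl// dotvv_ge0.
have fE t : sph (f t) = alpha * P t `^ (- 2^-1).
  rewrite PE -sph_ellipsoid; apply: eq_Rintegral => k _.
  by rewrite /f dotv_line.
have h1 : is_derive (0 : R) (1 : R) P (2 * dotv a c).
  by apply: is_derive_eq; rewrite /GRing.scale/=; ring.
have h2 := @is_derive1_comp R (fun r => r `^ (- 2^-1)) P 0 _ _ (is_derive1_powR _ (P0 0)) h1.
have D2 : is_derive (0 : R) (1 : R) (fun t => sph (f t))
    (alpha * (- 2^-1 * P 0 `^ (- 2^-1 - 1) * (2 * dotv a c))).
  rewrite (_ : (fun t => _) = fun t => alpha * P t `^ (- 2^-1)); last exact/funext.
  have := is_deriveM (is_derive_cst alpha (0 : R) (1 : R)) h2.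
  by move=> h; apply: (is_derive_eq h); rewrite scaler0 addr0.
have : sph (df 0) = alpha * (- 2^-1 * P 0 `^ (- 2^-1 - 1) * (2 * dotv a c)).
  by rewrite -(@derive_val _ _ _ _ _ _ _ D1) -(@derive_val _ _ _ _ _ _ _ D2).
rewrite {1}/P mul0r expr0n mul0r !addr0 => E.
have E2 : sph (df 0) = - d * sph (fun k => Gs' n.+1 (1 / 2) (dotv a (unitv k)) *
                (dotv a (unitv k) * dotv c (unitv k))).
  rewrite -RintegralZl//.
  - apply: eq_Rintegral => k _; rewrite /df mul0r addr0 /Gs'.
    rewrite (_ : - (n.+1%:R + 1 + 2 * (1 / 2)) / 2 = - (d / 2) - 1); last by rewrite /d; field.
    by field.
  - exact: measurable_pball.
  - apply: (@bounded_integrable _ _ _ _ _ (@measurable_pball R n.+1) pball_fin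
      _ (enorm a * enorm c)).
    + apply: measurable_funM.
        apply: (measurableT_comp (continuous_measurable_fun (@continuous_onesqr_powR R _))).
        exact: measurable_dotv_unitv.
      by apply: measurable_funM; exact: measurable_dotv_unitv.
    + move=> k; rewrite normrM ger0_norm ?(ltW (Gs'_gt0 _ _ _))//.
      rewrite -[leRHS]mul1r ler_pM ?(ltW (Gs'_gt0 _ _ _))// ?Gs'_le1//.
      by rewrite normrM ler_pM// dotv_unitv_le.
have dN0 : - d != 0 by rewrite oppr_eq0 gt_eqF.
apply: (mulfI dN0); rewrite -E2 E.
by field; rewrite gt_eqF.
Qed.

Lemma sph_Gs (a c : 'rV[R]_n.+1) :
  sph (fun k => Gs n.+1 (1 / 2) (dotv a (unitv k)) * dotv c (unitv k)) =
  alpha / d * (dotv a c / Qarea a).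
Proof.
pose f (t : R) k := Gs n.+1 (1 / 2) (t * dotv a (unitv k)) * dotv c (unitv k).
pose df (t : R) k := Gs' n.+1 (1 / 2) (t * dotv a (unitv k)) *
  (dotv a (unitv k) * dotv c (unitv k)).
have mf t : measurable_fun setT (f t : 'rV[R]_n.+1 -> R).
  apply: measurable_funM; last exact: measurable_dotv_unitv.
  apply: (measurableT_comp (measurable_Gs _ _)).
  by apply: measurable_funM => //; exact: measurable_dotv_unitv.
have h0 : 0 <= 1 / 2 :> R by rewrite divr_ge0.
have fC t k : `|f t k| <= `|t| * enorm a * enorm c.
  rewrite /f normrM ler_pM ?dotv_unitv_le//.
  rewrite -[Gs _ _ _]subr0 -(Gs0 n.+1 (1 / 2)); apply: (le_trans (Gs_lip _ _ _ h0)).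
  by rewrite subr0 normrM ler_wpM2l ?dotv_unitv_le.
have fd t k : is_derive t (1 : R) (f ^~ k) (df t k).
  have h1 : is_derive t (1 : R) (fun t : R => t * dotv a (unitv k)) (dotv a (unitv k)).
    by apply: is_derive_eq; rewrite /GRing.scale/=; ring.
  have h2 := @is_derive1_comp R (Gs n.+1 (1 / 2)) (fun t => t * dotv a (unitv k)) t _ _
    (is_derive_Gs _ _ _) h1.
  have h := is_deriveM h2 (is_derive_cst (dotv c (unitv k)) t (1 : R)).
  by apply: (is_derive_eq h); rewrite scaler0 add0r /df /GRing.scale/=; ring.
have dfM t k : `|df t k| <= enorm a * enorm c.
  rewrite /df normrM ger0_norm ?(ltW (Gs'_gt0 _ _ _))//.
  rewrite -[leRHS]mul1r ler_pM ?(ltW (Gs'_gt0 _ _ _))// ?Gs'_le1//.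
  by rewrite normrM ler_pM// dotv_unitv_le.
have D1 t := is_derive_integral (@measurable_pball R n.+1) pball_fin t mf fC fd dfM.
pose A := dotv a a; pose C := alpha / d * dotv a c.
have A0 t : 0 < 1 + t ^+ 2 * A.
  by rewrite ltr_pwDl// mulr_ge0 ?sqr_ge0// dotvv_ge0.
(* [h t] is the right-hand side at [t *: a]; the two parts of its derivative combine into [C] times
   the power -3/2 of 1 + t^2 |a|^2, the moment found above. *)
pose h (t : R) := C * (t * (1 + t ^+ 2 * A) `^ (- 2^-1)).
have hd t : is_derive t (1 : R) h (C * (1 + t ^+ 2 * A) `^ (- 2^-1 - 1)).
  have h1 : is_derive t (1 : R) (fun t : R => 1 + t ^+ 2 * A) (2 * t * A).
    by apply: is_derive_eq; rewrite /GRing.scale/=; ring.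
  have h2 := @is_derive1_comp R (fun r => r `^ (- 2^-1)) (fun t => 1 + t ^+ 2 * A) t _ _
    (is_derive1_powR _ (A0 t)) h1.
  have h3 := is_deriveM (is_derive_cst C t (1 : R)) (is_deriveM (is_derive_id t (1 : R)) h2).
  apply: (is_derive_eq h3); rewrite scaler0 addr0 /GRing.scale/=.
  rewrite (_ : _ `^ (- 2^-1) = (1 + t ^+ 2 * A) * (1 + t ^+ 2 * A) `^ (- 2^-1 - 1)).
    by field.
  rewrite -{2}[1 + t ^+ 2 * A]powRr1 ?(ltW (A0 t))// -powRD; last by rewrite (gt_eqF (A0 t)) implybT.
  by congr (_ `^ _); ring.
have dfE t : 0 < t -> sph (df t) = C * (1 + t ^+ 2 * A) `^ (- 2^-1 - 1).
  move=> t0.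
  have tN0 : t != 0 by rewrite gt_eqF.
  (* At [t *: a] both sides of the moment identity carry one more factor t than is wanted, which is
     cancelled because t > 0. *)
  have := sph_moment (t *: a) c.
  rewrite !dotvZl dotvZr.
  have -> : sph (fun k => Gs' n.+1 (1 / 2) (dotv (t *: a) (unitv k)) *
      (dotv (t *: a) (unitv k) * dotv c (unitv k))) = t * sph (df t).
    rewrite -RintegralZl//.
    - by apply: eq_Rintegral => k _; rewrite /df !dotvZl; ring.
    - exact: measurable_pball.
    - apply: (@bounded_integrable _ _ _ _ _ (@measurable_pball R n.+1) pball_fin
        _ (enorm a * enorm c)) => //.
      apply: measurable_funM.
        apply: (measurableT_comp (continuous_measurable_fun (@continuous_onesqr_powR R _))).
        by apply: measurable_funM => //; exact: measurable_dotv_unitv.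
      by apply: measurable_funM; exact: measurable_dotv_unitv.
  have -> : t * (t * dotv a a) = t ^+ 2 * A by rewrite mulrA.
  move=> E; apply: (mulfI tN0); rewrite E /C; ring.
have e0 : sph (f 0) = h 0.
  rewrite /h mul0r mulr0; transitivity (sph (fun=> 0 : R)).
    by apply: eq_Rintegral => k _; rewrite /f mul0r Gs0 mul0r.
  by rewrite /Rintegral integral0.
have f1 k : f 1 k = Gs n.+1 (1 / 2) (dotv a (unitv k)) * dotv c (unitv k).
  by rewrite /f [1 * dotv _ _]mul1r.
rewrite -(eq_Rintegral _ (fun k _ => f1 k)).
rewrite (eq_derive_itv01 D1 hd dfE e0).
by rewrite /h /C expr1n !mul1r QareaV mulrA.
Qed.

Lemma integral_pball_Gs (a b : 'rV[R]_n.+1) :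
  (\int[lebesgue_rV R n.+1]_(k in pball R n.+1)
    ((Gs n.+1 (1 / 2) (dotv a (unitv k)) - Gs n.+1 (1 / 2) (dotv b (unitv k))) *
     (dotv a (unitv k) - dotv b (unitv k)))%:E =
  (alpha / d * dotv ((Qarea a)^-1 *: a - (Qarea b)^-1 *: b) (a - b))%:E)%E.
Proof.
have h0 : 0 <= 1 / 2 :> R by rewrite divr_ge0.
have ig x : (lebesgue_rV R n.+1).-integrable (pball R n.+1)
    (EFin \o (fun k => Gs n.+1 (1 / 2) (dotv x (unitv k)) * dotv (a - b) (unitv k))).
  apply: (@bounded_integrable _ _ _ _ _ (@measurable_pball R n.+1) pball_fin
      _ (enorm x * enorm (a - b))) => //.
    apply: measurable_funM; last exact: measurable_dotv_unitv.
    by apply: (measurableT_comp (measurable_Gs _ _)); exact: measurable_dotv_unitv.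
  move=> k; rewrite normrM ler_pM ?dotv_unitv_le//.
  rewrite -[Gs _ _ _]subr0 -(Gs0 n.+1 (1 / 2)); apply: (le_trans (Gs_lip _ _ _ h0)).
  by rewrite subr0 dotv_unitv_le.
under eq_integral => k _.
  rewrite -dotvNl -dotvDl mulrBl EFinB.
over.
have mp := @measurable_pball R n.+1.
rewrite integralB//; last 2 first.
- exact: ig.
- exact: ig.
have iE x : (\int[lebesgue_rV R n.+1]_(k in pball R n.+1)
    (Gs n.+1 (1 / 2) (dotv x (unitv k)) * dotv (a - b) (unitv k))%:E =
    (alpha / d * (dotv x (a - b) / Qarea x))%:E)%E.
  by rewrite -sph_Gs fineK//; apply: integrable_fin_num => //; exact: ig.
rewrite !iE -EFinB dotvDl dotvNl !dotvZl; congr (_%:E); ring.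
Qed.

End spherical_identity.

(** Write Q for [Qarea]. As |a|^2 = Q(a)^2 - 1, the left side is (Q(a) + Q(b)) (1 - (1 + a.b) /
    (Q(a) Q(b))). The quotient is the scalar product of the unit vectors nu(a) and nu(b), so the
    second factor is |nu(a) - nu(b)|^2 / 2. *)
Lemma nu_hat_dotv (R : realType) n (a b : 'rV[R]_n) :
  dotv ((Qarea a)^-1 *: a - (Qarea b)^-1 *: b) (a - b) =
  enorm (nu_hat a - nu_hat b) ^+ 2 * ((Qarea a + Qarea b) / 2).
Proof.
have dotv_row (x y : 'rV[R]_n) (s t : R) :
    dotv (row_mx x s%:M) (row_mx y t%:M : 'rV_(n + 1)) = dotv x y + s * t.
  rewrite /dotv big_split_ord/=; congr (_ + _).
    by apply: eq_bigr => i _; rewrite !row_mxEl.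
  by rewrite big_ord1 !row_mxEr !mxE !eqxx !mulr1n.
rewrite sqr_enorm /nu_hat !(dotvDl, dotvNl, dotvZl).
rewrite ![dotv _ (_ *: _ - _)]dotvC ![dotv _ (a - _)]dotvC !(dotvDl, dotvNl, dotvZl) !dotv_row.
rewrite (dotvC b a).
have Qa := sqr_Qarea a; have Qb := sqr_Qarea b.
have -> : dotv a a = Qarea a ^+ 2 - 1 by rewrite Qa; ring.
have -> : dotv b b = Qarea b ^+ 2 - 1 by rewrite Qb; ring.
by field; rewrite !gt_eqF ?Qarea_gt0.
Qed.

(** * Difference quotients in L^2 *)

Section square_integrals.
Context (R : realType) (n : nat).
Implicit Types (f g psi : 'rV[R]_n -> R) (G : 'rV[R]_n -> 'rV[R]_n) (h : 'rV[R]_n).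

Definition N2 f : \bar R := (\int[lebesgue_rV R n]_x (f x ^+ 2)%:E)%E.

Lemma N2_ge0 f : (0 <= N2 f)%E.
Proof. by apply: integral_ge0 => x _; rewrite lee_fin sqr_ge0. Qed.

Lemma measurable_sqr_EFin f : measurable_fun setT f ->
  measurable_fun setT (fun x => (f x ^+ 2)%:E).
Proof. by move=> mf; apply/measurable_EFinP; exact: measurable_funX. Qed.

Lemma le_N2 f g : measurable_fun setT f -> measurable_fun setT g ->
  (forall x, f x ^+ 2 <= g x ^+ 2) -> (N2 f <= N2 g)%E.
Proof.
move=> mf mg fg; apply: ge0_le_integral => //.
- by move=> x _; rewrite lee_fin sqr_ge0.
- exact: measurable_sqr_EFin.
- exact: measurable_sqr_EFin.
- by move=> x _; rewrite lee_fin.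
Qed.

Lemma N2Z (c : R) f : measurable_fun setT f ->
  (N2 (fun x => c * f x)%R = (c ^+ 2)%:E * N2 f)%E.
Proof.
move=> mf; rewrite /N2.
under eq_integral do rewrite exprMn EFinM.
rewrite ge0_integralZl//.
- exact: measurable_sqr_EFin.
- by move=> x _; rewrite lee_fin sqr_ge0.
- by rewrite lee_fin sqr_ge0.
Qed.

Lemma N2D f g : measurable_fun setT f -> measurable_fun setT g ->
  (N2 (fun x => f x + g x)%R <= 2%:E * N2 f + 2%:E * N2 g)%E.
Proof.
move=> mf mg; rewrite /N2.
have mf2 := measurable_sqr_EFin mf; have mg2 := measurable_sqr_EFin mg.
have f20 x : (0 <= (f x ^+ 2)%:E)%E by rewrite lee_fin sqr_ge0.
have g20 x : (0 <= (g x ^+ 2)%:E)%E by rewrite lee_fin sqr_ge0.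
rewrite -!ge0_integralZl// -ge0_integralD//; last 4 first.
- by move=> x _; rewrite mule_ge0.
- exact: measurable_funeM.
- by move=> x _; rewrite mule_ge0.
- exact: measurable_funeM.
apply: ge0_le_integral => //.
- by move=> x _; rewrite lee_fin sqr_ge0.
- by apply: measurable_sqr_EFin; exact: measurable_funD.
- by apply: emeasurable_funD; exact: measurable_funeM.
- move=> x _; rewrite -!EFinM -EFinD lee_fin.
  have := sqr_ge0 (f x - g x); rewrite sqrrB sqrrD; lra.
Qed.

Lemma integral_translate (f : 'rV[R]_n -> \bar R) h : measurable_fun setT f ->
  (forall x, (0 <= f x)%E) ->
  (\int[lebesgue_rV R n]_x f (x + h)%R = \int[lebesgue_rV R n]_x f x)%E.
Proof.
move=> mf f0; have [_ E] := volume_scaling_translation h.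
by rewrite -[RHS]E// mul1e.
Qed.

Lemma measurable_translate h : measurable_fun setT (fun x : 'rV[R]_n => x + h).
Proof. by have [mT _] := volume_scaling_translation h. Qed.

Lemma measurable_comp_translate f h : measurable_fun setT f ->
  measurable_fun setT (fun x : 'rV[R]_n => f (x + h)).
Proof. by move=> mf; exact: (measurableT_comp mf (measurable_translate h)). Qed.

Lemma N2_translate f h : measurable_fun setT f -> N2 (fun x => f (x + h)) = N2 f.
Proof.
move=> mf; rewrite /N2 (integral_translate (f := fun x => (f x ^+ 2)%:E))//.
  exact: measurable_sqr_EFin.
by move=> x; rewrite lee_fin sqr_ge0.
Qed.

Definition incr f h x := f (x + h) - f x.

Lemma measurable_incr f h : measurable_fun setT f -> measurable_fun setT (incr f h).
Proof. by move=> mf; apply: measurable_funB => //; exact: measurable_comp_translate. Qed.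

Lemma N2N f : N2 (fun x => - f x) = N2 f.
Proof. by rewrite /N2; under eq_integral do rewrite sqrrN. Qed.

Lemma N2_incr_le f h : measurable_fun setT f -> (N2 (incr f h) <= 4%:E * N2 f)%E.
Proof.
move=> mf; have mfh := measurable_comp_translate h mf.
apply: (le_trans (N2D mfh (measurable_funN mf))).
rewrite N2_translate// N2N -ge0_muleDl ?lee_fin//.
by rewrite -EFinD; have -> : 2 + 2 = 4 :> R by lra.
Qed.

(** The increment over 2h is the sum of two translates of the increment over h. The factor 4 is
    exactly the growth of |h|^2 under doubling, so iterating it does not degrade a bound by
    |h|^2. *)
Lemma N2_incr_double f h : measurable_fun setT f ->
  (N2 (incr f (h + h)) <= 4%:E * N2 (incr f h))%E.
Proof.
move=> mf; have mi := measurable_incr h mf.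
have -> : incr f (h + h) = (fun x => incr f h (x + h) + incr f h x).
  by apply/funext => x; rewrite /incr addrA; ring.
apply: (le_trans (N2D (measurable_comp_translate h mi) mi)).
rewrite N2_translate// -ge0_muleDl ?lee_fin//.
by rewrite -EFinD; have -> : 2 + 2 = 4 :> R by lra.
Qed.

Definition measurable_field G := forall i, measurable_fun setT (fun x => G x ord0 i).

Lemma measurable_field_dotv G h : measurable_field G ->
  measurable_fun setT (fun x => dotv (G x) h).
Proof. by move=> mG; apply: measurable_sum => i; apply: measurable_funM => //; exact: mG. Qed.

Lemma measurable_field_enorm G : measurable_field G ->
  measurable_fun setT (fun x => enorm (G x)).
Proof.
move=> mG; apply: (measurableT_comp (@measurable_enorm R n)).
by apply: measurable_fun_rV => i; exact: mG.
Qed.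

Lemma N2_dotv_le G h : measurable_field G ->
  (N2 (fun x => dotv (G x) h) <= (enorm h ^+ 2)%:E * N2 (fun x => enorm (G x)))%E.
Proof.
move=> mG; rewrite -N2Z; last exact: measurable_field_enorm.
apply: le_N2; first exact: measurable_field_dotv.
  by apply: measurable_funM => //; exact: measurable_field_enorm.
move=> x; rewrite exprMn !sqr_enorm mulrC; exact: dotv_sqr_le.
Qed.

Definition remainder f G h x := incr f h x - dotv (G x) h.

Lemma measurable_remainder f G h : measurable_fun setT f -> measurable_field G ->
  measurable_fun setT (remainder f G h).
Proof.
by move=> mf mG; apply: measurable_funB; [exact: measurable_incr|exact: measurable_field_dotv].
Qed.

(** Fourth power of |h|: [N2] is a squared norm and a second-order Taylor remainder has size |h|^2.
    Test functions satisfy this with their gradient. *)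
Definition quartic_remainder f G (C : R) :=
  forall h, (N2 (remainder f G h) <= (C * enorm h ^+ 4)%:E)%E.

Lemma quartic_remainderB f g F G (C D : R) :
  measurable_fun setT f -> measurable_fun setT g ->
  measurable_field F -> measurable_field G ->
  quartic_remainder f F C -> quartic_remainder g G D ->
  quartic_remainder (fun x => f x - g x) (fun x => F x - G x) (2 * C + 2 * D).
Proof.
move=> mf mg mF mG fC gD h.
have -> : remainder (fun x => f x - g x) (fun x => F x - G x) h =
    (fun x => remainder f F h x + - remainder g G h x).
  by apply/funext => x; rewrite /remainder /incr dotvDl dotvNl; ring.
apply: (le_trans (N2D _ _)); first exact: measurable_remainder.
  by apply: measurable_funN; exact: measurable_remainder.
rewrite N2N.
have -> : ((2 * C + 2 * D) * enorm h ^+ 4)%:E =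
    (2%:E * (C * enorm h ^+ 4)%:E + 2%:E * (D * enorm h ^+ 4)%:E)%E.
  by rewrite -!EFinM -EFinD; congr (_%:E); ring.
by apply: leeD; apply: lee_pmul; rewrite ?lee_fin ?N2_ge0.
Qed.

(* Doubling the step k times from h / 2^k divides the contribution of the
   remainder by 4^k, so that only the linear part survives. *)
Lemma N2_incr_dotv f G (C : R) h : measurable_fun setT f -> measurable_field G ->
  quartic_remainder f G C ->
  (N2 (incr f h) <= 2%:E * N2 (fun x => dotv (G x) h))%E.
Proof.
move=> mf mG fC.
have step k : (N2 (incr f h) <= (4 ^+ k)%:E * N2 (incr f ((2 ^+ k)^-1 *: h)))%E.
  elim: k => [|k IHk]; first by rewrite expr0 invr1 scale1r mul1e.
  apply: (le_trans IHk); rewrite exprSr EFinM -muleA.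
  apply: lee_pmul; rewrite ?lee_fin ?N2_ge0 ?exprn_ge0//.
  have -> : (2 ^+ k)^-1 *: h = (2 ^+ k.+1)^-1 *: h + (2 ^+ k.+1)^-1 *: h.
    rewrite -scalerDl exprS; congr (_ *: _); field; exact: expf_neq0.
  exact: N2_incr_double.
have est k : (N2 (incr f h) <= 2%:E * N2 (fun x => dotv (G x) h) +
    (2 * C * enorm h ^+ 4 * (4 ^+ k)^-1)%:E)%E.
  apply: (le_trans (step k)); set t := (2 ^+ k)^-1.
  have -> : incr f (t *: h) = (fun x => t * dotv (G x) h + remainder f G (t *: h) x).
    by apply/funext => x; rewrite /remainder dotvZr; ring.
  have mGh := measurable_field_dotv h mG.
  have m1 : measurable_fun setT (fun x => t * dotv (G x) h) by exact: measurable_funM.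
  apply: (@le_trans _ _ ((4 ^+ k)%:E * (2%:E * ((t ^+ 2)%:E * N2 (fun x => dotv (G x) h)) +
      2%:E * (C * enorm (t *: h) ^+ 4)%:E))%E).
    apply: lee_pmul; rewrite ?lee_fin ?N2_ge0 ?exprn_ge0//.
    apply: (le_trans (N2D m1 (measurable_remainder _ mf mG))).
    rewrite N2Z//; apply: leeD => //.
    by apply: lee_pmul; rewrite ?lee_fin ?N2_ge0//; exact: fC.
  have k4 : 4 ^+ k = (2 ^+ k) ^+ 2 :> R.
    by rewrite -exprM mulnC exprM; congr (_ ^+ _); lra.
  have k0 : 2 ^+ k != 0 :> R by exact: expf_neq0.
  rewrite ge0_muleDr; last 2 first.
  - by rewrite !mule_ge0 ?N2_ge0// lee_fin ?sqr_ge0.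
  - by rewrite mule_ge0// (le_trans (N2_ge0 _) (fC _)).
  apply: leeD.
    rewrite muleCA [X in (_ * X)%E]muleA -EFinM k4 /t exprVn mulfV ?mul1e ?expf_neq0//.
  rewrite -!EFinM lee_fin enormZ exprMn ger0_norm; last by rewrite invr_ge0 exprn_ge0.
  rewrite k4 /t exprVn le_eqVlt; apply/orP; left; apply/eqP; field.
  by [].
apply/lee_addgt0Pr => e e0.
set K := 2 * C * enorm h ^+ 4 in est.
have K0 : 0 <= K.
  have := le_trans (N2_ge0 _) (fC h); rewrite lee_fin /K => h0.
  by rewrite -mulrA mulr_ge0.
have [k Kk] : exists k, K * (4 ^+ k)^-1 <= e.
  exists (Num.Def.trunc (K / e)).+1.
  rewrite ler_pdivrMr ?exprn_gt0// mulrC -ler_pdivrMr//.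
  apply: (le_trans (ltW (truncnS_gt _))).
  rewrite -natrX ler_nat; apply: ltnW; exact: ltn_expl.
by apply: (le_trans (est k)); apply: leeD => //; rewrite lee_fin.
Qed.

End square_integrals.

(** * Taylor remainders of test functions *)

Section test_functions.
Context (R : realType) (n : nat).
Implicit Types (phi g : 'rV[R]_n -> R) (x h : 'rV[R]_n).

Lemma coord_le_norm x i : `|x ord0 i| <= `|x|.
Proof.
rewrite [`|x|]mx_normrE.
exact: (@le_bigmax _ _ _ 0 (fun ij : 'I_1 * 'I_n => `|x ij.1 ij.2|) (ord0, i)).
Qed.

Lemma bounded_measure_fin (A : set 'rV[R]_n) : measurable A -> bounded_set A ->
  (lebesgue_rV R n A < +oo)%E.
Proof.
move=> mA [M [_ AM]].
pose K := `|M| + 1.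
have K0 : 0 < K by rewrite ltr_pwDr// normr_ge0.
have MK : M < K by rewrite /K; have := ler_norm M; lra.
(* The lower corner is -K - 1 because the boxes are open on the left. *)
apply: (@le_lt_trans _ _ (lebesgue_rV R n [set v | forall i,
  v ord0 i \in `](const_mx (- K - 1) : 'rV[R]_n) ord0 i, (const_mx K : 'rV[R]_n) ord0 i]])).
  apply: le_measure; rewrite ?inE//; first exact: measurable_coor_itv.
  move=> x Ax i; rewrite !mxE in_itv/=.
  have := le_trans (coord_le_norm x i) (AM _ MK _ Ax).
  by rewrite ler_norml => /andP[a b]; apply/andP; split => //; lra.
rewrite lebesgue_rV_box ?ltry// => i; rewrite !mxE; lra.
Qed.

Lemma measurable_supp phi : measurable (supp phi).
Proof.
rewrite -[supp phi]setCK; apply: measurableC; apply: open_measurable_rV.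
by apply: closed_openC; exact: closed_closure.
Qed.

Lemma supp_measure_fin phi : compact (supp phi) -> (lebesgue_rV R n (supp phi) < +oo)%E.
Proof.
by move=> cphi; apply: bounded_measure_fin; [exact: measurable_supp|exact: compact_bounded].
Qed.

Lemma nsupp_eq0 phi x : ~ supp phi x -> phi x = 0.
Proof.
move=> nx; apply/eqP/negP => /negP px; apply: nx; exact: subset_closure.
Qed.

Lemma nsupp_partial (K : set 'rV[R]_n) phi i : closed K -> (forall x, ~ K x -> phi x = 0) ->
  forall x, ~ K x -> partial i phi x = 0.
Proof.
move=> cK phi0 x Kx; rewrite /partial.
rewrite (@near_eq_derive _ _ _ _ (cst 0)) ?derive_cst//.
have : nbhs x (~` K) by apply: open_nbhs_nbhs; split => //; exact: closed_openC.
by apply: filterS => y; exact: phi0.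
Qed.

Lemma compact_support_bounded (K : set 'rV[R]_n) g : compact K -> continuous g ->
  (forall x, ~ K x -> g x = 0) -> exists M, forall x, `|g x| <= M.
Proof.
move=> cK cg g0.
have : compact (g @` K) by apply: continuous_compact => //; exact: continuous_subspaceT.
move=> /compact_bounded[M [_ gM]].
exists (`|M| + 1) => x.
have [Kx|nKx] := pselect (K x); last by rewrite g0// normr0 addr_ge0.
apply: gM; first by have := ler_norm M; lra.
by exists x.
Qed.

Lemma is_derive_line g x (e : 'rV[R]_n) (t : R) : derivable g (x + t *: e) e ->
  is_derive t (1 : R) (fun r : R => g (x + r *: e)) ('D_e g (x + t *: e)).
Proof.
move=> dg.
have E : (fun h : R => h^-1 *: (((fun r : R => g (x + r *: e)) \o shift t) (h *: (1 : R)) - g (x + t *: e))) =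
    (fun h : R => h^-1 *: ((g \o shift (x + t *: e)) (h *: e) - g (x + t *: e))).
  apply/funext => h /=; congr (_ *: (g _ - _)).
  by rewrite [h *: 1]mulr1 scalerDl addrCA.
by split; rewrite /derivable /derive E.
Qed.

Lemma derive_MVT_loc (f df : R -> R) (t : R) :
  (forall x : R, is_derive x (1 : R) f (df x)) ->
  exists2 c, `|c| <= `|t| & f t - f 0 = df c * t.
Proof.
move=> fd.
have cf A : {within A, continuous f}.
  apply: continuous_subspaceT => x; apply: differentiable_continuous.
  by apply/derivable1_diffP; exact: ex_derive.
have [t0|t0] := leP 0 t.
  have [c] := MVT_segment t0 (fun r _ => fd r) (cf _).
  rewrite in_itv/= subr0 => /andP[c0 ct] E; exists c => //.
  by rewrite !ger0_norm.
have [c] := MVT_segment (ltW t0) (fun r _ => fd r) (cf _).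
rewrite in_itv/= sub0r => /andP[tc c0] E; exists c.
  by rewrite !ler0_norm ?lerN2// ltW.
by rewrite -opprB E mulrN opprK.
Qed.

(* One mean value theorem per coordinate of [h], so that only the existence of
   the partial derivatives is needed. *)
Lemma increment_MVT g x h : (forall i y, derivable g y (delta_mx ord0 i)) ->
  exists c : 'I_n -> 'rV[R]_n,
    (forall i j, `|(c i - x) ord0 j| <= `|h ord0 j|) /\
    g (x + h) - g x = \sum_(i < n) partial i g (c i) * h ord0 i.
Proof.
move=> dg.
pose p k : 'rV[R]_n := x + \row_i (if (i < k)%N then h ord0 i else 0).
have pS (i : 'I_n) : p i.+1 = p i + h ord0 i *: delta_mx ord0 i.
  apply/rowP => j; rewrite !mxE eqxx/= -addrA; congr (_ + _).
  rewrite ltnS leq_eqVlt val_eqE; have [->|ji] := eqVneq j i.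
    by rewrite ltnn/= add0r mulr1.
  by rewrite mulr0 addr0.
have step i : exists2 c, `|c| <= `|h ord0 i| &
    g (p i.+1) - g (p i) = partial i g (p i + c *: delta_mx ord0 i) * h ord0 i.
  have [c cle E] := derive_MVT_loc (h ord0 i)
    (fun t => is_derive_line (dg i (p i + t *: delta_mx ord0 i))).
  by exists c => //; rewrite pS; move: E; rewrite scale0r addr0.
pose c (i : 'I_n) := p i + sval (cid2 (step i)) *: delta_mx ord0 i.
exists c; split.
  move=> i j; rewrite /c; case: (cid2 _) => t tle _ /=.
  rewrite !mxE eqxx/=; have [->|ji] := eqVneq j i.
    by rewrite ltnn addr0 mulr1 addrC addKr.
  by rewrite mulr0 addr0 addrC addKr; case: ifPn => _; rewrite ?normr0.
have -> : g (x + h) - g x = \sum_(0 <= k < n) (g (p k.+1) - g (p k)).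
  rewrite telescope_sumr//; congr (g _ - g _); apply/rowP => j; rewrite !mxE.
    by rewrite ltn_ord.
  by rewrite addr0.
rewrite big_mkord; apply: eq_bigr => i _.
by rewrite /c; case: (cid2 _) => t tle /= ->.
Qed.

Lemma coord_le_enorm x i : `|x ord0 i| <= enorm x.
Proof.
rewrite -(ler_pXn2r (n := 2))// ?nnegrE ?enorm_ge0// real_normK ?num_real//.
by rewrite sqr_enorm; exact: sqr_coor_le.
Qed.

Lemma sum_coord_le x : \sum_(i < n) `|x ord0 i| <= n%:R * enorm x.
Proof.
apply: (@le_trans _ _ (\sum_(i < n) enorm x)).
  by apply: ler_sum => i _; exact: coord_le_enorm.
by rewrite sumr_const card_ord mulr_natl.
Qed.

(** [increment_MVT] is applied to phi and then to each of its partial derivatives, between x and an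
    intermediate point [c i]. Both steps cost the sum of the |h_i|, which is at most n |h|. *)
Lemma taylor_bound phi (M : R) x h :
  (forall i y, derivable phi y (delta_mx ord0 i)) ->
  (forall i j y, derivable (partial i phi) y (delta_mx ord0 j)) ->
  (forall i j y, `|partial j (partial i phi) y| <= M) ->
  `|remainder phi (gradient phi) h x| <= M * (n%:R * enorm h) ^+ 2.
Proof.
move=> d1 d2 bM.
have S0 : 0 <= \sum_(i < n) `|h ord0 i| by exact: sumr_ge0.
have lip i y : (forall j, `|(y - x) ord0 j| <= `|h ord0 j|) ->
    `|partial i phi y - partial i phi x| <= M * \sum_(i < n) `|h ord0 i|.
  move=> yx; have [c [_]] := increment_MVT x (y - x) (d2 i).
  rewrite [x + _]addrC subrK => ->.
  apply: (le_trans (ler_norm_sum _ _ _)); rewrite mulr_sumr; apply: ler_sum => j _.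
  by rewrite normrM ler_pM.
have [c [cx E]] := increment_MVT x h d1.
rewrite /remainder /incr E /dotv -sumrB.
apply: (@le_trans _ _ (\sum_(i < n) (M * \sum_(i < n) `|h ord0 i|) * `|h ord0 i|)).
  apply: (le_trans (ler_norm_sum _ _ _)); apply: ler_sum => i _.
  rewrite [gradient _ _ _ _]mxE -mulrBl normrM; apply: ler_wpM2r => //.
  by apply: lip => j; exact: cx.
rewrite -mulr_sumr -mulrA -expr2.
(* For n = 0 the hypothesis [bM] is vacuous and leaves the sign of [M] unknown, but both sides
   vanish. *)
have [n0|n0] := posnP n.
  rewrite (_ : \sum_(i < n) _ = 0); last by apply: big1 => i _; have := ltn_ord i; rewrite {2}n0.
  have -> : n%:R = 0 :> R by rewrite n0.
  by rewrite mul0r.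
have M0 : 0 <= M by apply: le_trans (bM (Ordinal n0) (Ordinal n0) 0).
apply: ler_wpM2l => //; rewrite ler_pXn2r ?nnegrE//; first exact: sum_coord_le.
by rewrite mulr_ge0// enorm_ge0.
Qed.

(** Class C^2 with compact support bounds the second derivatives, hence the remainder pointwise;
    moreover the remainder vanishes unless x or x + h lies in the support. *)
Lemma Cc_infty_remainder (A : set 'rV[R]_n) phi : Cc_infty A phi ->
  [/\ measurable_fun setT phi, measurable_field (gradient phi) &
      exists C, quartic_remainder phi (gradient phi) C].
Proof.
move=> [smooth csupp _].
have [cphi d1] := smooth 2.
have mphi : measurable_fun setT phi by exact: continuous_measurable_rV.
have mgrad : measurable_field (gradient phi).
  move=> i; rewrite (_ : (fun x => _) = partial i phi); last first.
    by apply/funext => x; rewrite mxE.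
  by apply: continuous_measurable_rV; have [_ []] := d1 i.
split => //.
have clsupp : closed (supp phi) by exact: closed_closure.
have z1 i := @nsupp_partial _ phi i clsupp (@nsupp_eq0 phi).
have z2 i j := @nsupp_partial _ (partial i phi) j clsupp (z1 i).
have bnd (ij : 'I_n * 'I_n) : exists M, forall x, `|partial ij.2 (partial ij.1 phi) x| <= M.
  apply: (compact_support_bounded csupp); last exact: z2.
  have [_ [_ d2]] := d1 ij.1.
  by have [_ []] := d2 ij.2.
have [Mf Mb] := choice bnd.
pose M := \sum_ij `|Mf ij|.
have bM i j y : `|partial j (partial i phi) y| <= M.
  apply: (le_trans (Mb (i, j) y)); apply: (le_trans (ler_norm _)).
  by rewrite /M (bigD1 (i, j))//= lerDl sumr_ge0.
have dd1 i y : derivable phi y (delta_mx ord0 i) by have [d _] := d1 i.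
have dd2 i j y : derivable (partial i phi) y (delta_mx ord0 j).
  by have [_ [_ d2]] := d1 i; have [d _] := d2 j.
have mK := measurable_supp phi.
pose V := fine (lebesgue_rV R n (supp phi)).
have VE : V%:E = lebesgue_rV R n (supp phi).
  by rewrite fineK// ge0_fin_numE// supp_measure_fin.
pose B h : R := M * (n%:R * enorm h) ^+ 2.
(* The squared pointwise bound is (M n^2)^2 |h|^4, and the support and its translate have total
   measure 2 V. *)
exists ((M * n%:R ^+ 2) ^+ 2 * 2 * V) => h.
have mI : measurable_fun setT (fun x : 'rV[R]_n => (\1_(supp phi) x : R)%:E).
  by apply/measurable_EFinP; exact: measurable_indic.
apply: (@le_trans _ _ (\int[lebesgue_rV R n]_x ((B h ^+ 2)%:E *
    ((\1_(supp phi) x)%:E + (\1_(supp phi) (x + h)%R)%:E)))%E).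
  apply: ge0_le_integral => //.
  - by move=> x _; rewrite lee_fin sqr_ge0.
  - by apply: measurable_sqr_EFin; exact: measurable_remainder.
  - apply: measurable_funeM; apply: (emeasurable_funD mI).
    exact: (measurableT_comp mI (measurable_translate h)).
  move=> x _; rewrite -EFinD -EFinM lee_fin !indicE.
  have TB := taylor_bound x h dd1 dd2 bM.
  have rB : remainder phi (gradient phi) h x ^+ 2 <= B h ^+ 2.
    by rewrite -(real_normK (num_real _)) ler_pXn2r ?nnegrE// (le_trans _ TB).
  have B0 := sqr_ge0 (B h).
  have [Kx|Kx] := pselect (supp phi x).
    rewrite (mem_set Kx) mulrDr mulr1 (le_trans rB)// lerDl mulr_ge0//.
  have [Kh|Kh] := pselect (supp phi (x + h)).
    by rewrite (mem_set Kh) mulrDr mulr1 (le_trans rB)// lerDr mulr_ge0.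
  rewrite /remainder /incr (nsupp_eq0 Kx) (nsupp_eq0 Kh) subrr sub0r sqrrN.
  rewrite /dotv big1; last first.
    by move=> i _; rewrite [gradient _ _ _ _]mxE z1 ?mul0r.
  by rewrite expr0n mulr_ge0// addr_ge0.
have mIh : measurable_fun setT (fun x : 'rV[R]_n => (\1_(supp phi) (x + h) : R)%:E).
  exact: (measurableT_comp mI (measurable_translate h)).
have mII := emeasurable_funD mI mIh.
have I0 x : (0 <= (\1_(supp phi) x : R)%:E)%E by rewrite lee_fin.
rewrite ge0_integralZl ?lee_fin ?sqr_ge0//; last first.
  by move=> x _; rewrite -EFinD lee_fin addr_ge0.
rewrite (ge0_integralD _ measurableT (fun x _ => I0 x) mI (fun x _ => I0 (x + h)) mIh).
rewrite (integral_translate h mI I0).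
have -> : (\int[lebesgue_rV R n]_x (\1_(supp phi) x)%:E = V%:E)%E.
  by rewrite integral_indic// setIT VE.
rewrite -EFinD -EFinM lee_fin le_eqVlt.
by apply/orP; left; apply/eqP; rewrite /B; ring.
Qed.

End test_functions.

(** * Difference quotients of functions in H^1_0 *)

Section sobolev.
Context (R : realType) (n : nat).
Implicit Types (u : 'rV[R]_n -> R) (h : 'rV[R]_n).

Lemma L2_N2 (f : 'rV[R]_n -> R) : L2 f -> measurable_fun setT f /\ (N2 f < +oo)%E.
Proof.
move=> Lf; split.
  by have := sub_Lfun_mfun Lf; rewrite inE.
have /integrableP[_] := Lfun2_integrable_sqr Lf.
congr (_ < _)%E; apply: eq_integral => x _ /=.
by rewrite ger0_norm// sqr_ge0.
Qed.

Lemma N2_enorm (G : 'rV[R]_n -> 'rV[R]_n) : measurable_field G ->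
  N2 (fun x => enorm (G x)) = (\sum_(i < n) N2 (fun x => G x ord0 i))%E.
Proof.
move=> mG; rewrite /N2 -ge0_integral_sum//.
- apply: eq_integral => x _; rewrite sqr_enorm /dotv -sumEFin.
  by apply: eq_bigr => i _; rewrite expr2.
- by move=> i; exact: measurable_sqr_EFin.
- by move=> i x _; rewrite lee_fin sqr_ge0.
Qed.

Lemma H1_facts u : H1 u -> [/\ measurable_fun setT u, (N2 u < +oo)%E,
  measurable_field (weak_gradient u) & (N2 (fun x => enorm (weak_gradient u x)) < +oo)%E].
Proof.
move=> [/L2_N2[mu Nu] [g wg]].
have wG : is_weak_gradient u (weak_gradient u).
  (* The default value of [xget] is ruled out by the weak gradient g that membership in H^1
     provides. *)
  by rewrite /weak_gradient; case: xgetP => [y _ //|]; move=> /(_ g).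
have mG : measurable_field (weak_gradient u).
  by move=> i; have [/L2_N2[]] := wG i.
split => //; rewrite N2_enorm//; apply/lte_sum_pinfty => i _.
by have [/L2_N2[]] := wG i.
Qed.

Lemma measurable_fieldB (F G : 'rV[R]_n -> 'rV[R]_n) :
  measurable_field F -> measurable_field G -> measurable_field (fun x => F x - G x).
Proof.
move=> mF mG i; rewrite (_ : (fun x => _) = fun x => F x ord0 i - G x ord0 i).
  by apply: measurable_funB.
by apply/funext => x; rewrite !mxE.
Qed.

Lemma H10_approx (A : set 'rV[R]_n) u (eps : R) : H10 A u -> 0 < eps ->
  exists2 phi, Cc_infty A phi & (N2 (fun x => u x - phi x)%R <= eps%:E)%E /\
    (N2 (fun x => enorm (weak_gradient u x - gradient phi x)) <= eps%:E)%E.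
Proof.
move=> [/H1_facts[mu _ mG _] _ /(_ eps) H] /H[phi cphi lt_eps]; exists phi => //.
have [mphi mgphi _] := Cc_infty_remainder cphi.
have m1 : measurable_fun setT (fun x => u x - phi x) by exact: measurable_funB.
have m2 : measurable_fun setT (fun x => enorm (weak_gradient u x - gradient phi x)).
  by apply: measurable_field_enorm; exact: measurable_fieldB.
have m21 := measurable_sqr_EFin m1; have m22 := measurable_sqr_EFin m2.
move: lt_eps; under eq_integral do rewrite EFinD.
rewrite ge0_integralD//; last 2 first.
- by move=> x _; rewrite lee_fin sqr_ge0.
- by move=> x _; rewrite lee_fin sqr_ge0.
rewrite -/(N2 (fun x => u x - phi x)) -/(N2 (fun x => enorm (weak_gradient u x - gradient phi x))).
move=> /ltW lt_eps; split; apply: le_trans lt_eps.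
- by rewrite leeDl// N2_ge0.
- by rewrite leeDr// N2_ge0.
Qed.

Lemma N2_enormBC (F G : 'rV[R]_n -> 'rV[R]_n) :
  N2 (fun x => enorm (F x - G x)) = N2 (fun x => enorm (G x - F x)).
Proof. by rewrite /N2; apply: eq_integral => x _; rewrite -[F x - G x]opprB enormN. Qed.

Lemma N2_enormD (F G H : 'rV[R]_n -> 'rV[R]_n) :
  measurable_field F -> measurable_field G -> measurable_field H ->
  (N2 (fun x => enorm (F x - H x)) <=
   2%:E * N2 (fun x => enorm (F x - G x)) + 2%:E * N2 (fun x => enorm (G x - H x)))%E.
Proof.
move=> mF mG mH.
rewrite !N2_enorm; [|exact: measurable_fieldB..].
rewrite !ge0_sume_distrr; [|by move=> i _; exact: N2_ge0..].
rewrite -big_split/=; apply: lee_sum => i _.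
rewrite (_ : (fun x => (F x - H x) ord0 i) =
    fun x => (F x - G x) ord0 i + (G x - H x) ord0 i).
  by apply: N2D; exact: measurable_fieldB.
by apply/funext => x; rewrite !mxE; ring.
Qed.

Lemma lee_wpM2l_EFin (c : R) x y : (0 <= x)%E -> 0 <= c -> (x <= y)%E -> (c%:E * x <= c%:E * y)%E.
Proof. by move=> x0 c0 xy; apply: lee_pmul => //; rewrite lee_fin. Qed.

(** Decompose u = (u - psi) + (psi - phi) + phi with phi fixed and psi within e |h|^2 of u. The
    increment of u - psi needs no derivative, that of psi - phi is bounded by gradients through
    [N2_incr_dotv], whose bound does not involve the uncontrolled remainder constant of psi, and phi
    has a Taylor remainder. *)
Lemma H10_difference (A : set 'rV[R]_n) u (eta : R) : H10 A u -> 0 < eta ->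
  exists2 delta : R, 0 < delta & forall h, enorm h < delta ->
    (N2 (remainder u (weak_gradient u) h) <= (eta * enorm h ^+ 2)%:E)%E.
Proof.
move=> Hu eta0.
have [/H1_facts[mu _ mG _] _ _] := Hu.
(* The four pieces cost 4e, 8e, eta/8 and e times |h|^2, and two rounds of [N2D] multiply each by 4:
   52 e + eta/2 = eta. *)
pose e := eta / 104.
have e0 : 0 < e by rewrite divr_gt0.
have [phi cphi [u1 u2]] := H10_approx Hu e0.
have [mphi mgphi [C rphi]] := Cc_infty_remainder cphi.
have C0 : 0 <= `|C| by [].
(* Makes |C| |h|^4 at most (eta/8) |h|^2; the added 1 keeps the denominator positive when C = 0. *)
pose delta := Num.min 1 (eta / (8 * (`|C| + 1))).
have d0 : 0 < delta by rewrite lt_min ltr01 divr_gt0// mulr_gt0// ltr_wpDl.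
exists delta => // h hd.
have [->|h0] := eqVneq h 0.
  rewrite (_ : remainder _ _ _ = cst 0); last first.
    apply/funext => x; rewrite /remainder /incr addr0 subrr /dotv big1 ?subrr//.
    by move=> i _; rewrite mxE mulr0.
  by rewrite /N2 /= expr0n/= integral0 lee_fin mulr_ge0 ?sqr_ge0// ltW.
have hp : 0 < enorm h by rewrite enorm_gt0.
have [psi cpsi [v1 v2]] := H10_approx Hu (mulr_gt0 e0 (exprn_gt0 2 hp)).
have [mpsi mgpsi [D rpsi]] := Cc_infty_remainder cpsi.
have h1 : enorm h <= 1 by rewrite ltW// (lt_le_trans hd)// ge_min lexx.
have Ch : `|C| * enorm h ^+ 2 <= eta / 8.
  apply: (@le_trans _ _ (`|C| * enorm h)).
    by apply: ler_wpM2l => //; rewrite expr2 ler_piMl// ltW.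
  have : enorm h <= eta / (8 * (`|C| + 1)).
    by rewrite ltW// (lt_le_trans hd)// ge_min lexx orbT.
  rewrite ler_pdivlMr ?mulr_gt0 ?ltr_wpDl// => hle.
  rewrite ler_pdivlMr//; apply: le_trans hle.
  rewrite mulrCA mulrAC mulrC; nra.
rewrite (_ : remainder u (weak_gradient u) h = fun x =>
   (incr (fun x => u x - psi x) h x + incr (fun x => psi x - phi x) h x) +
   (remainder phi (gradient phi) h x +
    dotv (gradient phi x - weak_gradient u x) h)); last first.
  by apply/funext => x; rewrite /remainder /incr dotvDl dotvNl; ring.
have m1 : measurable_fun setT (fun x => u x - psi x) by exact: measurable_funB.
have m2 : measurable_fun setT (fun x => psi x - phi x) by exact: measurable_funB.
have mi1 := measurable_incr h m1; have mi2 := measurable_incr h m2.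
have mr := measurable_remainder h mphi mgphi.
have mF := measurable_fieldB mgphi mG.
have md := measurable_field_dotv h mF.
apply: (le_trans (N2D (measurable_funD mi1 mi2) (measurable_funD mr md))).
have b1 : (N2 (incr (fun x => u x - psi x)%R h) <= (4 * (e * enorm h ^+ 2))%:E)%E.
  apply: (le_trans (N2_incr_le h m1)); rewrite EFinM; apply: lee_wpM2l_EFin => //; exact: N2_ge0.
have b2 : (N2 (incr (fun x => psi x - phi x)%R h) <= (8 * (e * enorm h ^+ 2))%:E)%E.
  have mFG := measurable_fieldB mgpsi mgphi.
  apply: (le_trans (N2_incr_dotv h m2 mFG (quartic_remainderB mpsi mphi mgpsi mgphi rpsi rphi))).
  apply: (@le_trans _ _ (2%:E * ((enorm h ^+ 2)%:E * (4 * e)%:E))%E); last first.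
    by rewrite -!EFinM lee_fin le_eqVlt; apply/orP; left; apply/eqP; ring.
  apply: lee_wpM2l_EFin => //; first exact: N2_ge0.
  apply: (le_trans (N2_dotv_le h mFG)).
  apply: lee_wpM2l_EFin; rewrite ?N2_ge0 ?sqr_ge0//.
  apply: (le_trans (N2_enormD mgpsi mG mgphi)).
  apply: (@le_trans _ _ (2%:E * e%:E + 2%:E * e%:E)%E); last first.
    by rewrite -!EFinM -EFinD lee_fin; lra.
  apply: leeD; (apply: lee_wpM2l_EFin; [exact: N2_ge0|by []|]); last exact: u2.
  rewrite N2_enormBC; apply: (le_trans v2); rewrite lee_fin.
  by apply: ler_piMr; [exact: ltW|apply: exprn_ile1 => //; exact: ltW].
have b3 : (N2 (remainder phi (gradient phi) h) <= (eta / 8 * enorm h ^+ 2)%:E)%E.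
  apply: (le_trans (rphi h)); rewrite lee_fin.
  apply: (@le_trans _ _ (`|C| * enorm h ^+ 4)).
    by apply: ler_wpM2r; [rewrite exprn_ge0// ltW|exact: ler_norm].
  rewrite (exprD _ 2 2) mulrA; apply: ler_wpM2r => //; exact: sqr_ge0.
have b4 : (N2 (fun x => dotv (gradient phi x - weak_gradient u x) h) <= (e * enorm h ^+ 2)%:E)%E.
  apply: (le_trans (N2_dotv_le h mF)); rewrite [(e * _)%R]mulrC [leRHS]EFinM.
  by apply: lee_wpM2l_EFin; [exact: N2_ge0|exact: sqr_ge0|rewrite N2_enormBC; exact: u2].
apply: (@le_trans _ _ (2%:E * (2%:E * (4 * (e * enorm h ^+ 2))%:E + 2%:E * (8 * (e * enorm h ^+ 2))%:E)
   + 2%:E * (2%:E * (eta / 8 * enorm h ^+ 2)%:E + 2%:E * (e * enorm h ^+ 2)%:E))%E); last first.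
  rewrite -!EFinM -!EFinD lee_fin /e.
  by rewrite le_eqVlt; apply/orP; left; apply/eqP; field.
apply: leeD; (apply: lee_wpM2l_EFin; [exact: N2_ge0|by []|]).
  apply: (le_trans (N2D mi1 mi2)).
  by apply: leeD; (apply: lee_wpM2l_EFin; [exact: N2_ge0|by []|]); [exact: b1|exact: b2].
apply: (le_trans (N2D mr md)).
by apply: leeD; (apply: lee_wpM2l_EFin; [exact: N2_ge0|by []|]); [exact: b3|exact: b4].
Qed.

End sobolev.

(** * Convergence of Theta_s to Theta_0 *)

Section monotone_flux.
Context (R : realType) (d : nat) (d0 : (0 < d)%N).
Implicit Types (s a b : R).

Definition flux s a b : R := (Gs d s a - Gs d s b) * (a - b).

Lemma flux_ge0 s a b : 0 <= s -> 0 <= flux s a b.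
Proof. by move=> s0; have /andP[] := Gs_mono d a b s0. Qed.

Lemma flux_le s a b : 0 <= s -> flux s a b <= (a - b) ^+ 2.
Proof. by move=> s0; have /andP[] := Gs_mono d a b s0. Qed.

(** From oddness of G: it makes the double integrand symmetric in x and y, and absorbs the sign
    between [diffq] at (x, x + h) and the increment over h. *)
Lemma fluxNN s a b : flux s (- a) (- b) = flux s a b.
Proof. by rewrite /flux !GsN -!opprD mulrNN. Qed.

Lemma sqr_diff_le a b a0 b0 :
  (a - b) ^+ 2 <= 2 * (a0 - b0) ^+ 2 + 4 * ((a - a0) ^+ 2 + (b - b0) ^+ 2).
Proof.
have h1 := sqr_ge0 ((a0 - b0) - ((a - a0) - (b - b0))).
have h2 := sqr_ge0 ((a - a0) + (b - b0)).
have : 2 * (a0 - b0) ^+ 2 + 4 * ((a - a0) ^+ 2 + (b - b0) ^+ 2) - (a - b) ^+ 2 =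
  ((a0 - b0) - ((a - a0) - (b - b0))) ^+ 2 + 2 * ((a - a0) + (b - b0)) ^+ 2 by ring.
lra.
Qed.

(** First replace s by 1/2 at the cost eta (a - b)^2, then move the arguments using that G is
    1-Lipschitz and Young's inequality with weight eta. By [sqr_diff_le] the coefficients add up to
    2 + 2 + 1 = 5 and 4 + 4 = 8. *)
Lemma flux_close s a b a0 b0 eta : 0 <= s -> s <= 1 / 2 -> 0 < eta -> eta <= 1 ->
  (1 - 2 * s) / 2 <= eta ->
  `|flux s a b - flux (1 / 2) a0 b0| <=
  5 * eta * (a0 - b0) ^+ 2 + (8 + eta^-1) * ((a - a0) ^+ 2 + (b - b0) ^+ 2).
Proof.
move=> s0 s1 eta0 eta1 es.
have h0 : 0 <= 1 / 2 :> R by rewrite divr_ge0.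
set X := (a - a0) ^+ 2 + (b - b0) ^+ 2; set B := (a0 - b0) ^+ 2.
have A2 : (a - b) ^+ 2 <= 2 * B + 4 * X := sqr_diff_le a b a0 b0.
have X0 : 0 <= X by rewrite addr_ge0 ?sqr_ge0.
have B0 : 0 <= B by rewrite sqr_ge0.
have N1 : `|flux s a b - flux (1 / 2) a b| <= eta * (2 * B + 4 * X).
  apply: (le_trans (Gs_near a b d0 s0 s1)).
  by apply: ler_pM => //; [lra|exact: sqr_ge0].
have N2 : `|flux (1 / 2) a b - flux (1 / 2) a0 b0| <=
    (`|a - a0| + `|b - b0|) * (`|a - b| + `|a0 - b0|).
  rewrite (_ : _ - _ = (Gs d (1 / 2) a - Gs d (1 / 2) b) * ((a - a0) - (b - b0)) +
     ((Gs d (1 / 2) a - Gs d (1 / 2) a0) - (Gs d (1 / 2) b - Gs d (1 / 2) b0)) * (a0 - b0)); last first.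
    rewrite /flux; move: (Gs d _ a) (Gs d _ b) (Gs d _ a0) (Gs d _ b0) => ? ? ? ?.
    by ring.
  apply: (le_trans (ler_normD _ _)); rewrite [leRHS]mulrDr; apply: lerD.
    rewrite normrM mulrC; apply: ler_pM => //; first exact: ler_normB.
    exact: Gs_lip.
  rewrite normrM; apply: ler_wpM2r => //; apply: (le_trans (ler_normB _ _)).
  by apply: lerD; exact: Gs_lip.
have N3 : (`|a - a0| + `|b - b0|) * (`|a - b| + `|a0 - b0|) <=
    eta^-1 * X + eta * ((a - b) ^+ 2 + B).
  rewrite /X /B -(real_normK (num_real (a - a0))) -(real_normK (num_real (b - b0))).
  rewrite -(real_normK (num_real (a - b))) -(real_normK (num_real (a0 - b0))).
  set p := `|a - a0|; set q := `|b - b0|; set A := `|a - b|; set D := `|a0 - b0|.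
  rewrite -subr_ge0.
  have -> : eta^-1 * (p ^+ 2 + q ^+ 2) + eta * (A ^+ 2 + D ^+ 2) - (p + q) * (A + D) =
    eta^-1 / 2 * ((p - q) ^+ 2 + (p + q - eta * (A + D)) ^+ 2) + eta / 2 * (A - D) ^+ 2.
    by field; rewrite gt_eqF.
  by rewrite addr_ge0// mulr_ge0// ?addr_ge0 ?sqr_ge0// divr_ge0// ?invr_ge0 ltW.
have -> : flux s a b - flux (1 / 2) a0 b0 =
  (flux s a b - flux (1 / 2) a b) + (flux (1 / 2) a b - flux (1 / 2) a0 b0).
  by rewrite addrA subrK.
apply: (le_trans (ler_normD _ _)).
have N4 : eta * (a - b) ^+ 2 <= eta * (2 * B + 4 * X).
  by apply: ler_wpM2l => //; exact: ltW.
have N5 : eta * X <= X by rewrite ler_piMl.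
have : eta * (2 * B + 4 * X) + (eta^-1 * X + eta * ((a - b) ^+ 2 + B)) <=
   5 * eta * B + (8 + eta^-1) * X.
  have -> : 5 * eta * B + (8 + eta^-1) * X = 5 * (eta * B) + 8 * X + eta^-1 * X by ring.
  have E1 : eta * (2 * B + 4 * X) = 2 * (eta * B) + 4 * (eta * X) by ring.
  have E2 : eta * ((a - b) ^+ 2 + B) = eta * (a - b) ^+ 2 + eta * B by ring.
  by move: N4; rewrite E1 E2; lra.
lra.
Qed.

Lemma measurable_flux s dd (T : measurableType dd) (f g : T -> R) :
  measurable_fun setT f -> measurable_fun setT g ->
  measurable_fun setT (fun x => flux s (f x) (g x)).
Proof.
move=> mf mg; apply: measurable_funM; last exact: measurable_funB.
by apply: measurable_funB; apply: (measurableT_comp (measurable_Gs _ _)).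
Qed.

End monotone_flux.

(** * Pairs leaving the domain *)

Section boundary_layer.
Context (R : realType) (n : nat) (Omega : set 'rV[R]_n) (oO : open Omega).

Lemma ball_enorm (x h : 'rV[R]_n) (e : R) : enorm h < e -> ball x e (x + h).
Proof.
move=> he; split; first exact: le_lt_trans (enorm_ge0 _) he.
move=> i j; rewrite (ord1 i) mxE /ball/= opprD addNKr normrN.
exact: le_lt_trans (coord_le_enorm h j) he.
Qed.

(** A point x of Omega with x + h outside Omega lies in the 1/(k+1)-neighbourhood [U k] of the
    complement once |h| < 1/(k+1), the sup norm being at most the Euclidean one. Since Omega is
    open, each of its points leaves [U k] for large k, and dominated convergence applies. *)
Lemma boundary_layer (Y : 'rV[R]_n -> R) (tau : R) :
  measurable_fun setT Y -> (forall x, 0 <= Y x) ->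
  (\int[lebesgue_rV R n]_x (Y x)%:E < +oo)%E -> 0 < tau ->
  exists2 delta : R, 0 < delta & forall h, enorm h < delta ->
    (\int[lebesgue_rV R n]_x (Y x * (\1_Omega x * (1 - \1_Omega (x + h))))%:E <= tau%:E)%E.
Proof.
move=> mY Y0 Yoo tau0.
have mO : measurable Omega by exact: open_measurable_rV.
pose U k : set 'rV[R]_n := \bigcup_(y in ~` Omega) ball y (k.+1%:R^-1).
have mU k : measurable (U k).
  by apply: open_measurable_rV; apply: bigcup_open => y _; exact: ball_open.
pose E k := Omega `&` U k.
have mE k : measurable (E k) by exact: measurableI.
pose f k x := (Y x * \1_(E k) x)%:E.
have iY : (lebesgue_rV R n).-integrable setT (EFin \o Y).
  apply/integrableP; split; first exact/measurable_EFinP.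
  by under eq_integral do rewrite gee0_abs ?lee_fin//.
have mf k : measurable_fun setT (f k).
  by apply/measurable_EFinP; apply: measurable_funM => //; exact: measurable_indic.
have fcvg x : f ^~ x @ \oo --> (0 : \bar R).
  apply: cvg_near_cst.
  have [Ox|nOx] := pselect (Omega x); last first.
    near=> k; rewrite /f indicE memNset ?mulr0// => -[]//.
  have /nbhs_ballP[e /= e0 xeO] : nbhs x Omega by apply: open_nbhs_nbhs.
  near=> k; rewrite /f indicE memNset ?mulr0// => -[_ [y nOy] /ball_sym yk].
  apply: nOy; apply: xeO; apply: le_ball yk; apply/ltW.
  near: k; exact: (near_infty_natSinv_lt (PosNum e0)).
have fle k x : (`|f k x| <= (EFin \o Y) x)%E.
  rewrite /f/= lee_fin normrM !ger0_norm// ler_piMr//.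
have cv0 : (\int[lebesgue_rV R n]_x f k x @[k --> \oo] --> 0)%E.
  have [_ _] := @dominated_convergence _ _ _ (lebesgue_rV R n) setT measurableT f
    (cst 0%E) (EFin \o Y) mf (measurable_cst _)
    (aeW _ (fun x _ => fcvg x)) iY (aeW _ (fun x k _ => fle k x)).
  by rewrite integral0.
have [k fk] : exists k, (\int[lebesgue_rV R n]_x f k x <= tau%:E)%E.
  have /fine_cvgP[fin /cvgrPdist_le/(_ _ tau0) small] := cv0.
  have [k _ /(_ k (leqnn k))[fink smallk]] := filterI fin small.
  exists k; rewrite -(fineK fink) lee_fin; apply: le_trans smallk.
  by rewrite sub0r normrN ler_norm.
exists (k.+1%:R^-1); first by rewrite invr_gt0.
move=> h hk; apply: le_trans fk; apply: ge0_le_integral => //.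
- move=> x _; rewrite lee_fin mulr_ge0// mulr_ge0// subr_ge0 indicE.
- apply/measurable_EFinP; apply: measurable_funM => //; apply: measurable_funM.
    exact: measurable_indic.
  apply: measurable_funB => //; apply: measurable_comp_translate.
  exact: measurable_indic.
- move=> x _; rewrite /f lee_fin; apply: ler_wpM2l => //.
  rewrite !indicE; have [Ox|] := boolP (x \in Omega); last by rewrite mul0r.
  have [Oh|nOh] := boolP (x + h \in Omega); first by rewrite subrr mulr0.
  rewrite subr0 mulr1 mem_set//; split; first exact: set_mem.
  exists (x + h); first by move: nOh; rewrite notin_setE.
  by apply: ball_sym; exact: ball_enorm.
Unshelve. all: by end_near. Qed.

End boundary_layer.

Lemma le_integral_close d (T : measurableType d) (R : realType)
    (mu : {measure set T -> \bar R}) (f g r : T -> R) (rho : R) :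
  measurable_fun setT f -> measurable_fun setT g -> measurable_fun setT r ->
  (forall x, 0 <= f x) -> (forall x, 0 <= g x) ->
  (forall x, `|f x - g x| <= r x) -> (\int[mu]_x (r x)%:E <= rho%:E)%E ->
  (\int[mu]_x (f x)%:E <= \int[mu]_x (g x)%:E + rho%:E)%E.
Proof.
move=> /measurable_EFinP mf /measurable_EFinP mg /measurable_EFinP mr f0 g0 fgr ir.
have r0 x : 0 <= r x by apply: le_trans (fgr x).
apply: (@le_trans _ _ (\int[mu]_x ((g x)%:E + (r x)%:E))%E).
  apply: ge0_le_integral => //.
  - by move=> x _; rewrite lee_fin.
  - exact: emeasurable_funD.
  - move=> x _; rewrite -EFinD lee_fin.
    by have := fgr x; rewrite ler_distl => /andP[_].
rewrite ge0_integralD//; first exact: leeD.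
- by move=> x _; rewrite lee_fin.
- by move=> x _; rewrite lee_fin.
Qed.

(** * Comparison of Theta_s with Theta_0 for small h, and its decay for large h *)

Section closeness.
Context (R : realType) (n : nat) (n0 : (0 < n)%N).
Variables (Omega : set 'rV[R]_n) (oO : open Omega).
Variables (u v : 'rV[R]_n -> R) (a b : 'rV[R]_n -> 'rV[R]_n).
Hypotheses (mu : measurable_fun setT u) (mv : measurable_fun setT v).
Hypotheses (ma : measurable_field a) (mb : measurable_field b).
Hypotheses (Na : (N2 (fun x => enorm (a x)) < +oo)%E) (Nb : (N2 (fun x => enorm (b x)) < +oo)%E).
Hypothesis Du : forall eta : R, 0 < eta -> exists2 delta : R, 0 < delta &
  forall h, enorm h < delta -> (N2 (remainder u a h) <= (eta * enorm h ^+ 2)%:E)%E.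
Hypothesis Dv : forall eta : R, 0 < eta -> exists2 delta : R, 0 < delta &
  forall h, enorm h < delta -> (N2 (remainder v b h) <= (eta * enorm h ^+ 2)%:E)%E.

(** The weight is 1 when x and x + h are both in Omega and 2 when only x is: a pair with only its
    second point in Omega is counted through its mirror image. *)
Definition theta_density (s : R) (h x : 'rV[R]_n) : R :=
  \1_Omega x * (1 + (1 - \1_Omega (x + h))) *
  flux n s (incr u h x / enorm h) (incr v h x / enorm h).

Definition theta0_density (h x : 'rV[R]_n) : R :=
  \1_Omega x * flux n (1 / 2) (dotv (a x) (unitv h)) (dotv (b x) (unitv h)).

Definition Theta s h : \bar R := (\int[lebesgue_rV R n]_x (theta_density s h x)%:E)%E.
Definition Theta0 h : \bar R := (\int[lebesgue_rV R n]_x (theta0_density h x)%:E)%E.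

Let mO : measurable Omega. Proof. exact: open_measurable_rV. Qed.

Lemma measurable_theta_density s h : measurable_fun setT (theta_density s h).
Proof.
have mI : measurable_fun setT (\1_Omega : 'rV[R]_n -> R) by exact: measurable_indic.
apply: measurable_funM.
  apply: measurable_funM => //; apply: measurable_funD => //.
  by apply: measurable_funB => //; exact: measurable_comp_translate.
by apply: measurable_flux; apply: measurable_funM => //; exact: measurable_incr.
Qed.

Lemma measurable_theta0_density h : measurable_fun setT (theta0_density h).
Proof.
apply: measurable_funM; first exact: measurable_indic.
by apply: measurable_flux; exact: measurable_field_dotv.
Qed.

Lemma indic01 (A : set 'rV[R]_n) x : 0 <= (\1_A x : R) <= 1.
Proof. by rewrite indicE; case: (x \in A); rewrite ?lexx ?ler01. Qed.

Lemma theta_density_ge0 s h x : 0 <= s -> 0 <= theta_density s h x.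
Proof.
move=> s0; rewrite mulr_ge0 ?flux_ge0// mulr_ge0//.
Qed.

Lemma theta0_density_ge0 h x : 0 <= theta0_density h x.
Proof. by rewrite mulr_ge0// flux_ge0// divr_ge0. Qed.

Lemma N2_enormB_fin : (N2 (fun x => enorm (a x - b x)) < +oo)%E.
Proof.
have mz : measurable_field (fun _ : 'rV[R]_n => (0 : 'rV[R]_n)).
  by move=> i; exact: measurable_cst.
apply: (le_lt_trans (N2_enormD ma mz mb)).
rewrite (_ : (fun x => enorm (a x - 0)) = fun x => enorm (a x)); last first.
  by apply/funext => x; rewrite subr0.
rewrite (_ : (fun x => enorm (0 - b x)) = fun x => enorm (b x)); last first.
  by apply/funext => x; rewrite sub0r enormN.
by apply: lte_add_pinfty; apply: lte_mul_pinfty => //; rewrite lee_fin.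
Qed.

(** When x + h is outside Omega the flux is counted twice, and the second copy is at most 2 Y + 4 X,
    where X is the squared error of the quotients and Y = |a - b|^2. This turns the 8 of
    [flux_close] into 12 and creates the boundary term. *)
Lemma theta_density_close (s eta : R) h x :
  0 <= s -> s <= 1 / 2 -> 0 < eta -> eta <= 1 -> (1 - 2 * s) / 2 <= eta -> h != 0 ->
  `|theta_density s h x - theta0_density h x| <=
  5 * eta * enorm (a x - b x) ^+ 2 +
  (12 + eta^-1) * ((enorm h)^-1 ^+ 2 * (remainder u a h x ^+ 2 + remainder v b h x ^+ 2)) +
  2 * (enorm (a x - b x) ^+ 2 * (\1_Omega x * (1 - \1_Omega (x + h)))).
Proof.
move=> s0 s1 eta0 eta1 es h0.
have hN0 : enorm h != 0 by rewrite enorm_eq0.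
rewrite /theta_density /theta0_density.
set al := incr u h x / _; set be := incr v h x / _.
set al0 := dotv (a x) _; set be0 := dotv (b x) _.
set Y := enorm (a x - b x) ^+ 2.
have Y0 : 0 <= Y by exact: sqr_ge0.
have -> : (enorm h)^-1 ^+ 2 * (remainder u a h x ^+ 2 + remainder v b h x ^+ 2) =
    (al - al0) ^+ 2 + (be - be0) ^+ 2.
  by rewrite /al /be /al0 /be0 /remainder /unitv !dotvZr; field.
set X := _ ^+ 2 + _ ^+ 2.
have X0 : 0 <= X by rewrite addr_ge0 ?sqr_ge0.
have BY : (al0 - be0) ^+ 2 <= Y.
  rewrite /al0 /be0 -dotvNl -dotvDl -(real_normK (num_real _)).
  by rewrite ler_pXn2r ?nnegrE ?enorm_ge0// dotv_unitv_le.
have C1 := flux_close n0 al be al0 be0 s0 s1 eta0 eta1 es.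
have C2 : flux n s al be <= 2 * Y + 4 * X.
  apply: (le_trans (flux_le _ _ _ s0)); apply: (le_trans (sqr_diff_le al be al0 be0)).
  by rewrite -/X; lra.
have F0 := flux_ge0 n al be s0.
have iE : 0 <= eta^-1 * X by rewrite mulr_ge0// invr_ge0 ltW.
have eB : eta * (al0 - be0) ^+ 2 <= eta * Y by rewrite ler_wpM2l// ltW.
have eY : 0 <= eta * Y by rewrite mulr_ge0// ltW.
have C3 : `|flux n s al be - flux n (1 / 2) al0 be0| <= 5 * eta * Y + (8 + eta^-1) * X.
  apply: (le_trans C1); rewrite -/X.
  have -> : 5 * eta * (al0 - be0) ^+ 2 = 5 * (eta * (al0 - be0) ^+ 2) by ring.
  have -> : 5 * eta * Y = 5 * (eta * Y) by ring.
  lra.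
have -> : (12 + eta^-1) * X = (8 + eta^-1) * X + 4 * X by ring.
have E : 0 <= 5 * eta * Y by rewrite -mulrA mulr_ge0.
have E8 : 0 <= (8 + eta^-1) * X by rewrite mulrDl addr_ge0// mulr_ge0.
move: F0 C2 C3; set F1 := flux n s al be; set F2 := flux n (1 / 2) al0 be0 => F10 C2 C3.
rewrite !indicE; have [xO|xO] := boolP (x \in Omega); last first.
  by rewrite !mul0r subrr normr0 mulr0; lra.
have [hO|hO] := boolP (x + h \in Omega).
  by rewrite subrr addr0 !mul1r !mulr0 addr0; lra.
rewrite subr0 !mul1r !mulr1.
rewrite (_ : (1 + 1) * _ - _ = (F1 - F2) + F1); last by ring.
apply: (le_trans (ler_normD _ _)); rewrite [`|F1|]ger0_norm//; lra.
Qed.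

(** Two one-sided bounds, so that no extended reals are subtracted. [eta] is fixed by the L^2 norm
    of a - b before the range of h, since remainders are weighted by [eta^-1]. The shares of rho are
    1/3 for the eta term, 1/6 for each remainder and 1/3 for the boundary layer. *)
Lemma Theta_close (rho : R) : 0 < rho -> exists2 delta : R, 0 < delta <= 1 &
  exists2 eta : R, 0 < eta & forall s h, 0 <= s -> s <= 1 / 2 -> (1 - 2 * s) / 2 <= eta ->
    0 < enorm h <= delta ->
    (Theta s h <= Theta0 h + rho%:E)%E /\ (Theta0 h <= Theta s h + rho%:E)%E.
Proof.
move=> rho0.
have mE : measurable_fun setT (fun x => enorm (a x - b x)).
  by apply: measurable_field_enorm; exact: measurable_fieldB.
pose K := fine (N2 (fun x => enorm (a x - b x))).
have KE : N2 (fun x => enorm (a x - b x)) = K%:E.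
  by rewrite fineK// ge0_fin_numE ?N2_ge0// N2_enormB_fin.
have K0 : 0 <= K by rewrite -lee_fin -KE N2_ge0.
pose eta := Num.min 1 (rho / (15 * (K + 1))).
have eta0 : 0 < eta by rewrite lt_min ltr01 divr_gt0// mulr_gt0// ltr_wpDl.
have eta1 : eta <= 1 by rewrite ge_min lexx.
have etaK : 5 * eta * K <= rho / 3.
  have : eta <= rho / (15 * (K + 1)) by rewrite ge_min lexx orbT.
  by rewrite ler_pdivlMr ?mulr_gt0 ?ltr_wpDl//; nra.
have ie0 : 0 < eta^-1 by rewrite invr_gt0.
(* Chosen so that (12 + eta^-1) |h|^-2 times e2 |h|^2 is rho/6. *)
pose e2 := rho / (6 * (12 + eta^-1)).
have p12 : 0 < 12 + eta^-1 by rewrite addr_gt0.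
have e20 : 0 < e2 by rewrite divr_gt0// mulr_gt0.
have [d1 d10 H1] := Du e20; have [d2 d20 H2] := Dv e20.
have mY : measurable_fun setT (fun x => enorm (a x - b x) ^+ 2) by exact: measurable_funX.
have tau0 : 0 < rho / 6 by rewrite divr_gt0.
have [d3 d30 H3] := boundary_layer oO mY (fun x => sqr_ge0 _) N2_enormB_fin tau0.
pose d0 := Num.min (Num.min d1 d2) (Num.min d3 1).
have d0p : 0 < d0 by rewrite !lt_min d10 d20 d30 ltr01.
(* Halving turns the strict bound |h| < d0 into the closed range |h| <= delta used for the near
   part. *)
exists (d0 / 2).
  rewrite divr_gt0//=; have : d0 <= 1 by rewrite !ge_min lexx !orbT.
  by move: d0p; lra.
exists eta => // s h s0 s1 es /andP[h0 hd].
have hd0 : enorm h < d0 by move: d0p; lra.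
have hN0 : h != 0 by rewrite -enorm_gt0.
have hd1 : enorm h < d1 by rewrite (lt_le_trans hd0)// !ge_min lexx.
have hd2 : enorm h < d2 by rewrite (lt_le_trans hd0)// !ge_min lexx !orbT.
have hd3 : enorm h < d3 by rewrite (lt_le_trans hd0)// !ge_min lexx !orbT.
pose r1 x := 5 * eta * enorm (a x - b x) ^+ 2.
pose r2 x := (12 + eta^-1) * (enorm h)^-1 ^+ 2 * remainder u a h x ^+ 2.
pose r3 x := (12 + eta^-1) * (enorm h)^-1 ^+ 2 * remainder v b h x ^+ 2.
pose r4 x := 2 * (enorm (a x - b x) ^+ 2 * (\1_Omega x * (1 - \1_Omega (x + h)))).
pose r x := r1 x + r2 x + (r3 x + r4 x).
have mI : measurable_fun setT (\1_Omega : 'rV[R]_n -> R) by exact: measurable_indic.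
have mb4 : measurable_fun setT (fun x => enorm (a x - b x) ^+ 2 * (\1_Omega x * (1 - \1_Omega (x + h)))).
  apply: measurable_funM => //; apply: measurable_funM => //.
  by apply: measurable_funB => //; exact: measurable_comp_translate.
have b40 x : 0 <= enorm (a x - b x) ^+ 2 * (\1_Omega x * (1 - \1_Omega (x + h))).
  rewrite mulr_ge0 ?sqr_ge0// mulr_ge0//.
have mru := measurable_remainder h mu ma; have mrv := measurable_remainder h mv mb.
have m1 : measurable_fun setT r1 by exact: measurable_funM.
have m2 : measurable_fun setT r2 by apply: measurable_funM => //; exact: measurable_funX.
have m3 : measurable_fun setT r3 by apply: measurable_funM => //; exact: measurable_funX.
have m4 : measurable_fun setT r4 by exact: measurable_funM.
have q0 : 0 <= (12 + eta^-1) * (enorm h)^-1 ^+ 2 by rewrite mulr_ge0 ?sqr_ge0// ltW.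
have r10 x : 0 <= r1 x by rewrite mulr_ge0 ?sqr_ge0// mulr_ge0// ltW.
have r20 x : 0 <= r2 x by rewrite mulr_ge0 ?sqr_ge0.
have r30 x : 0 <= r3 x by rewrite mulr_ge0 ?sqr_ge0.
have r40 x : 0 <= r4 x by rewrite mulr_ge0.
have close x : `|theta_density s h x - theta0_density h x| <= r x.
  apply: (le_trans (theta_density_close x s0 s1 eta0 eta1 es hN0)).
  by rewrite le_eqVlt; apply/orP; left; apply/eqP; rewrite /r /r1 /r2 /r3 /r4; ring.
have mr : measurable_fun setT r by apply: measurable_funD; exact: measurable_funD.
have iZ (c : R) (f : 'rV[R]_n -> R) (z : R) : 0 <= c -> measurable_fun setT f -> (forall x, 0 <= f x) ->
    (\int[lebesgue_rV R n]_x (f x)%:E <= z%:E)%E ->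
    (\int[lebesgue_rV R n]_x (c * f x)%:E <= (c * z)%:E)%E.
  move=> c0 /measurable_EFinP mf f0 fz.
  under eq_integral do rewrite EFinM.
  rewrite ge0_integralZl//; last by move=> x _; rewrite lee_fin.
  rewrite EFinM; apply: lee_wpM2l_EFin => //.
  by apply: integral_ge0 => x _; rewrite lee_fin.
have i1 : (\int[lebesgue_rV R n]_x (r1 x)%:E <= (rho / 3)%:E)%E.
  apply: (@le_trans _ _ (5 * eta * K)%:E); last by rewrite lee_fin.
  apply: iZ => //; first by rewrite mulr_ge0// ltW.
    by move=> x; exact: sqr_ge0.
  by rewrite -KE.
have i23 (w : 'rV[R]_n -> R) g : measurable_fun setT (remainder w g h) ->
    (N2 (remainder w g h) <= (e2 * enorm h ^+ 2)%:E)%E ->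
    (\int[lebesgue_rV R n]_x ((12 + eta^-1) * (enorm h)^-1 ^+ 2 * remainder w g h x ^+ 2)%:E <= (rho / 6)%:E)%E.
  move=> mw Nw; apply: (@le_trans _ _ ((12 + eta^-1) * (enorm h)^-1 ^+ 2 * (e2 * enorm h ^+ 2))%:E).
    by apply: iZ => //; [exact: measurable_funX|move=> x; exact: sqr_ge0].
  have gen q : 0 < q -> q * (enorm h)^-1 ^+ 2 * (rho / (6 * q) * enorm h ^+ 2) = rho / 6.
    by move=> q1; field; rewrite !gt_eqF.
  by rewrite lee_fin /e2 gen.
have i2 := i23 u a mru (H1 h hd1).
have i3 := i23 v b mrv (H2 h hd2).
have i4 : (\int[lebesgue_rV R n]_x (r4 x)%:E <= (2 * (rho / 6))%:E)%E.
  by apply: iZ => //; exact: H3.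
have ir : (\int[lebesgue_rV R n]_x (r x)%:E <= rho%:E)%E.
  have iD (f g : 'rV[R]_n -> R) (y z : R) : measurable_fun setT f -> measurable_fun setT g ->
      (forall x, 0 <= f x) -> (forall x, 0 <= g x) ->
      (\int[lebesgue_rV R n]_x (f x)%:E <= y%:E)%E ->
      (\int[lebesgue_rV R n]_x (g x)%:E <= z%:E)%E ->
      (\int[lebesgue_rV R n]_x (f x + g x)%:E <= (y + z)%:E)%E.
    move=> /measurable_EFinP mf /measurable_EFinP mg f0 g0 fy gz.
    under eq_integral do rewrite EFinD.
    rewrite ge0_integralD//; [by rewrite EFinD; exact: leeD|by move=> x _; rewrite lee_fin..].
  have -> : rho = rho / 3 + rho / 6 + (rho / 6 + 2 * (rho / 6)) by field.
  apply: (iD (fun x => r1 x + r2 x) (fun x => r3 x + r4 x)).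
  - exact: measurable_funD.
  - exact: measurable_funD.
  - by move=> x; rewrite addr_ge0.
  - by move=> x; rewrite addr_ge0.
  - exact: (iD r1 r2).
  - exact: (iD r3 r4).
split; apply: (le_integral_close (r := r)) => //.
- exact: measurable_theta_density.
- exact: measurable_theta0_density.
- by move=> x; exact: theta_density_ge0.
- exact: theta0_density_ge0.
- exact: measurable_theta0_density.
- exact: measurable_theta_density.
- exact: theta0_density_ge0.
- by move=> x; exact: theta_density_ge0.
- by move=> x; rewrite distrC.
Qed.

(** The flux is at most the squared difference quotient of u - v. The constant 8 is the maximal
    weight 2 times the 4 of [N2_incr_le]; the decay |h|^-2 makes the kernel integrable at
    infinity. *)
Lemma Theta_far s h : 0 <= s -> h != 0 ->
  (Theta s h <= 8%:E * (((enorm h)^-1 ^+ 2)%:E * N2 (fun x => u x - v x)%R))%E.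
Proof.
move=> s0 h0.
have mw : measurable_fun setT (fun x => u x - v x) by exact: measurable_funB.
have mi := measurable_incr h mw.
apply: (@le_trans _ _ (2%:E * (((enorm h)^-1 ^+ 2)%:E * N2 (incr (fun x => u x - v x)%R h)))%E); last first.
  rewrite (_ : 8%:E = 2%:E * 4%:E)%E; last by rewrite -EFinM; congr (_%:E); ring.
  rewrite -muleA; apply: lee_wpM2l_EFin => //; first by rewrite mule_ge0 ?N2_ge0// lee_fin sqr_ge0.
  by rewrite muleCA; apply: lee_wpM2l_EFin; rewrite ?N2_ge0 ?sqr_ge0//; exact: N2_incr_le.
rewrite -N2Z// /N2 -ge0_integralZl//; last 2 first.
- by apply: measurable_sqr_EFin; exact: measurable_funM.
- by move=> x _; rewrite lee_fin sqr_ge0.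
apply: ge0_le_integral => //.
- by move=> x _; rewrite lee_fin theta_density_ge0.
- by apply/measurable_EFinP; exact: measurable_theta_density.
- by apply: measurable_funeM; apply: measurable_sqr_EFin; exact: measurable_funM.
move=> x _; rewrite -EFinM lee_fin /theta_density.
have /andP[i0 i1] := indic01 Omega x; have /andP[j0 j1] := indic01 Omega (x + h).
apply: ler_pM.
- by rewrite mulr_ge0//; lra.
- exact: flux_ge0.
- rewrite -[leRHS]mul1r; apply: ler_pM => //; lra.
apply: (le_trans (flux_le _ _ _ s0)); rewrite le_eqVlt; apply/orP; left; apply/eqP.
by rewrite /incr; ring.
Qed.

End closeness.

(** * The nonlocal energy *)

Lemma measurable_add_rV (R : realType) n :
  measurable_fun setT (fun p : 'rV[R]_n * 'rV[R]_n => p.2 + p.1).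
Proof.
apply: measurable_fun_rV => i.
rewrite (_ : _ \o _ = fun p => (coor i \o snd) p + (coor i \o fst) p); last first.
  by apply/funext => p /=; rewrite /coor mxE.
by apply: measurable_funD; apply: measurableT_comp => //; exact: measurable_coor.
Qed.

Section symmetric_double_integral.
Context (R : realType) (n : nat) (Omega : set 'rV[R]_n) (mO : measurable Omega).
Local Notation mu := (lebesgue_rV R n).

(** Split the domain into x in Omega, and x outside with y in Omega. Symmetry of W exchanges x and y
    in the second piece, so that x is in Omega throughout; then y = x + h by translation and
    Tonelli. *)
Lemma integral_Qset (W : 'rV[R]_n * 'rV[R]_n -> R) :
  measurable_fun setT W -> (forall p, 0 <= W p) -> (forall x y, W (x, y) = W (y, x)) ->
  (\int[mu \x mu]_(p in Qset Omega) (W p)%:E =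
   \int[mu]_h \int[mu]_x
     (\1_Omega x * (1 + (1 - \1_Omega (x + h))) * W (x, x + h))%R%:E)%E.
Proof.
move=> mW W0 Wsym.
pose i1 (p : 'rV[R]_n * 'rV[R]_n) : R := \1_Omega p.1.
pose i2 (p : 'rV[R]_n * 'rV[R]_n) : R := \1_Omega p.2.
have mI : measurable_fun setT (\1_Omega : 'rV[R]_n -> R) by exact: measurable_indic.
have m1 : measurable_fun setT i1 by exact: (measurableT_comp mI).
have m2 : measurable_fun setT i2 by exact: (measurableT_comp mI).
have i101 p : 0 <= i1 p <= 1 by exact: indic01.
have i201 p : 0 <= i2 p <= 1 by exact: indic01.
pose fa p := (W p * i1 p)%:E.
pose fb p := (W p * ((1 - i1 p) * i2 p))%:E.
pose fb' p := (W p * ((1 - i2 p) * i1 p))%:E.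
have fa0 p : (0 <= fa p)%E by rewrite lee_fin mulr_ge0//; have /andP[] := i101 p.
have fb0 p : (0 <= fb p)%E.
  by rewrite lee_fin mulr_ge0// mulr_ge0// subr_ge0; have /andP[] := i101 p.
have fb'0 p : (0 <= fb' p)%E.
  by rewrite lee_fin mulr_ge0// mulr_ge0// subr_ge0; have /andP[] := i201 p.
have mfa : measurable_fun setT fa by apply/measurable_EFinP; exact: measurable_funM.
have mfb : measurable_fun setT fb.
  apply/measurable_EFinP; apply: measurable_funM => //; apply: measurable_funM => //.
  exact: measurable_funB.
have mfb' : measurable_fun setT fb'.
  apply/measurable_EFinP; apply: measurable_funM => //; apply: measurable_funM => //.
  exact: measurable_funB.
transitivity (\int[mu \x mu]_p (fa p + fb p))%E.
  rewrite integral_mkcond; apply: eq_integral => -[x y] _.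
  rewrite patchE /fa /fb /i1 /i2/= !indicE -EFinD.
  case: ifPn => [/set_mem|].
    move=> /= /not_andP[/contrapT Ox|/contrapT Oy].
      by rewrite (mem_set Ox) subrr mul0r mulr0 addr0 mulr1.
    rewrite (mem_set Oy) mulr1; case: (x \in Omega); last by rewrite mulr0 add0r subr0 mulr1.
    by rewrite subrr mulr0 addr0 mulr1.
  rewrite notin_setE/= => /contrapT[nx ny].
  by rewrite (memNset nx) (memNset ny) !mulr0 addr0.
rewrite ge0_integralD//.
have -> : (\int[mu \x mu]_p fb p = \int[mu \x mu]_p fb' p)%E.
  rewrite (fubini_tonelli1 fb mfb fb0) (fubini_tonelli1 fb' mfb' fb'0) /fubini_F.
  rewrite (tonelli_rV mfb fb0).
  apply: eq_integral => x _; apply: eq_integral => y _.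
  by rewrite /fb /fb' /i1 /i2/= Wsym.
rewrite -ge0_integralD//.
pose f2 p := (fa p + fb' p)%E.
have mf2 : measurable_fun setT f2 by exact: emeasurable_funD.
have f20 p : (0 <= f2 p)%E by rewrite adde_ge0.
rewrite (fubini_tonelli1 f2 mf2 f20) /fubini_F.
transitivity (\int[mu]_x \int[mu]_h f2 (x, (h + x)%R))%E.
  apply: eq_integral => x _.
  rewrite (integral_translate (f := fun y => f2 (x, y)))//.
  exact: measurableT_comp.
rewrite (@tonelli_rV _ _ (fun p => f2 (p.1, p.2 + p.1)))/=; last 2 first.
- apply: (measurableT_comp mf2); apply: measurable_fun_pair => //.
  exact: measurable_add_rV.
- by move=> p; exact: f20.
apply: eq_integral => h _; apply: eq_integral => x _.
rewrite /f2 /fa /fb' /i1 /i2/= -EFinD (addrC h x); congr (_%:E); ring.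
Qed.

End symmetric_double_integral.

Section nonlocal.
Context (R : realType) (n : nat).
Variables (Omega : set 'rV[R]_n) (oO : open Omega).
Variables (u v : 'rV[R]_n -> R).
Hypotheses (mu : measurable_fun setT u) (mv : measurable_fun setT v).
Local Notation leb := (lebesgue_rV R n).

Let mO : measurable Omega. Proof. exact: open_measurable_rV. Qed.

Lemma measurable_sub_rV : measurable_fun setT (fun p : 'rV[R]_n * 'rV[R]_n => p.1 - p.2).
Proof.
apply: measurable_fun_rV => i.
rewrite (_ : _ \o _ = fun p => (coor i \o fst) p - (coor i \o snd) p); last first.
  by apply/funext => p /=; rewrite /coor !mxE.
by apply: measurable_funB; apply: measurableT_comp => //; exact: measurable_coor.
Qed.

Lemma measurable_diffq (w : 'rV[R]_n -> R) : measurable_fun setT w ->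
  measurable_fun setT (fun p : 'rV[R]_n * 'rV[R]_n => diffq w p.1 p.2).
Proof.
move=> mw; apply: measurable_funM.
  by apply: measurable_funB; exact: (measurableT_comp mw).
exact: (measurableT_comp (@measurable_enormV R n) measurable_sub_rV).
Qed.

Lemma diffqC (w : 'rV[R]_n -> R) x y : diffq w y x = - diffq w x y.
Proof. by rewrite /diffq -[y - x]opprB enormN -mulNr opprB. Qed.

Lemma diffqE (w : 'rV[R]_n -> R) x h : diffq w x (x + h) = - (incr w h x / enorm h).
Proof. by rewrite /diffq opprD addNKr enormN /incr -mulNr opprB. Qed.

Lemma nonlocal_integralE (s : R) : 0 <= s ->
  (\int[leb \x leb]_(p in Qset Omega)
      ((Gs n s (diffq u p.1 p.2) - Gs n s (diffq v p.1 p.2)) *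
       (diffq (u \- v) p.1 p.2 /
        enorm (p.1 - p.2) `^ (n%:R - 1 + 2 * s)))%R%:E =
  \int[leb]_h (Theta Omega u v s h * (enorm h `^ (- (n%:R - 1 + 2 * s)))%:E))%E.
Proof.
move=> s0; set q := n%:R - 1 + 2 * s.
pose W (p : 'rV[R]_n * 'rV[R]_n) := flux n s (diffq u p.1 p.2) (diffq v p.1 p.2) *
  enorm (p.1 - p.2) `^ (- q).
transitivity (\int[leb \x leb]_(p in Qset Omega) (W p)%:E)%E.
  apply: eq_integral => p _; congr (_%:E); rewrite /W /flux powRN -mulrA.
  by congr (_ * (_ / _)); rewrite /diffq -mulrBl/=; congr (_ / _); ring.
have mW : measurable_fun setT W.
  apply: measurable_funM.
    by apply: measurable_flux; exact: measurable_diffq.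
  apply: (measurableT_comp (measurable_powR _)).
  exact: (measurableT_comp (@measurable_enorm R n) measurable_sub_rV).
have W0 p : 0 <= W p by rewrite mulr_ge0 ?flux_ge0// powR_ge0.
have Wsym x y : W (x, y) = W (y, x).
  by rewrite /W/= (diffqC u) (diffqC v) fluxNN -[x - y]opprB enormN.
rewrite (integral_Qset mO mW W0 Wsym); apply: eq_integral => h _.
have mt : measurable_fun setT (fun x => (theta_density Omega u v s h x)%:E).
  by apply/measurable_EFinP; exact: measurable_theta_density.
rewrite -ge0_integralZr ?lee_fin ?powR_ge0//; last first.
  by move=> x _; rewrite lee_fin theta_density_ge0.
apply: eq_integral => x _; rewrite -EFinM; congr (_%:E).
rewrite /theta_density -[RHS]mulrA; congr (_ * _).
by rewrite /W/= !diffqE fluxNN opprD addNKr enormN.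
Qed.

Lemma measurable_Theta (s : R) : 0 <= s -> measurable_fun setT (Theta Omega u v s).
Proof.
move=> s0.
pose f (p : 'rV[R]_n * 'rV[R]_n) := (theta_density Omega u v s p.1 p.2)%:E.
apply: (measurable_fun_fubini_tonelli_F f); last first.
  by move=> p; rewrite lee_fin theta_density_ge0.
apply/measurable_EFinP.
have mI : measurable_fun setT (\1_Omega : 'rV[R]_n -> R) by exact: measurable_indic.
have mq (w : 'rV[R]_n -> R) : measurable_fun setT w ->
    measurable_fun setT (fun p : 'rV[R]_n * 'rV[R]_n => incr w p.1 p.2 / enorm p.1).
  move=> mw; apply: measurable_funM.
    apply: measurable_funB; first exact: (measurableT_comp mw (@measurable_add_rV R n)).
    exact: (measurableT_comp mw).
  exact: (measurableT_comp (@measurable_enormV R n)).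
apply: measurable_funM; last by apply: measurable_flux; exact: mq.
apply: measurable_funM; first exact: (measurableT_comp mI).
apply: measurable_funD => //; apply: measurable_funB => //.
exact: (measurableT_comp mI (@measurable_add_rV R n)).
Qed.

Lemma Theta_ge0 (s : R) h : 0 <= s -> (0 <= Theta Omega u v s h)%E.
Proof. by move=> s0; apply: integral_ge0 => x _; rewrite lee_fin theta_density_ge0. Qed.

End nonlocal.

(** * The spherical mean of Theta_0 and the local energy *)

Section limit_density.
Context (R : realType) (n : nat).
Variables (Omega : set 'rV[R]_n.+1) (oO : open Omega).
Variables (a b : 'rV[R]_n.+1 -> 'rV[R]_n.+1).
Hypotheses (ma : measurable_field a) (mb : measurable_field b).
Hypotheses (Na : (N2 (fun x => enorm (a x)) < +oo)%E) (Nb : (N2 (fun x => enorm (b x)) < +oo)%E).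
Local Notation leb := (lebesgue_rV R n.+1).

Let mO : measurable Omega. Proof. exact: open_measurable_rV. Qed.

Definition local_density (x : 'rV[R]_n.+1) : R :=
  enorm (nu_hat (a x) - nu_hat (b x)) ^+ 2 * ((Qarea (a x) + Qarea (b x)) / 2).

Lemma local_density_ge0 x : 0 <= local_density x.
Proof. by rewrite mulr_ge0 ?sqr_ge0// divr_ge0// addr_ge0// ltW// Qarea_gt0. Qed.

Lemma measurable_local_density : measurable_fun setT local_density.
Proof.
have mc (c : 'rV[R]_n.+1 -> 'rV[R]_n.+1) : measurable_field c ->
    measurable_fun setT (fun x => (Qarea (c x))^-1).
  move=> mc; under eq_fun do rewrite QareaV.
  apply: (measurableT_comp (measurable_powR _)); apply: measurable_funD => //.
  by apply: measurable_sum => i; apply: measurable_funM; exact: mc.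
rewrite (_ : local_density = fun x =>
    dotv ((Qarea (a x))^-1 *: a x - (Qarea (b x))^-1 *: b x) (a x - b x)); last first.
  by apply/funext => x; rewrite nu_hat_dotv.
apply: measurable_sum => i.
apply: measurable_funM; last exact: measurable_fieldB.
rewrite (_ : (fun x => _) = fun x =>
    (Qarea (a x))^-1 * a x ord0 i - (Qarea (b x))^-1 * b x ord0 i); last first.
  by apply/funext => x; rewrite !mxE.
by apply: measurable_funB; apply: measurable_funM => //; exact: mc.
Qed.

Lemma measurable_theta0_joint :
  measurable_fun setT (fun p : 'rV[R]_n.+1 * 'rV[R]_n.+1 => theta0_density Omega a b p.1 p.2).
Proof.
have md (c : 'rV[R]_n.+1 -> 'rV[R]_n.+1) : measurable_field c ->
    measurable_fun setT (fun p : 'rV[R]_n.+1 * 'rV[R]_n.+1 => dotv (c p.2) (unitv p.1)).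
  move=> mc; apply: measurable_sum => i; apply: measurable_funM.
    exact: (measurableT_comp (mc i)).
  under eq_fun do rewrite mxE; apply: measurable_funM.
    exact: (measurableT_comp (@measurable_enormV R n.+1)).
  exact: (measurableT_comp (measurable_coor i)).
apply: measurable_funM; last by apply: measurable_flux; exact: md.
by apply: (measurableT_comp (measurable_indic _)).
Qed.

Lemma Theta0_ge0 h : (0 <= Theta0 Omega a b h)%E.
Proof. by apply: integral_ge0 => x _; rewrite lee_fin theta0_density_ge0. Qed.

Lemma measurable_Theta0 : measurable_fun setT (Theta0 Omega a b).
Proof.
apply: (measurable_fun_fubini_tonelli_F
  (fun p : 'rV[R]_n.+1 * 'rV[R]_n.+1 => (theta0_density Omega a b p.1 p.2)%:E)); last first.
  by move=> p; rewrite lee_fin theta0_density_ge0.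
by apply/measurable_EFinP; exact: measurable_theta0_joint.
Qed.

Lemma Theta0Z c h : 0 < c -> Theta0 Omega a b (c *: h) = Theta0 Omega a b h.
Proof.
by move=> c0; apply: eq_integral => x _; rewrite /theta0_density unitvZ.
Qed.

Lemma Theta0_le h : (Theta0 Omega a b h <= N2 (fun x => enorm (a x - b x)))%E.
Proof.
have me : measurable_fun setT (fun x => enorm (a x - b x)).
  by apply: measurable_field_enorm; exact: measurable_fieldB.
apply: ge0_le_integral => //.
- by move=> x _; rewrite lee_fin theta0_density_ge0.
- by apply/measurable_EFinP; exact: measurable_theta0_density.
- exact: measurable_sqr_EFin.
move=> x _; rewrite lee_fin /theta0_density -[leRHS]mul1r.
have h0 : 0 <= 1 / 2 :> R by rewrite divr_ge0.
apply: ler_pM => //; first exact: flux_ge0.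
apply: (le_trans (flux_le _ _ _ h0)).
rewrite -dotvNl -dotvDl -(real_normK (num_real _)).
by rewrite ler_pXn2r ?nnegrE ?enorm_ge0// dotv_unitv_le.
Qed.

(** After Tonelli the direction is integrated first, at fixed x, where [integral_pball_Gs] and
    [nu_hat_dotv] produce the local density. *)
Lemma integral_pball_Theta0 :
  (\int[leb]_(k in pball R n.+1) Theta0 Omega a b k =
   (ball_volume R n.+1 / n.+1%:R)%:E * \int[leb]_(x in Omega) (local_density x)%:E)%E.
Proof.
pose f (p : 'rV[R]_n.+1 * 'rV[R]_n.+1) :=
  (\1_(pball R n.+1) p.1 * theta0_density Omega a b p.1 p.2)%:E.
have mB := @measurable_pball R n.+1.
have mf : measurable_fun setT f.
  apply/measurable_EFinP; apply: measurable_funM; last exact: measurable_theta0_joint.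
  exact: (measurableT_comp (measurable_indic _)).
have f0 p : (0 <= f p)%E.
  by rewrite lee_fin mulr_ge0 ?theta0_density_ge0.
transitivity (\int[leb]_k \int[leb]_x f (k, x))%E.
  rewrite integral_mkcond; apply: eq_integral => k _.
  rewrite patchE /f/= indicE; case: ifPn => kB.
    by apply: eq_integral => x _; rewrite mul1r.
  by rewrite integral0_eq// => x _; rewrite mul0r.
rewrite (tonelli_rV mf f0).
have md := measurable_local_density.
transitivity (\int[leb]_x ((ball_volume R n.+1 / n.+1%:R)%:E *
    (\1_Omega x * local_density x)%:E))%E; last first.
  rewrite ge0_integralZl//.
  - congr (_ * _)%E; rewrite [RHS]integral_mkcond; apply: eq_integral => x _.
    by rewrite patchE indicE; case: ifPn => _; rewrite ?mul1r ?mul0r.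
  - by apply/measurable_EFinP; apply: measurable_funM => //; exact: measurable_indic.
  - by move=> x _; rewrite lee_fin mulr_ge0// local_density_ge0.
  - by rewrite lee_fin divr_ge0// ltW// ball_volume_gt0.
apply: eq_integral => x _.
transitivity (\int[leb]_(k in pball R n.+1) (theta0_density Omega a b k x)%:E)%E.
  rewrite [RHS]integral_mkcond; apply: eq_integral => k _.
  by rewrite patchE /f/= indicE; case: ifPn => _; rewrite ?mul1r ?mul0r.
rewrite /theta0_density indicE; case: (x \in Omega); last first.
  by rewrite mul0r mule0 integral0_eq// => k _; rewrite mul0r.
rewrite [true%:R * local_density x]mul1r -EFinM /local_density -nu_hat_dotv.
rewrite -integral_pball_Gs; apply: eq_integral => k _.
by rewrite [_ * flux _ _ _ _]mul1r.
Qed.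

(** Read backwards from the previous identity: Theta_0 is bounded by the squared L^2 norm of a - b
    and the ball has finite measure, so the left side is finite, and the factor on the right is
    positive. *)
Lemma local_integral_fin : (\int[leb]_(x in Omega) (local_density x)%:E < +oo)%E.
Proof.
have an0 : 0 < ball_volume R n.+1 / n.+1%:R by rewrite divr_gt0// ball_volume_gt0.
have fin : (\int[leb]_(k in pball R n.+1) Theta0 Omega a b k < +oo)%E.
  have Nfin := N2_enormB_fin ma mb Na Nb.
  have NE : N2 (fun x => enorm (a x - b x)) = (fine (N2 (fun x => enorm (a x - b x))))%:E.
    by rewrite fineK// ge0_fin_numE ?N2_ge0.
  apply: (@le_lt_trans _ _ (\int[leb]_(k in pball R n.+1) (fine (N2 (fun x => enorm (a x - b x))))%:E)%E).
    apply: ge0_le_integral => //.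
    - exact: measurable_pball.
    - by move=> k _; exact: Theta0_ge0.
    - by apply: measurable_funTS; exact: measurable_Theta0.
    - by move=> k _; rewrite -NE; exact: Theta0_le.
  rewrite integral_cst; last exact: measurable_pball.
  by apply: lte_mul_pinfty; rewrite ?lee_fin ?fine_ge0 ?N2_ge0//; exact: pball_fin.
move: fin; rewrite integral_pball_Theta0; case: (integral _ _ _) => [r _|h|//].
  exact: ltry.
by move: h; rewrite gt0_muley ?lte_fin.
Qed.

End limit_density.

(** * Two-sided bounds on the squared nonlocal energy *)

Section energy_limit.
Context (R : realType) (n : nat).
Variables (Omega : set 'rV[R]_n.+1) (oO : open Omega).
Variables (u v : 'rV[R]_n.+1 -> R) (a b : 'rV[R]_n.+1 -> 'rV[R]_n.+1).
Hypotheses (mu : measurable_fun setT u) (mv : measurable_fun setT v).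
Hypotheses (Nu : (N2 u < +oo)%E) (Nv : (N2 v < +oo)%E).
Hypotheses (ma : measurable_field a) (mb : measurable_field b).
Hypotheses (Na : (N2 (fun x => enorm (a x)) < +oo)%E) (Nb : (N2 (fun x => enorm (b x)) < +oo)%E).
Hypothesis Du : forall eta : R, 0 < eta -> exists2 delta : R, 0 < delta &
  forall h, enorm h < delta -> (N2 (remainder u a h) <= (eta * enorm h ^+ 2)%:E)%E.
Hypothesis Dv : forall eta : R, 0 < eta -> exists2 delta : R, 0 < delta &
  forall h, enorm h < delta -> (N2 (remainder v b h) <= (eta * enorm h ^+ 2)%:E)%E.
Local Notation leb := (lebesgue_rV R n.+1).
Local Notation N := (n.+1%:R : R).
Local Notation alpha := (ball_volume R n.+1).

Definition nonlocal_energy (s : R) : \bar R := ((Cds n.+1 s)%:E *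
  \int[leb]_h (Theta Omega u v s h * (enorm h `^ (- (N - 1 + 2 * s)))%:E))%E.

Definition local_energy : R :=
  fine (\int[leb]_(x in Omega) (local_density a b x)%:E)%E.

Lemma local_energyE : (\int[leb]_(x in Omega) (local_density a b x)%:E = local_energy%:E)%E.
Proof.
rewrite fineK// ge0_fin_numE; first exact: local_integral_fin.
by apply: integral_ge0 => x _; rewrite lee_fin local_density_ge0.
Qed.

Lemma local_energy_ge0 : 0 <= local_energy.
Proof. by rewrite fine_ge0//; apply: integral_ge0 => x _; rewrite lee_fin local_density_ge0. Qed.

Lemma measurable_enorm_range (delta : R) :
  measurable [set h : 'rV[R]_n.+1 | 0 < enorm h <= delta] /\
  measurable [set h : 'rV[R]_n.+1 | delta < enorm h].
Proof.
split.
  rewrite (_ : [set _ | _] = setT `&` @enorm R n.+1 @^-1` `]0, delta]).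
    exact: measurable_enorm.
  by apply/seteqP; split => x /=; rewrite in_itv/=; [|case].
rewrite (_ : [set _ | _] = setT `&` @enorm R n.+1 @^-1` `]delta, +oo[).
  exact: measurable_enorm.
by apply/seteqP; split => x /=; rewrite in_itv/= andbT; [|case].
Qed.

(** The radial integral is N delta^(1-2s) / (1 - 2s); the constant [Cds] cancels 1 - 2s, and the
    hypothesis on g cancels alpha and N. No error term arises. *)
Lemma near_integral (g : 'rV[R]_n.+1 -> \bar R) (G delta s : R) :
  measurable_fun setT g -> (forall x, (0 <= g x)%E) ->
  (forall c x, 0 < c -> g (c *: x) = g x) -> s < 1 / 2 -> 0 < delta ->
  (\int[leb]_(k in pball R n.+1) g k = (alpha / N * G)%:E)%E ->
  ((Cds n.+1 s)%:E * \int[leb]_(h in [set h | (0 < enorm h <= delta)%R])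
      (g h * (enorm h `^ (- (N - 1 + 2 * s)))%:E) = (delta `^ (1 - 2 * s) * G)%:E)%E.
Proof.
move=> mg g0 gh s1 d0 gE.
rewrite integral_radial_near//; last by lra.
rewrite gE -!EFinM /Cds; congr (_%:E).
have -> : N - (N - 1 + 2 * s) = 1 - 2 * s by ring.
have al0 : alpha != 0 by rewrite gt_eqF// ball_volume_gt0.
have N0 : N != 0 by rewrite pnatr_eq0.
have e0 : 1 - 2 * s != 0 by rewrite gt_eqF//; lra.
by field; rewrite nat1r ?al0 ?N0 ?e0.
Qed.

Lemma Cds_ge0 (s : R) : s <= 1 / 2 -> 0 <= Cds n.+1 s.
Proof. by move=> s1; apply: divr_ge0; [lra|exact/ltW/ball_volume_gt0]. Qed.

(** Near the origin [Theta_close] sandwiches Theta_s around Theta_0 and [near_integral] evaluates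
    the bounds; [Theta_far] controls the rest. As delta does not depend on s, letting s tend to 1/2
    leaves only an error N rho. *)
Lemma energy_bounds (rho : R) : 0 < rho -> exists2 delta : R, 0 < delta <= 1 &
  exists2 eta : R, 0 < eta & forall s : R, 0 <= s -> s < 1 / 2 -> (1 - 2 * s) / 2 <= eta ->
    (nonlocal_energy s <= (delta `^ (1 - 2 * s) * (local_energy + N * rho) +
       (1 - 2 * s) * (8 * fine (N2 (fun x => u x - v x)%R) * N * delta `^ (- 2)))%:E)%E /\
    ((delta `^ (1 - 2 * s) * local_energy)%:E <= nonlocal_energy s +
       (delta `^ (1 - 2 * s) * (N * rho))%:E)%E.
Proof.
move=> rho0.
have [delta /andP[d0 d1] [eta eta0 close]] :=
  Theta_close (ltn0Sn n) oO mu mv ma mb Na Nb Du Dv rho0.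
exists delta; first by rewrite d0.
exists eta => // s s0 s1 es.
have [mnear mfar] := measurable_enorm_range delta.
have sle : s <= 1 / 2 by exact: ltW.
set q := N - 1 + 2 * s.
have C0 := Cds_ge0 sle.
pose K := fine (N2 (fun x => u x - v x)).
have mw : measurable_fun setT (fun x => u x - v x) by exact: measurable_funB.
have KE : N2 (fun x => u x - v x) = K%:E.
  rewrite fineK// ge0_fin_numE ?N2_ge0//.
  apply: (le_lt_trans (N2D mu (measurable_funN mv))).
  by rewrite N2N; apply: lte_add_pinfty; apply: lte_mul_pinfty => //; rewrite lee_fin.
have K0 : 0 <= K by rewrite fine_ge0// N2_ge0.
have mT := measurable_Theta oO mu mv s0.
have T0 h := Theta_ge0 Omega u v h s0.
have mT0 := measurable_Theta0 oO ma mb.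
have T00 h := Theta0_ge0 Omega a b h.
have mp : measurable_fun setT (fun h : 'rV[R]_n.+1 => (enorm h `^ (- q))%:E).
  apply/measurable_EFinP; apply: (measurableT_comp (measurable_powR _)).
  exact: measurable_enorm.
have p0 h : (0 <= (@enorm R n.+1 h `^ (- q))%:E)%E by rewrite lee_fin powR_ge0.
pose nearI (g : 'rV[R]_n.+1 -> \bar R) :=
  (\int[leb]_(h in [set h | (0 < enorm h <= delta)%R]) (g h * (enorm h `^ (- q))%:E))%E.
pose farI := (\int[leb]_(h in [set h | (delta < enorm h)%R])
  (Theta Omega u v s h * (enorm h `^ (- q))%:E))%E.
have nE0 : (nonlocal_energy s = (Cds n.+1 s)%:E * nearI (Theta Omega u v s) +
    (Cds n.+1 s)%:E * farI)%E.
  rewrite /nonlocal_energy -ge0_muleDr; last 2 first.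
  - by apply: integral_ge0 => h _; rewrite mule_ge0.
  - by apply: integral_ge0 => h _; rewrite mule_ge0.
  congr (_ * _)%E.
  rewrite integral_origin//; last 2 first.
  - exact: emeasurable_funM.
  - by move=> h _; rewrite mule_ge0.
  rewrite setTI -ge0_integral_setU//.
  - congr (integral _ _ _); apply/seteqP; split => h /=.
      by move=> h0; have [hd|hd] := leP (enorm h) delta; [left; rewrite h0|right].
    by move=> [/andP[]//|]; exact: lt_trans.
  - by apply: measurable_funTS; exact: emeasurable_funM.
  - by move=> h _; rewrite mule_ge0.
  - by apply/disj_setPS => h [/= /andP[_ hd]]; rewrite ltNge hd.
have farle : ((Cds n.+1 s)%:E * farI <=
    ((1 - 2 * s) * (8 * K * N * delta `^ (- 2)))%:E)%E.
  have farle1 : (farI <= (8 * K)%:E * \int[leb]_(h in [set h | (delta < enorm h)%R])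
      (enorm h `^ (- (q + 2)))%:E)%E.
    have mp2 : measurable_fun [set h : 'rV[R]_n.+1 | delta < enorm h]
        (fun h : 'rV[R]_n.+1 => (enorm h `^ (- (q + 2)))%:E).
      apply: measurable_funTS; apply/measurable_EFinP.
      apply: (measurableT_comp (measurable_powR _)); exact: measurable_enorm.
    rewrite -ge0_integralZl//; last 2 first.
    - by move=> h _; rewrite lee_fin powR_ge0.
    - by rewrite lee_fin mulr_ge0.
    apply: ge0_le_integral => //.
    - by move=> h _; rewrite mule_ge0.
    - by apply: measurable_funTS; exact: emeasurable_funM.
    - exact: measurable_funeM.
    move=> h /= hd; have h0 : 0 < enorm h by exact: lt_trans hd.
    have hN0 : h != 0 by rewrite -enorm_gt0.
    apply: (@le_trans _ _ ((8 * ((enorm h)^-1 ^+ 2 * K))%:E * (enorm h `^ (- q))%:E)%E).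
      apply: lee_pmul => //.
      by rewrite !EFinM -KE; exact: Theta_far.
    rewrite -!EFinM lee_fin [- (q + 2)]opprD powRD; last by rewrite (gt_eqF h0) implybT.
    rewrite (powRN _ 2) powR_mulrn ?(ltW h0)// exprVn le_eqVlt; apply/orP; left; apply/eqP; ring.
  apply: (@le_trans _ _ ((Cds n.+1 s)%:E * ((8 * K)%:E *
     (alpha * (N * (delta `^ (- (q + 2 - N)) / (q + 2 - N))))%:E))%E).
    apply: lee_wpM2l_EFin => //; first by apply: integral_ge0 => h _; rewrite mule_ge0.
    by rewrite -integral_radial_far//; rewrite /q; lra.
  rewrite -!EFinM lee_fin.
  have -> : q + 2 - N = 1 + 2 * s by rewrite /q; ring.
  have -> : Cds n.+1 s * (8 * K * (alpha * (N * (delta `^ (- (1 + 2 * s)) / (1 + 2 * s))))) =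
    (1 - 2 * s) * (8 * K * N * (delta `^ (- (1 + 2 * s)) / (1 + 2 * s))).
    have al0 : alpha != 0 by rewrite gt_eqF// ball_volume_gt0.
    have e0 : 1 + 2 * s != 0 by rewrite gt_eqF//; lra.
    by rewrite /Cds; field; rewrite ?al0 ?e0.
  apply: ler_wpM2l; first by lra.
  apply: ler_wpM2l; first by rewrite !mulr_ge0.
  (* Removes s from the far constant: 1 + 2s >= 1 in the denominator, and 1 + 2s <= 2 in the
     exponent with delta <= 1. *)
  apply: (@le_trans _ _ (delta `^ (- (1 + 2 * s)))).
    by rewrite ler_pdivrMr; [rewrite ler_peMr ?powR_ge0//|]; lra.
  by apply: ger_powR; rewrite ?d0//; lra.
pose T0r h := (Theta0 Omega a b h + rho%:E)%E.
have mT0r : measurable_fun setT T0r by exact: emeasurable_funD.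
have T0r0 h : (0 <= T0r h)%E by rewrite adde_ge0// lee_fin ltW.
have mB := @measurable_pball R n.+1.
(* The constant rho is also constant on rays, so [near_integral] treats it like Theta_0; its ball
   integral alpha rho, written alpha/N times N rho, is the source of the error N rho. *)
have irho : (\int[leb]_(k in pball R n.+1) (cst rho%:E) k = (alpha / N * (N * rho))%:E)%E.
  under eq_integral => k _ do rewrite -[cst rho%:E k]mule1.
  rewrite ge0_integralZl//; last by rewrite lee_fin ltW.
  rewrite integral_pball1// -EFinM; congr (_%:E); field.
  by rewrite nat1r pnatr_eq0.
have iT0 : (\int[leb]_(k in pball R n.+1) Theta0 Omega a b k = (alpha / N * local_energy)%:E)%E.
  by rewrite integral_pball_Theta0// local_energyE -EFinM.
have iT0r : (\int[leb]_(k in pball R n.+1) T0r k = (alpha / N * (local_energy + N * rho))%:E)%E.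
  rewrite ge0_integralD//; last 2 first.
  - exact: measurable_funTS.
  - by move=> k _; rewrite lee_fin ltW.
  by rewrite iT0 irho -EFinD mulrDr.
have nT0 := near_integral mT0 T00 (Theta0Z Omega a b) s1 d0 iT0.
have r0 : (0 <= rho%:E)%E by rewrite lee_fin ltW.
have T0rZ c h : 0 < c -> T0r (c *: h) = T0r h by move=> c0; rewrite /T0r Theta0Z.
have nrho := near_integral (measurable_cst rho%:E) (fun _ => r0)
  (fun _ _ _ => erefl) s1 d0 irho.
have nT0r := near_integral mT0r T0r0 T0rZ s1 d0 iT0r.
split.
- rewrite nE0 EFinD; apply: leeD => //.
  rewrite -nT0r.
  apply: lee_wpM2l_EFin => //; first by apply: integral_ge0 => h _; rewrite mule_ge0.
  apply: ge0_le_integral => //.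
  + by move=> h _; rewrite mule_ge0.
  + by apply: measurable_funTS; exact: emeasurable_funM.
  + by apply: measurable_funTS; exact: emeasurable_funM.
  move=> h /= hd; apply: lee_pmul => //.
  by have [] := close s h s0 sle es hd.
- rewrite -nrho -nT0 nE0.
  (* For the lower bound the nonnegative far part is dropped. *)
  apply: (@le_trans _ _ ((Cds n.+1 s)%:E * nearI (Theta Omega u v s) +
    (Cds n.+1 s)%:E * nearI (cst rho%:E))%E); last first.
    rewrite [leRHS]addeAC leeDl// mule_ge0 ?lee_fin//.
    by apply: integral_ge0 => h _; rewrite mule_ge0.
  rewrite -ge0_muleDr; last 2 first.
  - by apply: integral_ge0 => h _; rewrite mule_ge0.
  - by apply: integral_ge0 => h _; rewrite mule_ge0.
  apply: lee_wpM2l_EFin => //; first by apply: integral_ge0 => h _; rewrite mule_ge0.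
  rewrite -ge0_integralD//; last 4 first.
  - by move=> h _; rewrite mule_ge0.
  - by apply: measurable_funTS; exact: emeasurable_funM.
  - by move=> h _; rewrite mule_ge0.
  - by apply: measurable_funTS; exact: emeasurable_funM.
  apply: ge0_le_integral => //.
  + by move=> h _; rewrite mule_ge0.
  + by apply: measurable_funTS; exact: emeasurable_funM.
  + by apply: measurable_funTS; apply: emeasurable_funD; exact: emeasurable_funM.
  move=> h /= hd; rewrite -ge0_muleDl//; apply: lee_pmul => //.
  by have [] := close s h s0 sle es hd.
Qed.

End energy_limit.

Lemma nonlocal_energy_close (R : realType) n (Omega : set 'rV[R]_n.+1)
    (u v : 'rV[R]_n.+1 -> R) (a b : 'rV[R]_n.+1 -> 'rV[R]_n.+1) : open Omega ->
  measurable_fun setT u -> measurable_fun setT v -> (N2 u < +oo)%E -> (N2 v < +oo)%E ->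
  measurable_field a -> measurable_field b ->
  (N2 (fun x => enorm (a x)) < +oo)%E -> (N2 (fun x => enorm (b x)) < +oo)%E ->
  (forall eta : R, 0 < eta -> exists2 delta : R, 0 < delta &
    forall h, enorm h < delta -> (N2 (remainder u a h) <= (eta * enorm h ^+ 2)%:E)%E) ->
  (forall eta : R, 0 < eta -> exists2 delta : R, 0 < delta &
    forall h, enorm h < delta -> (N2 (remainder v b h) <= (eta * enorm h ^+ 2)%:E)%E) ->
  forall eps : R, 0 < eps -> exists2 kappa : R, 0 < kappa &
    forall s : R, 0 <= s -> s < 1 / 2 -> 1 - 2 * s <= kappa ->
      nonlocal_energy Omega u v s \is a fin_num /\
      `|local_energy Omega a b - fine (nonlocal_energy Omega u v s)| <= eps.
Proof.
move=> oO mu mv Nu Nv ma mb Na Nb Du Dv eps eps0.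
set L := local_energy Omega a b.
have L0 : 0 <= L by exact: local_energy_ge0.
have N0 : 0 < n.+1%:R :> R by [].
pose rho := eps / (2 * n.+1%:R).
have rho0 : 0 < rho by rewrite divr_gt0// mulr_gt0.
have Nrho : n.+1%:R * rho = eps / 2 by rewrite /rho; field; rewrite nat1r gt_eqF.
have [delta /andP[d0 d1] [eta eta0 bounds]] :=
  energy_bounds oO mu mv Nu Nv ma mb Na Nb Du Dv rho0.
set M := 8 * fine (N2 (fun x => u x - v x)) * n.+1%:R * delta `^ (- 2) in bounds.
have M0 : 0 <= M by rewrite !mulr_ge0 ?powR_ge0// fine_ge0// N2_ge0.
have ln0 : ln delta <= 0 by exact: ln_le0.
have LN0 : 0 <= L * - ln delta by rewrite mulr_ge0// oppr_ge0.
(* The three bounds on e = 1 - 2s respectively allow [energy_bounds], make the far term e M at most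
   eps/2, and make the loss L (1 - delta^e) <= e L (- ln delta) at most eps/2. The added 1 keeps
   each denominator positive. *)
pose kappa := Num.min (2 * eta) (Num.min (eps / (2 * (M + 1))) (eps / (2 * (L * - ln delta + 1)))).
exists kappa.
  by rewrite !lt_min mulr_gt0//= !divr_gt0// mulr_gt0// ltr_wpDl.
move=> s s0 s1 sk.
set e := 1 - 2 * s in sk *.
have e0 : 0 < e by rewrite /e; lra.
have k1 : e <= 2 * eta by rewrite (le_trans sk)// ge_min lexx.
have k2 : e <= eps / (2 * (M + 1)) by rewrite (le_trans sk)// !ge_min lexx !orbT.
have k3 : e <= eps / (2 * (L * - ln delta + 1)) by rewrite (le_trans sk)// !ge_min lexx !orbT.
have eM : e * M <= eps / 2.
  move: k2; rewrite ler_pdivlMr ?mulr_gt0 ?ltr_wpDl// => k2.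
  have -> : e * M = (e * (2 * (M + 1))) / 2 - e by field.
  by lra.
have eL : e * (L * - ln delta) <= eps / 2.
  move: k3; rewrite ler_pdivlMr ?mulr_gt0 ?ltr_wpDl// => k3.
  have -> : e * (L * - ln delta) = (e * (2 * (L * - ln delta + 1))) / 2 - e by field.
  by lra.
have es : (1 - 2 * s) / 2 <= eta by rewrite -/e; lra.
have [] := bounds s s0 s1 es; rewrite -/e => up low.
have D1 : delta `^ e <= 1.
  by rewrite -[leRHS](powRr0 delta); apply: ger_powR; rewrite ?d0// ltW.
(* Quantitative form of delta^e tending to 1 as e tends to 0, from exp x >= 1 + x. *)
have D2 : 1 + e * ln delta <= delta `^ e.
  by rewrite /powR gt_eqF//; exact: expR_ge1Dx.
have D0 : 0 <= delta `^ e by exact: powR_ge0.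
have ne0 : (0 <= nonlocal_energy Omega u v s)%E.
  rewrite mule_ge0 ?lee_fin ?Cds_ge0//; first exact: ltW.
  by apply: integral_ge0 => h _; rewrite mule_ge0 ?Theta_ge0// lee_fin powR_ge0.
have fin : nonlocal_energy Omega u v s \is a fin_num.
  by rewrite ge0_fin_numE//; apply: (le_lt_trans up); exact: ltry.
split => //.
move: up low; rewrite -(fineK fin) -EFinD !lee_fin /=.
set S := fine _; rewrite Nrho -/L => up low.
have h1 : delta `^ e * (L + eps / 2) <= L + eps / 2.
  by rewrite ler_piMl// addr_ge0// divr_ge0// ltW.
have h2 : delta `^ e * (eps / 2) <= eps / 2 by rewrite ler_piMl// divr_ge0// ltW.
have h3 : L - eps / 2 <= delta `^ e * L.
  have h4 : (1 + e * ln delta) * L <= delta `^ e * L by exact: ler_wpM2r.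
  apply: le_trans h4; have -> : (1 + e * ln delta) * L = L - e * (L * - ln delta) by ring.
  by lra.
by rewrite ler_norml; apply/andP; split; lra.
Qed.

Theorem theorem5p12 (R : realType) (d : nat) (Omega Lambda : set 'rV[R]_d)
    (u v : 'rV[R]_d -> R) :
  (0 < d)%N ->
  bounded_set Omega ->
  lipschitz_domain Omega ->
  bounded_set Lambda ->
  Omega `<=` Lambda ->
  H10 Lambda u ->
  H10 Lambda v ->
  e_nonlocal Omega s u v @[s --> (1 / 2 : R)^'-] --> e_local Omega u v.
Proof.
case: d Omega Lambda u v => // n Omega Lambda u v _ _ [_ oO _ _] _ _ Hu Hv.
have [/H1_facts[mu Nu ma Na] _ _] := Hu; have [/H1_facts[mv Nv mb Nb] _ _] := Hv.
have h12 : (1 / 2 : R) = 2^-1 by rewrite mul1r.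
have -> : e_local Omega u v =
    (Num.sqrt (local_energy Omega (weak_gradient u) (weak_gradient v)))%:E.
  rewrite /e_local (local_energyE oO ma mb Na Nb) poweR_EFin h12 powR12_sqrt//.
  exact: local_energy_ge0.
have close := nonlocal_energy_close oO mu mv Nu Nv ma mb Na Nb
  (fun eta => H10_difference Hu) (fun eta => H10_difference Hv).
have near12 (k : R) : 0 < k -> \forall s \near (1 / 2 : R)^'-, [/\ 0 <= s, s < 1 / 2 & 1 - 2 * s <= k].
  move=> k0; near=> s; split.
  - by apply/ltW; near: s; apply: nbhs_left_gt; lra.
  - by near: s; exact: nbhs_left_lt.
  - suff : 1 / 2 - k / 2 < s by lra.
    by near: s; apply: nbhs_left_gt; lra.
(* Finiteness of the nonlocal energy is established only for s close to 1/2, so the passage to a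
   real square root is made eventually; any tolerance, here 1, provides it. *)
have E : \forall s \near (1 / 2 : R)^'-, (Num.sqrt (fine (nonlocal_energy Omega u v s)))%:E =
    e_nonlocal Omega s u v.
  have [k k0 H] := close 1 ltr01.
  apply: filterS (near12 _ k0) => s [s0 s1 sk].
  have [fin _] := H s s0 s1 sk.
  rewrite /e_nonlocal nonlocal_integralE// -/(nonlocal_energy Omega u v s).
  rewrite -[in RHS](fineK fin) poweR_EFin h12 powR12_sqrt// fine_ge0//.
  rewrite mule_ge0 ?lee_fin ?Cds_ge0//; first exact: ltW.
  by apply: integral_ge0 => h _; rewrite mule_ge0 ?Theta_ge0// lee_fin powR_ge0.
apply: (cvg_trans (near_eq_cvg E)).
apply: cvg_EFin; first by near=> s.
apply: (@cvg_comp _ _ _ (fun s => fine (nonlocal_energy Omega u v s)) Num.sqrt _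
  (nbhs (local_energy Omega (weak_gradient u) (weak_gradient v)))); last exact: sqrt_continuous.
apply/cvgrPdist_le => eps eps0.
have [k k0 H] := close eps eps0.
by apply: filterS (near12 _ k0) => s [s0 s1 sk]; have [] := H s s0 s1 sk.
Unshelve. all: by end_near. Qed.
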